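(* Fix an integer $d>0$ and let $K$ be a (not necessarily locally compact) flag simplicial complex equipped with a CAT(0) metric $d_K$ with $d$-bounded, thick shapes. Then there exists a quadratic function $f\colon\mathbb{N}\to\mathbb{N}$ such that whenever $X$ is a finite connected $d$-dimensional simplicial complex and $g\colon X\to K$ is a simplicial map, there is a triangulation $P$ of the cone $CX$ of $X$ and a simplicial map $g'\colon P\to K$ such that $g'|_X=g$ and $|P|\leq f(|X|)$.
   Context: $K$ denotes the simplicial complex, the topological space determined by it, and the metric space $(K,d_K)$. A complex is flag if every finite set of pairwise adjacent vertices spans a simplex. Simplicial maps send the vertex set of each simplex to a set of vertices spanning a simplex (collapsing allowed). $(K,d_K)$ has $d$-bounded shapes if for every $\delta>0$ there is a subdivision of the $d$-skeleton $K^{(d)}$ into a collection of smaller simplices, each of diameter at most $\delta$, such that every simplex of $K^{(d)}$ is subdivided into a uniformly bounded number of simplices, the bound depending only on $K$ and $\delta$. For $A\subset K$, $N_\epsilon(A)$ is the closed $\epsilon$-neighbourhood of $A$. Let $\tilde K$ be the first barycentric subdivision of $K$ and, for a vertex $v\in K^{(0)}$, let $N(v)$ be the closure of the union of the simplices $\tilde\Delta$ of $\tilde K$ with $v\in\tilde\Delta$. $K$ has thick shapes if there exists $\epsilon>0$ such that for every vertex $v$ and every simplex $\Delta$ of $K$, if $N_\epsilon(N(v))\cap\Delta\neq\emptyset$ then $v\in\Delta^{(0)}$, that is, $v$ is a vertex of $\Delta$. The cone of $X$ is $CX=(X\times[0,1])/(X\times\{0\})$, and $X$ is identified with $X\times\{1\}\subset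 CX$. For an $m$-dimensional complex $Y$, $|Y|$ is the number of its $m$-simplices; so $|X|$ counts $d$-simplices and $|P|$ counts $(d+1)$-simplices.
   Formalization: Here ''d-dimensional'' X means pure: every simplex of X is a face of a d-simplex; for d ≥ 2 the claim fails otherwise (two triangles joined by a long edge path in the triangulated plane have |X| = 2 but need unboundedly large |P|). *)

(* Defs.v *)
From HB Require Import structures.
From mathcomp Require Import all_boot all_order all_algebra finmap.
From mathcomp Require Import generic_quotient.
From mathcomp Require Import all_classical all_reals all_analysis.

Set Implicit Arguments.
Unset Strict Implicit.
Unset Printing Implicit Defensive.

Import Order.TTheory GRing.Theory Num.Theory.
Import numFieldNormedType.Exports.

Local Open Scope classical_set_scope.
Local Open Scope fset_scope.
Local Open Scope quotient_scope.
Local Open Scope ring_scope.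

(* The type [V] is only an ambient type: the vertices of [K] are the [v] such
   that [K [fset v]] holds. *)
Record complex (V : choiceType) := Complex {
  simplex :> {fset V} -> Prop;
  simplex_neq0 : forall s, simplex s -> s != fset0;
  simplex_face : forall s t : {fset V},
    simplex s -> t `<=` s -> t != fset0 -> simplex t }.

(* Taking [u = v] in the second hypothesis says that the elements of [s] are
   vertices of [K]. *)
Definition flag (V : choiceType) (K : complex V) :=
  forall s : {fset V}, s != fset0 ->
    (forall u v, u \in s -> v \in s -> K [fset u; v]) -> K s.

Section Skeleton.
Variables (V : choiceType) (d : nat) (K : complex V).

Let skel (s : {fset V}) : Prop := K s /\ (#|` s| <= d.+1)%N.

Let skel_neq0 s : skel s -> s != fset0.
Proof. by move=> [Ks _]; exact: simplex_neq0 Ks. Qed.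

Let skel_face (s t : {fset V}) : skel s -> t `<=` s -> t != fset0 -> skel t.
Proof.
move=> [Ks cs] ts t0; split; first exact: simplex_face Ks ts t0.
exact: leq_trans (fsubset_leq_card ts) cs.
Qed.

Definition skeleton : complex V := Complex skel_neq0 skel_face.

End Skeleton.

Section BarycentricSubdivision.
Variables (V : choiceType) (K : complex V).

Let chain (c : {fset {fset V}}) : Prop :=
  [/\ c != fset0, forall s, s \in c -> K s &
      forall s t, s \in c -> t \in c -> s `<=` t \/ t `<=` s].

Let chain_neq0 c : chain c -> c != fset0. Proof. by case. Qed.

Let chain_face (c e : {fset {fset V}}) :
  chain c -> e `<=` c -> e != fset0 -> chain e.
Proof.
move=> [_ cK cc] /fsubsetP ec e0; split=> // [s /ec /cK //|s t /ec sc /ec tc].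
exact: cc.
Qed.

Definition barycentric_subdivision : complex {fset V} :=
  Complex chain_neq0 chain_face.

End BarycentricSubdivision.

(* Dimension [d] is meant in the homogeneous sense: every simplex is a face of
   a [d]-simplex. Otherwise the number of [d]-simplices does not control the
   complex: two [d]-simplices, [d >= 2], can be joined by an arbitrarily long
   path. *)
Definition dimensional (V : choiceType) (d : nat) (X : complex V) :=
  (exists s, X s) /\
  forall s, X s -> exists t : {fset V}, [/\ X t, #|` t| = d.+1 & s `<=` t].

Definition nb_simplices (T : finType) (m : nat) (X : complex T) : nat :=
  #|` fset_set [set s : {fset T} | X s /\ #|` s| = m.+1]|.

Definition simplicial (V W : choiceType) (X : complex V) (Y : complex W)
  (f : V -> W) := forall s, X s -> Y (f @` s).

Definition point (R : realType) (V : choiceType) := {fsfun V -> R with 0}.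

HB.instance Definition _ (R : realType) (V : choiceType) :=
  Choice.on (point R V).

Section Realization.
Variables (R : realType) (V : choiceType).
Implicit Types (K : complex V) (x : point R V).

Definition closed_simplex (s : {fset V}) : set (point R V) :=
  [set x | [/\ finsupp x `<=` s, forall v, 0 <= x v
             & \sum_(v <- finsupp x) x v = 1]].

Definition points K : set (point R V) :=
  [set x | exists2 s, K s & closed_simplex s x].

Definition realization K : Type := set_type (points K).

HB.instance Definition _ K := Choice.on (realization K).

Definition vertex_point (v : V) : point R V :=
  [fsfun [fsfun of _ => 0] with v |-> 1].

Definition barycenter (s : {fset V}) : point R V :=
  [fsfun v in s => (#|` s|%:R)^-1 | 0].

Definition affine_ext (W : choiceType) (p : W -> point R V) (x : point R W) :
    point R V :=
  [fsfun v in \bigcup_(w <- finsupp x) finsupp (p w) =>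
     \sum_(w <- finsupp x) x w * p w v | 0].

End Realization.

Arguments points R {V} K.
Arguments realization R {V} K.

(* [cell p t] is the simplex spanned by the points [p w], [w] in [t]. *)
Definition cell (R : realType) (V W : choiceType) (p : W -> point R V)
  (t : {fset W}) : set (point R V) := (affine_ext p @` closed_simplex t)%classic.

Record subdivision (R : realType) (V W : choiceType) (K : complex V)
    (L : complex W) (p : W -> point R V) : Prop := {
  subdivision_carrier : forall t, L t ->
    exists2 s, K s & forall w, w \in t -> closed_simplex s (p w);
  subdivision_bij : set_bij (points R L) (points R K) (affine_ext p) }.

Section RealizationMap.
Variables (R : realType) (V W : choiceType).

Lemma vertex_pointE (w v : W) : vertex_point R w v = (v == w)%:R.
Proof. by rewrite /vertex_point fsfun_withE fsfun0E; case: eqP. Qed.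

Lemma affine_ext_vertexE (f : V -> W) (x : point R V) (w : W) :
  affine_ext (fun v => vertex_point R (f v)) x w =
  \sum_(v <- finsupp x | f v == w) x v.
Proof.
rewrite /affine_ext fsfun_fun; case: ifPn => [_|wNs].
  rewrite [RHS]big_mkcond /=; apply: eq_bigr => v _.
  by rewrite vertex_pointE eq_sym; case: eqP => _; rewrite ?mulr1 ?mulr0.
rewrite big_seq_cond big1 // => v /andP[vx /eqP fvw].
case/negP: wNs; apply/bigfcupP; exists v; rewrite ?vx //.
by rewrite mem_finsupp vertex_pointE -fvw eqxx oner_eq0.
Qed.

Lemma affine_ext_vertex_points (X : complex V) (K : complex W) (f : V -> W)
    (x : point R V) : simplicial X K f -> points R X x ->
  points R K (affine_ext (fun v => vertex_point R (f v)) x).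
Proof.
move=> fXK [s Xs [xs x_ge0 x1]]; exists (f @` s); first exact: fXK.
set y := affine_ext _ x.
have ys : finsupp y `<=` (f @` finsupp x).
  apply/fsubsetP => w; rewrite mem_finsupp affine_ext_vertexE => yw.
  apply/negPn/negP => wNf; case/eqP: yw; rewrite big_seq_cond big1 //.
  by move=> v /andP[vx /eqP fvw]; case/negP: wNf; rewrite -fvw in_imfset.
split.
- apply: fsubset_trans ys _; apply/fsubsetP => w /imfsetP[v /= vx ->].
  by rewrite in_imfset //=; exact: (fsubsetP xs).
- by move=> w; rewrite affine_ext_vertexE sumr_ge0.
rewrite (big_fset_incl _ ys) /=; last first.
  by move=> w _; rewrite mem_finsupp negbK => /eqP.
rewrite -x1 (partition_big_imfset _ f) /=.
by apply: eq_bigr => w _; rewrite affine_ext_vertexE.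
Qed.

Definition realization_map (X : complex V) (K : complex W) (f : V -> W)
    (fXK : simplicial X K f) (x : realization R X) : realization R K :=
  exist (fun y => y \in points R K) _
    (mem_set (affine_ext_vertex_points fXK (set_mem (valP x)))).

End RealizationMap.

(* For a finite complex on [T], the topology of a subspace of R^T. *)
Definition polyhedron (R : realType) (T : finType) (X : complex T) : Type :=
  realization R X.

Definition coordinates (R : realType) (T : finType) (X : complex T)
  (x : polyhedron R X) : {ptws T -> R} := fun t => val x t.

HB.instance Definition _ (R : realType) (T : finType) (X : complex T) :=
  Choice.on (polyhedron R X).
HB.instance Definition _ (R : realType) (T : finType) (X : complex T) :=
  Topological.copy (polyhedron R X) (initial_topology (@coordinates R T X)).

Arguments polyhedron R {T} X.

Definition unit_interval (R : realType) : Type := set_type `[(0 : R), 1].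

HB.instance Definition _ (R : realType) := Topological.on (unit_interval R).

Fact unit_interval_1 (R : realType) : (1 : R) \in `[(0 : R), 1]%classic.
Proof. by apply/mem_set; rewrite /= in_itv /= ler01 lexx. Qed.

Section Cone.
Variables (R : realType) (Y : topologicalType).

Let cone_rel' (a b : Y * unit_interval R) : bool :=
  (a == b) || ((val a.2 == 0) && (val b.2 == 0)).

Let cone_rel_refl : reflexive cone_rel'.
Proof. by move=> a; rewrite /cone_rel' eqxx. Qed.

Let cone_rel_sym : symmetric cone_rel'.
Proof. by move=> a b; rewrite /cone_rel' eq_sym andbC. Qed.

Let cone_rel_trans : transitive cone_rel'.
Proof.
move=> b a c /predU1P[-> //|/andP[a0 b0]] /predU1P[<-|/andP[_ c0]];
  by rewrite /cone_rel' a0 ?b0 ?c0 orbT.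
Qed.

Definition cone_rel := EquivRel _ cone_rel_refl cone_rel_sym cone_rel_trans.

Definition cone : Type := {eq_quot cone_rel}.

HB.instance Definition _ := Topological.copy cone
  (quotient_topology {eq_quot cone_rel}).
HB.instance Definition _ := Quotient.copy cone {eq_quot cone_rel}.

Definition cone_base (y : Y) : cone :=
  \pi_cone (y, exist (fun s => s \in `[0, 1]%classic) 1 (unit_interval_1 R)).

End Cone.

Definition homeomorphism (Y Z : topologicalType) (h : Y -> Z) :=
  continuous h /\
  exists k : Z -> Y, [/\ continuous k, cancel h k & cancel k h].

(* A metric on the bare point set of a realization need not be related to the
   weak topology, from which it must differ when the complex is not locally
   finite. *)
Record metric (R : realType) (T : Type) := Metric {
  metric_dist :> T -> T -> R;
  metric_distxx : forall x, metric_dist x x = 0;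
  metric_dist_positivity : forall x y, metric_dist x y = 0 -> x = y;
  metric_dist_sym : forall x y, metric_dist x y = metric_dist y x;
  metric_dist_triangle : forall y x z,
    metric_dist x z <= metric_dist x y + metric_dist y z }.

Definition metrized (R : realType) (T : choiceType) (m : metric R T) : Type :=
  T.

HB.instance Definition _ (R : realType) (T : choiceType) (m : metric R T) :=
  Choice.copy (metrized m) T.
HB.instance Definition _ (R : realType) (T : choiceType) (m : metric R T) :=
  isMetric.Build R (metrized m) (@metric_distxx R T m)
    (@metric_dist_positivity R T m) (@metric_dist_sym R T m)
    (@metric_dist_triangle R T m).

Section CAT0.
Variables (R : realType) (M : metricType R).

Definition geodesic (x y : M) (c : R -> M) :=
  [/\ c 0 = x, c (mdist x y) = y &
      forall s t, 0 <= s <= mdist x y -> 0 <= t <= mdist x y ->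
        mdist (c s) (c t) = `|s - t|].

Definition plane_dist (a b : 'rV[R]_2) : R :=
  Num.sqrt (\sum_(k < 2) (a 0 k - b 0 k) ^+ 2).

(* The point of the segment [a, b] at distance [s] from [a]. *)
Definition segment_point (a b : 'rV[R]_2) (s : R) : 'rV[R]_2 :=
  a + (s / plane_dist a b) *: (b - a).

(* The triangle has vertices [x i] and sides [c i] from [x i] to
   [x (ordS i)], where [ordS] is the cyclic successor; [a] is a comparison
   triangle. *)
Definition CAT0 :=
  (forall x y : M, exists c, geodesic x y c) /\
  forall (x : 'I_3 -> M) (c : 'I_3 -> R -> M) (a : 'I_3 -> 'rV[R]_2),
    (forall i, geodesic (x i) (x (ordS i)) (c i)) ->
    (forall i, plane_dist (a i) (a (ordS i)) = mdist (x i) (x (ordS i))) ->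
    forall (i j : 'I_3) (s t : R),
      0 <= s <= mdist (x i) (x (ordS i)) ->
      0 <= t <= mdist (x j) (x (ordS j)) ->
      mdist (c i s) (c j t) <=
        plane_dist (segment_point (a i) (a (ordS i)) s)
                   (segment_point (a j) (a (ordS j)) t).

Definition closed_neighbourhood (e : R) (A : set M) : set M :=
  [set x | (ereal_inf [set (mdist x a)%:E | a in A] <= e%:E)%E].

End CAT0.

Section Shapes.
Variables (R : realType) (V : choiceType) (K : complex V).
Variable m : metric R (realization R K).

(* The points of [(K, m)] lying in a set of formal points. *)
Definition in_realization (A : set (point R V)) : set (metrized m) :=
  [set x | A (val (x : realization R K))].

Definition bounded_shapes (d : nat) :=
  forall delta : R, 0 < delta ->
  exists (N : nat) (W : choiceType) (L : complex W) (p : W -> point R V),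
  [/\ subdivision (skeleton d K) L p,
      forall t, L t -> forall x y : metrized m,
        in_realization (cell p t) x -> in_realization (cell p t) y ->
        mdist x y <= delta
    & forall s, skeleton d K s ->
        ([set t | L t /\ (cell p t `<=` closed_simplex s)%classic] #<= `I_N)%card].

Definition barycentric_star (v : V) : set (metrized m) :=
  closure (\bigcup_(c in [set c | barycentric_subdivision K c /\
                                  [fset v] \in c])
             in_realization (cell (@barycenter R V) c)).

Definition thick_shapes :=
  exists2 e : R, 0 < e & forall (v : V) (s : {fset V}),
    K [fset v] -> K s ->
    (closed_neighbourhood e (barycentric_star v) `&`
      in_realization (closed_simplex s) !=set0)%classic -> v \in s.

End Shapes.

(* [size q = 3] means that [q] has degree exactly 2. *)
Definition quadratic (f : nat -> nat) :=
  exists2 q : {poly rat}, size q = 3%N &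
    forall n : nat, (f n)%:R = q.[n%:R].

(* Main.v *)
(* Subdivide the simplices of [K] so finely that each cell has diameter at most
   delta = e / 2, where e is the thickness constant, and pull this subdivision
   back along [g] to a subdivision [Y] of [X] with O(|X|) simplices.  As [X] is
   connected, any two vertices of [Y] are joined by an edge path of length
   O(|X|), so their images in [K] are at distance at most delta * M with
   M = O(|X|).  Contract the image of [Y] along geodesics to one of its vertices
   and cut each geodesic into M equal parts: by the CAT(0) inequality, adjacent
   vertices of the cone over [Y], cut into M layers, go to points of [K] at
   distance at most e.  Label every such point by a vertex of [K] whose
   barycentric star contains it.  Thickness says that the labels of two points
   at distance at most e lie on a common simplex, so by flagness the labels form
   a simplicial map.  A last collar, whose outer side is [X] itself, joins [g]
   to the labels of [Y]; there are O(|X|^2) simplices altogether. *)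
Require Import Defs.
From mathcomp Require Import all_boot all_order all_algebra finmap.
From mathcomp Require Import generic_quotient.
From mathcomp Require Import all_classical all_reals all_analysis.
From mathcomp Require Import ring lra zify wochoice.

Set Implicit Arguments.
Unset Strict Implicit.
Unset Printing Implicit Defensive.

Import Order.TTheory GRing.Theory Num.Theory.
Import numFieldNormedType.Exports.
Import Defs.

Local Open Scope classical_set_scope.
Local Open Scope fset_scope.
Local Open Scope ring_scope.

(** Since [g] may collapse, the preimage of a cell of [K] in a simplex of [X] need not be a simplex
    and has to be triangulated coherently. A point [x] of [X] over the point of [K] with cell
    weights [l] is read as a transportation problem: over each vertex of [K], the mass supplied by
    [l] is matched with the mass of [x] in the fibre of [g]. For fixed total orders there is exactly
    one monotone solution, and its support is the simplex that contains [x]. The same pull-back,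
    applied to the map from the cone to an edge cut into M pieces, yields the layers. The collar is
    forced by the outer boundary, which must be [X] undivided and labelled by [g]. It causes no
    conflict: at the base, the label of a vertex of [Y] lies in the support of its image in [K], and
    this support is the [g]-image of the carrier of that vertex in [X]. The contraction is evaluated
    at vertices only, and only the labels of its values survive. Simplices are counted as subsets of
    boxes, a bounded number of vertices attached to each [d]-simplex on each layer; one factor |X|
    counts the [d]-simplices, the other the layers. *)

Lemma finsupp_fun_sub (R : realType) (V : choiceType) (S : {fset V}) (h : V ->
  R) :
  finsupp [fsfun v in S => h v | (0 : R)] `<=` S.
Proof.
apply/fsubsetP => v; rewrite mem_finsupp fsfun_fun.
by case: ifP => //; rewrite eqxx.
Qed.

(** * Finitely supported weights *)

Section Points.
Variables (R : realType) (V : choiceType).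
Implicit Types (x y z : point R V) (F G : V -> R).

(** The pairing of a weight with a function. Mass, coordinates and the coordinates of [affine_ext]
    are all values of it, so that their linearity and composition rules reduce to those of
    [fsum]. *)
Definition fsum x F : R := \sum_(v <- finsupp x) x v * F v.

Definition mass x : R := \sum_(v <- finsupp x) x v.

Definition pcomb (a : R) x (b : R) y : point R V :=
  [fsfun v in finsupp x `|` finsupp y => a * x v + b * y v | 0].

Lemma pcombE a x b y v : pcomb a x b y v = a * x v + b * y v.
Proof.
rewrite /pcomb fsfun_fun; case: ifPn => //; rewrite in_fsetU negb_or
  !memNfinsupp.
by move=> /andP[/eqP -> /eqP ->]; rewrite !mulr0 addr0.
Qed.

Lemma massE x : mass x = fsum x (fun=> 1).
Proof. by apply: eq_bigr => v _; rewrite mulr1. Qed.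

Lemma fsum_incl (D : {fset V}) x F :
  finsupp x `<=` D -> fsum x F = \sum_(v <- D) x v * F v.
Proof.
move=> xD; rewrite /fsum (big_fset_incl _ xD) // => v _.
by rewrite memNfinsupp => /eqP ->; rewrite mul0r.
Qed.

Lemma eq_fsum x F G : (forall v, v \in finsupp x -> F v = G v) ->
  fsum x F = fsum x G.
Proof. by move=> FG; apply: eq_big_seq => v /FG ->. Qed.

Lemma finsupp_pcomb a x b y :
  finsupp (pcomb a x b y) `<=` finsupp x `|` finsupp y.
Proof. exact: finsupp_fun_sub. Qed.

Lemma fsum_pcomb a x b y F :
  fsum (pcomb a x b y) F = a * fsum x F + b * fsum y F.
Proof.
rewrite (fsum_incl F (finsupp_pcomb a x b y)).
rewrite (fsum_incl F (fsubsetUl (finsupp x) (finsupp y))).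
rewrite (fsum_incl F (fsubsetUr (finsupp x) (finsupp y))).
rewrite !big_distrr -big_split /=; apply: eq_bigr => v _.
by rewrite pcombE; ring.
Qed.

Lemma mass_pcomb a x b y : mass (pcomb a x b y) = a * mass x + b * mass y.
Proof. by rewrite !massE fsum_pcomb. Qed.

Lemma finsupp_vertex (v : V) : finsupp (vertex_point R v) = [fset v].
Proof.
apply/fsetP => w; rewrite mem_finsupp vertex_pointE inE.
by rewrite pnatr_eq0 eqb0 negbK.
Qed.

Lemma fsum_vertex v F : fsum (vertex_point R v) F = F v.
Proof. by rewrite /fsum finsupp_vertex big_seq_fset1 vertex_pointE eqxx mul1r.
  Qed.

Lemma mass_vertex v : mass (vertex_point R v) = 1.
Proof. by rewrite massE fsum_vertex. Qed.

Lemma fsum_eq0 x F v : (forall v, 0 <= x v) -> (forall v, 0 <= F v) ->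
  fsum x F = 0 -> v \in finsupp x -> F v = 0.
Proof.
move=> x0 F0 /eqP; rewrite /fsum big_seq psumr_eq0 => [/allP /(_ v) h vx|w _].
  have := h vx; rewrite vx /= mulf_eq0 => /orP[|/eqP//].
  by move: vx; rewrite mem_finsupp => /negPf ->.
exact: mulr_ge0.
Qed.

Lemma fsum_delta x v : fsum x (fun w => (w == v)%:R) = x v.
Proof.
rewrite (fsum_incl _ (fsubsetUl _ [fset v])) (big_fsetD1 v) ?inE ?eqxx ?orbT
  //=.
rewrite mulr1 big1_fset ?addr0 // => w; rewrite !inE.
by move=> /andP[/negPf -> _] _; rewrite mulr0.
Qed.

Lemma mass_ge0 x : (forall v, 0 <= x v) -> 0 <= mass x.
Proof. by move=> x0; apply: sumr_ge0. Qed.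

Lemma mass_eq0 x : (forall v, 0 <= x v) -> mass x = 0 -> finsupp x = fset0.
Proof.
move=> x0; rewrite massE => h; apply/eqP/fset0Pn => -[v vx].
by have /eqP := fsum_eq0 x0 (fun=> ler01) h vx; rewrite oner_eq0.
Qed.

Lemma point_le_mass x v : (forall v, 0 <= x v) -> x v <= mass x.
Proof.
move=> x0; rewrite -fsum_delta massE; apply: ler_sum => w _.
by rewrite ler_wpM2l //; case: eqP.
Qed.

Lemma finsupp_eq0 x v : finsupp x = fset0 -> x v = 0.
Proof. by move=> h; apply/eqP; rewrite -memNfinsupp h. Qed.

Lemma point_gt0 x v : (forall v, 0 <= x v) -> (v \in finsupp x) = (0 < x v).
Proof. by move=> x0; rewrite mem_finsupp lt_def x0 andbT. Qed.

End Points.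

Section AffineExt.
Variables (R : realType) (V W : choiceType).
Implicit Types (x : point R W) (p : W -> point R V).

Lemma affine_extE p x v : affine_ext p x v = fsum x (fun w => p w v).
Proof.
rewrite /affine_ext fsfun_fun; case: ifPn => // vN.
rewrite /fsum big_seq big1 // => w wx; apply/eqP; rewrite mulf_eq0.
apply/orP; right; rewrite -memNfinsupp; apply: contra vN => vp.
by apply/bigfcupP; exists w; rewrite ?wx.
Qed.

Lemma fsum_affine_ext p x F :
  fsum (affine_ext p x) F = fsum x (fun w => fsum (p w) F).
Proof.
set D := \bigcup_(w <- finsupp x) finsupp (p w).
rewrite (@fsum_incl _ _ D) ?finsupp_fun_sub //.
under [RHS]eq_fsum => w wx.
  rewrite (@fsum_incl _ _ D); last first.
    by apply/fsubsetP => v vp; apply/bigfcupP; exists w; rewrite ?wx.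
  over.
rewrite /fsum; under [RHS]eq_bigr do rewrite big_distrr.
rewrite [RHS]exchange_big /=; apply: eq_bigr => v _.
rewrite affine_extE /fsum big_distrl; apply: eq_bigr => w _ /=; ring.
Qed.

Lemma mass_affine_ext p x :
  (forall w, w \in finsupp x -> mass (p w) = 1) ->
  mass (affine_ext p x) = mass x.
Proof.
move=> h; rewrite !massE fsum_affine_ext; apply: eq_fsum => w /h.
by rewrite massE.
Qed.

Lemma affine_ext_ge0 p x : (forall w, 0 <= x w) ->
  (forall w, w \in finsupp x -> forall v, 0 <= p w v) ->
  forall v, 0 <= affine_ext p x v.
Proof.
move=> x0 p0 v; rewrite affine_extE /fsum big_seq; apply: sumr_ge0 => w wx.
by rewrite mulr_ge0 ?p0.
Qed.

Lemma finsupp_affine_ext p x v : v \in finsupp (affine_ext p x) ->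
  exists2 w, w \in finsupp x & v \in finsupp (p w).
Proof.
move=> vx; have : v \in \bigcup_(w <- finsupp x) finsupp (p w).
  by move: vx; apply: (fsubsetP (finsupp_fun_sub _ _)).
by move=> /bigfcupP[w /andP[wx _] vw]; exists w.
Qed.

(** Nonnegative terms cannot cancel, so the support of an image is exactly the union of the supports
    of the vertices used. This is how statements about points become statements about carriers. *)
Lemma finsupp_affine_ext_sub p x w : (forall w, 0 <= x w) ->
  (forall w, w \in finsupp x -> forall v, 0 <= p w v) ->
  w \in finsupp x -> finsupp (p w) `<=` finsupp (affine_ext p x).
Proof.
move=> x0 p0 wx; apply/fsubsetP => v vp.
rewrite point_gt0; last exact: affine_ext_ge0.
rewrite affine_extE /fsum (big_fsetD1 w) //= ltr_pwDl //.
  by rewrite mulr_gt0 // lt_def ?x0 ?p0 // andbT -mem_finsupp.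
rewrite big_seq; apply: sumr_ge0 => u; rewrite !inE => /andP[_ ux].
by rewrite mulr_ge0 ?p0.
Qed.

Lemma affine_ext_pcomb p a x b y :
  affine_ext p (pcomb a x b y) = pcomb a (affine_ext p x) b (affine_ext p y).
Proof. by apply/fsfunP => v; rewrite pcombE !affine_extE fsum_pcomb. Qed.

End AffineExt.

Lemma affine_ext_vertex (R : realType) (V W : choiceType) (p : W -> point R V)
  w :
  affine_ext p (vertex_point R w) = p w.
Proof. by apply/fsfunP => v; rewrite affine_extE fsum_vertex. Qed.

Lemma affine_ext_comp (R : realType) (V W U : choiceType)
  (p : W -> point R V) (q : U -> point R W) x :
  affine_ext p (affine_ext q x) = affine_ext (affine_ext p \o q) x.
Proof.
apply/fsfunP => v; rewrite !affine_extE fsum_affine_ext.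
by apply: eq_fsum => w _; rewrite /= affine_extE.
Qed.

(** * Subdivisions *)

Section ConicalPoints.
Variables (R : realType).

(* Formal points of arbitrary mass: subtraction steps and splittings into
   summands stay inside [cpoints K], and no normalization is needed. *)
Definition cpoints (V : choiceType) (K : complex V) (x : point R V) :=
  (forall v, 0 <= x v) /\ (finsupp x = fset0 \/ K (finsupp x)).

Definition csubdivision (V W : choiceType) (K : complex V) (L : complex W)
    (p : W -> point R V) : Prop :=
  [/\ forall t, L t -> exists2 s, K s & forall w, w \in t -> closed_simplex s
    (p w),
      forall z, cpoints K z -> exists2 x, cpoints L x & affine_ext p x = z &
      forall x y, cpoints L x -> cpoints L y -> affine_ext p x = affine_ext p y
        ->
        x = y].

Lemma pointsP (V : choiceType) (K : complex V) x :
  points R K x <-> cpoints K x /\ mass x = 1.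
Proof.
split=> [[s Ks [xs x0 x1]]|[[x0 xK] x1]].
  split=> //; split=> //; case: (eqVneq (finsupp x) fset0) => [|xn];
    first by left.
  by right; apply: simplex_face Ks xs xn.
case: xK => [x00|xK].
  by move: x1; rewrite /mass x00 big_seq_fset0 => /esym/eqP; rewrite oner_eq0.
by exists (finsupp x).
Qed.

(** [pcomb a x 0 y] is the way the scalar multiple of [x] by [a] is written here; the second point
    is a dummy. *)
Lemma cpoints_scale (V : choiceType) (K : complex V) x a b y : 0 <= a ->
  cpoints K x -> b = 0 -> cpoints K (pcomb a x b y).
Proof.
move=> a0 [x0 xK] ->; split=> [v|].
  by rewrite pcombE mul0r addr0 mulr_ge0.
case: (eqVneq (finsupp (pcomb a x 0 y)) fset0) => [|n0]; first by left.
have sub : finsupp (pcomb a x 0 y) `<=` finsupp x.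
  apply/fsubsetP => v; rewrite !mem_finsupp pcombE mul0r addr0.
  by apply: contra => /eqP ->; rewrite mulr0.
right; case: xK => [x00|xK]; last exact: simplex_face xK sub n0.
by move: sub n0; rewrite x00 fsubset0 => ->.
Qed.

Section Carrier.
Variables (V W : choiceType) (K : complex V) (L : complex W).
Variable p : W -> point R V.
Hypothesis pK : forall t, L t ->
  exists2 s, K s & forall w, w \in t -> closed_simplex s (p w).

Lemma carrier_mass x w : cpoints L x -> w \in finsupp x -> mass (p w) = 1.
Proof.
move=> [_ [->//|/pK[s _ h]]] /h[]; by [].
Qed.

Lemma carrier_ge0 x w : cpoints L x -> w \in finsupp x -> forall v, 0 <= p w v.
Proof. by move=> [_ [->//|/pK[s _ h]]] /h[]. Qed.

Lemma mass_carrier x : cpoints L x -> mass (affine_ext p x) = mass x.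
Proof. by move=> Lx; apply: mass_affine_ext => w; exact: carrier_mass Lx. Qed.

Lemma cpoints_affine_ext x : cpoints L x -> cpoints K (affine_ext p x).
Proof.
move=> Lx; split; first by
  apply: affine_ext_ge0; [case: Lx|move=> w; exact: carrier_ge0 Lx].
case: (eqVneq (finsupp (affine_ext p x)) fset0) => [|n0]; first by left.
right; case: Lx => _ [x0|/pK[s Ks h]].
  case/fset0Pn: n0 => v /finsupp_affine_ext[w]; by rewrite x0.
apply: simplex_face Ks _ n0; apply/fsubsetP => v /finsupp_affine_ext[w /h[]].
by move=> /fsubsetP hs _ _ /hs.
Qed.

End Carrier.

(** Carriers have mass 1, so [affine_ext p] preserves mass. A point of positive mass is normalized,
    treated in the realization and scaled back; a point of mass 0 vanishes. *)
Lemma subdivision_csub (V W : choiceType) (K : complex V) (L : complex W)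
    (p : W -> point R V) :
  subdivision K L p <-> csubdivision K L p.
Proof.
split=> [[pK [fK injK surK]]|[pK surK injK]].
  split=> // [z Kz|x y Lx Ly e].
    have [z0|mz] := eqVneq (mass z) 0.
      have z00 := mass_eq0 (proj1 Kz) z0.
      exists [fsfun of _ => 0].
        by split=> [v|]; [rewrite fsfun0E|left; rewrite finsupp0].
      apply/fsfunP => v; rewrite affine_extE /fsum finsupp0 big_seq_fset0.
      by rewrite (finsupp_eq0 _ z00).
    have mz0 : 0 < mass z by rewrite lt_def mz mass_ge0 //; case: Kz.
    have : points R K (pcomb (mass z)^-1 z 0 z).
      apply/pointsP; split; last by rewrite mass_pcomb mul0r addr0 mulVf.
      by apply: cpoints_scale => //; rewrite invr_ge0 ltW.
    move=> /surK[x /pointsP[Lx x1] xz].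
    exists (pcomb (mass z) x 0 x); first by apply: cpoints_scale => //;
      exact: ltW.
    rewrite affine_ext_pcomb xz; apply/fsfunP => v.
    by rewrite !pcombE !mul0r !addr0 mulrA divff ?mul1r.
  have mxy : mass x = mass y.
    by rewrite -(mass_carrier pK Lx) e (mass_carrier pK Ly).
  have [x0|mx] := eqVneq (mass x) 0.
    have xx := mass_eq0 (proj1 Lx) x0.
    have yy := mass_eq0 (proj1 Ly) (etrans (esym mxy) x0).
    by apply/fsfunP => v; rewrite !finsupp_eq0.
  have mx0 : 0 < mass x by rewrite lt_def mx mass_ge0 //; case: Lx.
  have P z : cpoints L z -> mass z = mass x ->
      pcomb (mass x)^-1 z 0 z \in points R L.
    move=> Lz mz; apply/mem_set/pointsP.
    split; last by rewrite mass_pcomb mz mul0r addr0 mulVf.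
    by apply: cpoints_scale => //; rewrite invr_ge0 ltW.
  have : pcomb (mass x)^-1 x 0 x = pcomb (mass x)^-1 y 0 y.
    apply: (injK _ _ (P _ Lx erefl) (P _ Ly (esym mxy))).
    rewrite !affine_ext_pcomb e; apply/fsfunP => v.
    by rewrite !pcombE.
  move=> /fsfunP h; apply/fsfunP => v; have := h v.
  by rewrite !pcombE !mul0r !addr0 => /mulfI; apply; rewrite invr_eq0.
split=> //; split.
- move=> x /pointsP[Lx x1]; apply/pointsP; split;
  first exact: cpoints_affine_ext Lx.
  by rewrite (mass_carrier pK Lx).
- by move=> x y /set_mem/pointsP[Lx _] /set_mem/pointsP[Ly _]; exact: injK.
- move=> z /pointsP[/surK[x Lx <-]]; rewrite (mass_carrier pK Lx) => x1.
  by exists x => //; apply/pointsP.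
Qed.

End ConicalPoints.
(** * Pull-back of a subdivision along a simplicial map *)

(** Totality and transitivity are asked on [s] only, because [pb_le] below has them only on suitable
    sets of pairs. *)
Lemma ex_seq_min (T : eqType) (r : T -> T -> Prop) (s : seq T) : s != [::] ->
  (forall x y, x \in s -> y \in s -> r x y \/ r y x) ->
  (forall x y z, x \in s -> y \in s -> z \in s -> r x y -> r y z -> r x z) ->
  exists2 x, x \in s & forall y, y \in s -> r x y.
Proof.
elim: s => // a s IHs _ tot tr.
have raa : r a a by have [] := tot a a (mem_head _ _) (mem_head _ _).
have [s0|/eqP/eqP sn] := boolP (s == [::]).
  exists a => [|y]; rewrite ?mem_head // (eqP s0) inE => /eqP -> //.
have sub x : x \in s -> x \in a :: s by rewrite inE orbC => ->.
have [//|x y /sub xs /sub ys|x y z /sub xs /sub ys /sub zs|b bs bmin] := IHs.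
- exact: tot.
- exact: tr.
have [ab|ba] := tot a b (mem_head _ _) (sub _ bs).
  exists a => [|y]; rewrite ?mem_head // inE => /predU1P[-> //|ys].
  by apply: (tr a b y); rewrite ?mem_head ?sub //; exact: bmin.
exists b => [|y]; first exact: sub.
by rewrite inE => /predU1P[-> //|]; exact: bmin.
Qed.

Lemma ex_fset_min (T : choiceType) (r : T -> T -> Prop) (s : {fset T}) :
  s != fset0 ->
  (forall x y, x \in s -> y \in s -> r x y \/ r y x) ->
  (forall x y z, x \in s -> y \in s -> z \in s -> r x y -> r y z -> r x z) ->
  exists2 x, x \in s & forall y, y \in s -> r x y.
Proof.
by move=> s0 tot tr; apply: (@ex_seq_min _ r s).
Qed.

Section PullBack.
Variables (R : realType) (V W T : choiceType).
Variables (p : W -> point R V) (g : T -> V).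
Variables (leW : rel W) (leT : rel T).
Hypotheses (leW_total : total leW) (leW_anti : antisymmetric leW).
Hypotheses (leW_trans : transitive leW).
Hypotheses (leT_total : total leT) (leT_anti : antisymmetric leT).
Hypotheses (leT_trans : transitive leT).

Implicit Types (u : (W * {fset T})%type) (m : point R (W * {fset T})%type)
  (l : point R W) (x : point R T).

(* The pair [(w, A)] stands for the section [p w -> T] of [g] with image [A]. *)
Definition pb_section u :=
  {in u.2 &, injective g} /\ g @` u.2 = finsupp (p u.1).

(** Sections are compared fibre by fibre, as in the staircase triangulation of a product of
    simplices; elements over different vertices are never compared. *)
Definition pb_le u1 u2 := leW u1.1 u2.1 /\
  forall a b, a \in u1.2 -> b \in u2.2 -> g a = g b -> leT a b.

Definition pb_pos u : point R T := [fsfun a in u.2 => p u.1 (g a) | 0].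

Let pb_fst m : point R W := affine_ext (fun u => vertex_point R u.1) m.
Let push x : point R V := affine_ext (fun a => vertex_point R (g a)) x.

Lemma pb_posE u a : pb_pos u a = if a \in u.2 then p u.1 (g a) else 0.
Proof. by rewrite /pb_pos fsfun_fun. Qed.

Lemma finsupp_pb_pos u : pb_section u -> finsupp (pb_pos u) = u.2.
Proof.
move=> [_ gA]; apply/fsetP => a; rewrite mem_finsupp pb_posE.
case: (boolP (a \in u.2)) => [au|]; last by rewrite eqxx.
by rewrite -mem_finsupp -gA in_imfset.
Qed.

Lemma push_pb_pos u : pb_section u -> push (pb_pos u) = p u.1.
Proof.
move=> su; have [gi gA] := su; apply/fsfunP => v.
rewrite /push affine_extE /fsum finsupp_pb_pos //.
under eq_bigr do rewrite vertex_pointE.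
have [vA|vN] := boolP (v \in finsupp (p u.1)).
  move: (vA); rewrite -gA => /imfsetP[a /= aA ->].
  rewrite (big_fsetD1 a) //= eqxx mulr1 pb_posE aA.
  rewrite big_seq big1 ?addr0 // => b; rewrite !inE => /andP[ba bA].
  case: eqP => [/gi e|_]; last by rewrite mulr0.
  by move: ba; rewrite e ?eqxx.
rewrite big_seq big1 => [|a aA]; first by move: vN; rewrite memNfinsupp => /eqP.
case: eqP => [e|_]; last by rewrite mulr0.
by case/negP: vN; rewrite e -gA in_imfset.
Qed.

Lemma push_affine_ext m : (forall u, u \in finsupp m -> pb_section u) ->
  push (affine_ext pb_pos m) = affine_ext p (pb_fst m).
Proof.
move=> sm; rewrite /push /pb_fst !affine_ext_comp; apply/fsfunP => v.
rewrite !affine_extE; apply: eq_fsum => u um /=.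
by rewrite affine_ext_vertex -(push_pb_pos (sm _ um)).
Qed.

(** A monotone transport plan from the weights [pb_fst m] to the point [affine_ext pb_pos m]: the
    coefficient of [(w, A)] is the part of the weight of [w] that is lifted along the section
    [A]. *)
Definition pb_chain m := [/\ forall u, 0 <= m u,
  forall u, u \in finsupp m -> pb_section u /\ forall v, 0 <= p u.1 v &
  forall u1 u2, u1 \in finsupp m -> u2 \in finsupp m ->
    pb_le u1 u2 \/ pb_le u2 u1].

Let pb_pos_ge0 u : (forall v, 0 <= p u.1 v) -> forall a, 0 <= pb_pos u a.
Proof. by move=> p0 a; rewrite pb_posE; case: ifP. Qed.

(** [pb_le] is not transitive in general: a middle pair whose support misses [g a] transmits no
    comparison over [g a]. Hence [leW] is minimized first, and [pb_le] only among the pairs with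
    that first component, which all have the same support. A pair with another first component
    cannot lie below, by antisymmetry of [leW]. *)
Lemma pb_chain_min m : pb_chain m -> finsupp m != fset0 ->
  exists2 u, u \in finsupp m & forall u', u' \in finsupp m -> pb_le u u'.
Proof.
move=> [_ sm cm] m0.
have [] := @ex_fset_min _ (fun u u' => leW u.1 u'.1) (finsupp m) m0.
- by move=> u u' _ _; apply/orP; exact: leW_total.
- by move=> u1 u2 u3 _ _ _; exact: leW_trans.
move=> u0 u0m u0min.
have [] := @ex_fset_min _ pb_le [fset u in finsupp m | u.1 == u0.1].
- by apply/fset0Pn; exists u0; rewrite !inE u0m /=.
- by move=> u u'; rewrite !inE => /andP[um _] /andP[um' _]; exact: cm.
- move=> u1 u2 u3; rewrite !inE => /andP[m1 /eqP e1] /andP[m2 /eqP e2].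
  move=> /andP[m3 /eqP e3] [l12 h12] [l23 h23].
  split; first exact: leW_trans l23.
  move=> a b aA bA gab.
  have : g b \in g @` u2.2.
    have [[_ ->] _] := sm _ m2; have [[_ h3] _] := sm _ m3.
    by rewrite e2 -e3 -h3 in_imfset.
  move=> /imfsetP[c /= cA gbc]; apply: (leT_trans (h12 _ _ aA cA _)).
    by rewrite gab.
  exact: h23.
move=> u; rewrite !inE => /andP[um /eqP eu] umin.
exists u => // u' um'.
have [e|ne] := eqVneq u'.1 u0.1; first by apply: umin; rewrite !inE um' e /=.
have [//|[l' _]] := cm _ _ um um'.
by case/eqP: ne; apply: leW_anti; rewrite u0min // -eu l'.
Qed.

Let finsupp_pb_fst m w : (forall u, 0 <= m u) ->
  w \in finsupp (pb_fst m) <-> exists2 u, u \in finsupp m & u.1 = w.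
Proof.
move=> m0; split=> [/finsupp_affine_ext[u um]|[u um <-]].
  by rewrite finsupp_vertex inE => /eqP ->; exists u.
have v0 u' v : 0 <= vertex_point R (u'.1 : W) v by rewrite vertex_pointE.
have := finsupp_affine_ext_sub (p := fun u => vertex_point R u.1) m0
  (fun w _ => v0 w) um.
by rewrite finsupp_vertex fsub1set.
Qed.

Let finsupp_pb_image m a : pb_chain m ->
  a \in finsupp (affine_ext pb_pos m) <-> exists2 u, u \in finsupp m & a \in
    u.2.
Proof.
move=> [m0 sm _]; split=> [/finsupp_affine_ext[u um]|[u um au]].
  by rewrite finsupp_pb_pos; [exists u|case: (sm _ um)].
have pp u' : u' \in finsupp m -> forall v, 0 <= pb_pos u' v.
  by move=> /sm[_]; exact: pb_pos_ge0.
have /fsubsetP := finsupp_affine_ext_sub m0 pp um; apply.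
by rewrite finsupp_pb_pos //; case: (sm _ um).
Qed.

(** The two images determine the minimal pair: its first component is least in the support of the
    weights, and its section selects the least element of the support of the point in every fibre
    that it meets. *)
Let pb_min_sub m1 m2 u1 u2 : pb_chain m1 -> pb_chain m2 ->
  pb_fst m1 = pb_fst m2 -> affine_ext pb_pos m1 = affine_ext pb_pos m2 ->
  u1 \in finsupp m1 -> u2 \in finsupp m2 ->
  (forall u, u \in finsupp m1 -> pb_le u1 u) ->
  (forall u, u \in finsupp m2 -> pb_le u2 u) -> leW u2.1 u1.1 /\
  (u1.1 = u2.1 -> u1.2 `<=` u2.2).
Proof.
move=> c1 c2 e1 e2 m1u m2u min1 min2; split.
  have : u1.1 \in finsupp (pb_fst m1).
    by apply/finsupp_pb_fst; [case: c1|exists u1].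
  rewrite e1 => /finsupp_pb_fst => -[|u /min2[h _] <- //].
  by case: c2.
move=> e; apply/fsubsetP => a aA.
have [_ s1 _] := c1; have [_ s2 _] := c2.
have : g a \in g @` u2.2.
  have [[_ ->] _] := s2 _ m2u; have [[_ gA] _] := s1 _ m1u.
  by rewrite -e -gA in_imfset.
move=> /imfsetP[b /= bA gab].
have : a \in finsupp (affine_ext pb_pos m1) by apply/finsupp_pb_image => //;
  exists u1.
rewrite e2 => /(finsupp_pb_image _ c2)[u' /min2[_ h] au'].
have : b \in finsupp (affine_ext pb_pos m2) by apply/finsupp_pb_image => //;
  exists u2.
rewrite -e2 => /(finsupp_pb_image _ c1)[u'' /min1[_ h'] bu''].
suff -> : a = b by [].
by apply: leT_anti; rewrite h' // h.
Qed.

Let pb_sub m u c : pb_chain m -> c <= m u -> 0 <= c ->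
  pb_chain (pcomb 1 m (- c) (vertex_point R u)) /\
  finsupp (pcomb 1 m (- c) (vertex_point R u)) `<=` finsupp m.
Proof.
move=> [m0 sm cm] cu c0.
have sub : finsupp (pcomb 1 m (- c) (vertex_point R u)) `<=` finsupp m.
  apply/fsubsetP => u'; rewrite !mem_finsupp pcombE vertex_pointE mul1r.
  apply: contra => /eqP h; case: (eqVneq u' u) => [e|_].
    by rewrite -e in cu; rewrite h mulr1 add0r oppr_eq0 eq_le c0 -h cu.
  by rewrite mulr0 addr0 h.
split=> //; split=> [u'|u' /(fsubsetP sub)/sm //|u1 u2].
  rewrite pcombE vertex_pointE mul1r; case: (eqVneq u' u) => [->|_].
    by rewrite mulr1 subr_ge0.
  by rewrite mulr0 addr0.
by move=> /(fsubsetP sub) h1 /(fsubsetP sub) h2; exact: cm.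
Qed.

Let card_pb_sub m u : u \in finsupp m ->
  finsupp (pcomb 1 m (- m u) (vertex_point R u)) `<=` finsupp m ->
  (#|` finsupp (pcomb 1 m (- m u) (vertex_point R u))| < #|` finsupp m|)%N.
Proof.
move=> um sub; apply: fproper_ltn_card.
rewrite fproperE sub /=; apply/fsubsetPn; exists u => //.
by rewrite memNfinsupp pcombE vertex_pointE eqxx mul1r mulr1 subrr.
Qed.

Let pb_fst_mass m : mass (pb_fst m) = mass m.
Proof. by rewrite mass_affine_ext // => u _; rewrite mass_vertex. Qed.

(* Both chains start with the same pair, since it is determined by the supports
   of the two images; subtract the smaller of its two coefficients. *)
Lemma pb_unique m1 m2 : pb_chain m1 -> pb_chain m2 ->
  pb_fst m1 = pb_fst m2 -> affine_ext pb_pos m1 = affine_ext pb_pos m2 ->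
  m1 = m2.
Proof.
have [n] := ubnP (#|` finsupp m1| + #|` finsupp m2|)%N.
elim: n m1 m2 => // n IHn m1 m2 lemn c1 c2 e1 e2.
have em : mass m1 = mass m2 by rewrite -!pb_fst_mass e1.
have zero m : mass m = 0 -> pb_chain m -> finsupp m = fset0.
  by move=> mm [m0 _ _]; exact: mass_eq0.
have [m10|m1n] := eqVneq (mass m1) 0.
  apply/fsfunP => u; rewrite !finsupp_eq0 ?zero //.
  by rewrite -em.
have m1s : finsupp m1 != fset0.
  by apply: contra m1n => /eqP h; rewrite /mass h big_seq_fset0.
have m2s : finsupp m2 != fset0.
  by apply: contra m1n => /eqP h; rewrite em /mass h big_seq_fset0.
have [u1 u1m min1] := pb_chain_min c1 m1s.
have [u2 u2m min2] := pb_chain_min c2 m2s.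
have [l21 s12] := pb_min_sub c1 c2 e1 e2 u1m u2m min1 min2.
have [l12 s21] := pb_min_sub c2 c1 (esym e1) (esym e2) u2m u1m min2 min1.
have ew : u1.1 = u2.1 by apply: leW_anti; rewrite l12.
have eu : u1 = u2.
  apply/eqP; rewrite -pair_eqE /= ew eqxx /= eqEfsubset s12 //.
  exact: s21.
subst u2.
suff H c : 0 <= c -> c <= m1 u1 -> c <= m2 u1 -> (c = m1 u1 \/ c = m2 u1) ->
    m1 = m2.
  have [_ _ _] := c1; have [le|/ltW le] := leP (m1 u1) (m2 u1).
    by apply: (H (m1 u1)) => //; [case: c1|left].
  by apply: (H (m2 u1)) => //; [case: c2|right].
move=> c0 cm1 cm2 cc.
have [c1' sub1] := pb_sub c1 cm1 c0; have [c2' sub2] := pb_sub c2 cm2 c0.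
have : pcomb 1 m1 (- c) (vertex_point R u1) = pcomb 1 m2 (- c) (vertex_point R
  u1).
  apply: IHn => //.
  - rewrite ltnS in lemn; apply: leq_trans lemn.
    case: cc => cc; subst c.
      by rewrite -addSn leq_add ?card_pb_sub // fsubset_leq_card.
    by rewrite -addnS leq_add ?card_pb_sub // fsubset_leq_card.
  - by rewrite /pb_fst !affine_ext_pcomb [X in pcomb _ X _ _]e1.
  - by rewrite !affine_ext_pcomb e2.
move=> /fsfunP h; apply/fsfunP => u; have := h u.
by rewrite !pcombE !mul1r => /addIr.
Qed.

Let pb_first_pair (l : point R W) x w :
  (forall v, 0 <= l v) -> (forall a, 0 <= x a) ->
  (forall w, w \in finsupp l -> forall v, 0 <= p w v) ->
  affine_ext p l = push x -> w \in finsupp l ->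
  exists A : {fset T}, [/\ pb_section (w, A), A `<=` finsupp x &
    forall a b, a \in A -> b \in finsupp x -> g a = g b -> leT a b].
Proof.
move=> l0 x0 p0 e wl.
(* Over each vertex of [p w], the set [A] retains the [leT]-least element of the support of [x].
   There is one, since the support of [p w] lies in that of [push x]. *)
pose A := [fset a in finsupp x | (g a \in finsupp (p w)) &&
  all (fun b => (g b == g a) ==> leT a b) (finsupp x)].
have Amin a b : a \in A -> b \in finsupp x -> g a = g b -> leT a b.
  rewrite !inE => /and3P[_ _ /allP h] /h /implyP h' /esym/eqP; exact: h'.
exists A; split => //; last by apply/fsubsetP => a; rewrite !inE => /andP[].
split=> [a b aA bA gab|].
  have sub c : c \in A -> c \in finsupp x by rewrite !inE => /andP[].
  by apply: leT_anti; rewrite !Amin ?sub //.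
apply/fsetP => v; apply/imfsetP/idP => [[a]|vp].
  by rewrite !inE /= => /and3P[_ h _] ->.
have : v \in finsupp (push x).
  by rewrite -e; apply: (fsubsetP (finsupp_affine_ext_sub l0 p0 wl)).
move=> /finsupp_affine_ext[a ax]; rewrite finsupp_vertex inE => /eqP va.
have [] := @ex_fset_min _ (fun b c => leT b c) [fset b in finsupp x | g b == v].
- by apply/fset0Pn; exists a; rewrite !inE ax va /=.
- by move=> b c _ _; apply/orP; exact: leT_total.
- by move=> b c f _ _ _; exact: leT_trans.
move=> b; rewrite !inE => /andP[bx /eqP gb] bmin.
exists b => //; rewrite !inE bx gb vp /=; apply/allP => c cx;
  apply/implyP => gc.
by apply: bmin; rewrite !inE cx gc.
Qed.

(** The ratio test of linear programming: [c] is the minimum of [a0] and of the quotients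
    [G a / F a], so one of the constraints becomes an equality. *)
Let ex_coef (A : {fset T}) (F G : T -> R) (a0 : R) : 0 < a0 ->
  (forall a, a \in A -> 0 < F a /\ 0 < G a) ->
  exists c : R, [/\ 0 < c, c <= a0, forall a, a \in A -> c * F a <= G a &
    c = a0 \/ exists2 a, a \in A & c * F a = G a].
Proof.
move=> a00 FG; pose s := a0 :: [seq G a / F a | a <- A].
have [] := @ex_seq_min _ (fun b c : R => b <= c) s isT.
- by move=> x y _ _; apply/orP; exact: le_total.
- by move=> x y z _ _ _; exact: le_trans.
move=> c cs cmin; exists c; split.
- move: cs; rewrite inE => /predU1P[->//|/mapP[a aA ->]].
  by have [? ?] := FG _ aA; rewrite divr_gt0.
- by apply: cmin; rewrite mem_head.
- move=> a aA; have [F0 G0] := FG _ aA; rewrite -ler_pdivlMr //.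
  by apply: cmin; rewrite inE; apply/orP; right; apply/mapP; exists a.
- move: cs; rewrite inE => /predU1P[->|/mapP[a aA ->]]; first by left.
  right; exists a => //; have [F0 G0] := FG _ aA.
  by rewrite divfK // gt_eqF.
Qed.

(* The north-west corner rule: give the first pair the largest possible
   coefficient; this empties some coordinate of [l] or of [x]. *)
Lemma pb_exists (l : point R W) x :
  (forall v, 0 <= l v) -> (forall a, 0 <= x a) ->
  (forall w, w \in finsupp l -> forall v, 0 <= p w v) ->
  (forall w, w \in finsupp l -> finsupp (p w) != fset0) ->
  affine_ext p l = push x ->
  exists m, [/\ pb_chain m, pb_fst m = l & affine_ext pb_pos m = x].
Proof.
have [n] := ubnP (#|` finsupp l| + #|` finsupp x|)%N.
elim: n l x => // n IHn l x lemn l0 x0 p0 pn e.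
have [ls|ln] := eqVneq (finsupp l) fset0.
  have xs : finsupp x = fset0.
    apply/eqP/fset0Pn => -[a ax].
    have : g a \in finsupp (push x).
      have v0 a' : a' \in finsupp x -> forall v, 0 <= vertex_point R (g a') v.
        by move=> _ v; rewrite vertex_pointE.
      have := finsupp_affine_ext_sub x0 v0 ax.
      by rewrite finsupp_vertex fsub1set.
    by rewrite -e => /finsupp_affine_ext[w]; rewrite ls.
  exists [fsfun of _ => 0]; split.
  - split=> [u|u|u u']; rewrite ?fsfun0E ?finsupp0 //.
  - apply/fsfunP => w; rewrite /pb_fst affine_extE /fsum finsupp0 big_seq_fset0.
    by rewrite finsupp_eq0.
  - apply/fsfunP => w; rewrite affine_extE /fsum finsupp0 big_seq_fset0.
    by rewrite finsupp_eq0.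
have [] := @ex_fset_min _ (fun w w' => leW w w') (finsupp l) ln.
- by move=> w w' _ _; apply/orP; exact: leW_total.
- by move=> w w' w'' _ _ _; exact: leW_trans.
move=> w wl wmin.
have [A [sA Ax Amin]] := pb_first_pair l0 x0 p0 e wl.
have lw0 : 0 < l w by rewrite -point_gt0.
have [|c [c0 cl cA cc]] := @ex_coef A (fun a => p w (g a)) x (l w) lw0.
  move=> a aA; rewrite -(point_gt0 _ x0) (fsubsetP Ax) //; split => //.
  rewrite -(point_gt0 _ (p0 _ wl)).
  by case: sA => _ /= <-; rewrite in_imfset.
pose u := (w, A).
have [cl0 lsub] : (forall v, 0 <= pcomb 1 l (- c) (vertex_point R w) v) /\
    finsupp (pcomb 1 l (- c) (vertex_point R w)) `<=` finsupp l.
  split=> [v|].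
    rewrite pcombE vertex_pointE mul1r; case: (eqVneq v w) => [->|_].
      by rewrite mulr1 subr_ge0.
    by rewrite mulr0 addr0.
  apply: fsubset_trans (finsupp_pcomb _ _ _ _) _.
  by rewrite finsupp_vertex fsubUset fsubset_refl fsub1set.
have [cx0 xsub] : (forall v, 0 <= pcomb 1 x (- c) (pb_pos u) v) /\
    finsupp (pcomb 1 x (- c) (pb_pos u)) `<=` finsupp x.
  split=> [a|].
    rewrite pcombE pb_posE mul1r /=; case: ifP => [/cA|_].
      by rewrite mulNr subr_ge0.
    by rewrite mulr0 addr0.
  apply: fsubset_trans (finsupp_pcomb _ _ _ _) _.
  by rewrite finsupp_pb_pos // fsubUset fsubset_refl.
have lt_card : (#|` finsupp (pcomb 1%R l (- c) (vertex_point R w))| +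
    #|` finsupp (pcomb 1%R x (- c) (pb_pos u))| < n)%N.
  rewrite ltnS in lemn; apply: leq_trans lemn; case: cc => [cw|[a aA ca]].
    rewrite -addSn leq_add ?fsubset_leq_card // fproper_ltn_card //.
    rewrite fproperE lsub; apply/fsubsetPn; exists w => //.
    by rewrite memNfinsupp pcombE vertex_pointE eqxx mul1r cw mulr1 subrr.
  rewrite -addnS leq_add ?fsubset_leq_card // fproper_ltn_card //.
  rewrite fproperE xsub; apply/fsubsetPn; exists a; first exact: (fsubsetP Ax).
  by rewrite memNfinsupp pcombE pb_posE aA mul1r mulNr ca subrr.
have [|||m [cm fm am]] := IHn _ _ lt_card cl0 cx0.
- by move=> w' /(fsubsetP lsub); exact: p0.
- by move=> w' /(fsubsetP lsub); exact: pn.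
- rewrite affine_ext_pcomb affine_ext_vertex e /push affine_ext_pcomb.
  by rewrite -/push [X in _ = pcomb _ _ _ X](push_pb_pos sA).
have [m0 sm lem] := cm.
exists (pcomb 1 m c (vertex_point R u)).
have usub := finsupp_pcomb 1 m c (vertex_point R u).
rewrite finsupp_vertex in usub.
have uu : pb_le u u.
  split=> [|a b aA bA gab] /=; first by have := leW_total w w; rewrite orbb.
  by apply: Amin => //; exact: (fsubsetP Ax).
(* Subtraction only shrinks the supports of [l] and [x], so [u], which is least with respect to
   both, stays below every pair of the remaining plan. *)
have umin u' : u' \in finsupp m -> pb_le u u'.
  move=> um; split.
    apply: wmin; apply: (fsubsetP lsub); rewrite -fm.
    by apply/finsupp_pb_fst => //; exists u'.
  move=> a b aA bA; apply: Amin => //; apply: (fsubsetP xsub); rewrite -am.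
  by apply/finsupp_pb_image => //; exists u'.
split.
- split.
  + by move=> u'; rewrite pcombE vertex_pointE mul1r addr_ge0 ?mulr_ge0 // ltW.
  + move=> u' /(fsubsetP usub); rewrite !inE => /orP[/sm //|/eqP ->].
    by split=> // v; exact: p0.
  + move=> u1 u2 /(fsubsetP usub); rewrite !inE => h1 /(fsubsetP usub).
    rewrite !inE => h2; move: h1 h2 => /orP[m1|/eqP ->] /orP[m2|/eqP ->].
    * exact: lem.
    * by right; exact: umin.
    * by left; exact: umin.
    * by left.
- rewrite /pb_fst affine_ext_pcomb affine_ext_vertex [X in pcomb _ X _ _]fm /=.
  by apply/fsfunP => v; rewrite !pcombE; ring.
- rewrite affine_ext_pcomb affine_ext_vertex am /=.
  by apply/fsfunP => v; rewrite !pcombE; ring.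
Qed.

Section Complex.
Variables (L : complex W) (X : complex T).

(** The union of the sets [u.2] is the carrier in [X]; the condition [u.2 != fset0] keeps it
    nonempty on every face. *)
Let pb_simplex (c : {fset W * {fset T}}) : Prop :=
  [/\ c != fset0, L [fset u.1 | u in c], X (\bigcup_(u <- c) u.2),
      forall u, u \in c -> pb_section u /\ u.2 != fset0 &
      forall u1 u2, u1 \in c -> u2 \in c -> pb_le u1 u2 \/ pb_le u2 u1].

Let pb_neq0 c : pb_simplex c -> c != fset0. Proof. by case. Qed.

Let pb_face c e : pb_simplex c -> e `<=` c -> e != fset0 -> pb_simplex e.
Proof.
move=> [_ Lc Xc sc lc] /fsubsetP ec e0; have /fset0Pn[u ue] := e0; split=> //.
- apply: simplex_face Lc _ _.
    by apply/fsubsetP => w /imfsetP[u' /= /ec uc ->]; rewrite in_imfset.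
  by apply/fset0Pn; exists u.1; rewrite in_imfset.
- apply: simplex_face Xc _ _.
    apply/fsubsetP => a /bigfcupP[u' /andP[/ec uc _] au].
    by apply/bigfcupP; exists u'; rewrite ?uc.
  have [_ /fset0Pn[a au]] := sc _ (ec _ ue).
  by apply/fset0Pn; exists a; apply/bigfcupP; exists u; rewrite ?ue.
- by move=> u' /ec /sc.
- by move=> u1 u2 /ec h1 /ec h2; exact: lc.
Qed.

Definition pullback := Complex pb_neq0 pb_face.

Variable K : complex V.
Hypothesis subL : csubdivision K L p.
Hypothesis gXK : simplicial X K g.

Let p_simplex t w : L t -> w \in t -> [/\ forall v, 0 <= p w v, mass (p w) = 1 &
  finsupp (p w) != fset0].
Proof.
move=> Lt wt; have [s _ /(_ _ wt)[h1 h2 h3]] := (let: And3 h _ _ := subL in h)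
  _ Lt.
split=> //; apply/eqP => h0; move: h3; rewrite h0 big_seq_fset0 => /esym/eqP.
by rewrite oner_eq0.
Qed.

Lemma pullback_carrier c : pullback c ->
  forall u, u \in c -> closed_simplex (\bigcup_(u <- c) u.2) (pb_pos u).
Proof.
move=> [_ Lc Xc sc lc] u uc.
have uL : u.1 \in [fset u.1 | u in c] by rewrite in_imfset.
have [p0 p1 pn] := p_simplex Lc uL; have [su _] := sc _ uc; split.
- rewrite finsupp_pb_pos //; apply/fsubsetP => a au.
  by apply/bigfcupP; exists u; rewrite ?uc.
- exact: pb_pos_ge0.
- change (mass (pb_pos u) = 1); rewrite -p1 -(push_pb_pos su) mass_affine_ext
  //.
  by move=> a _; exact: mass_vertex.
Qed.

Let pull_car : forall c, pullback c ->
  exists2 s, X s & forall u, u \in c -> closed_simplex s (pb_pos u).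
Proof.
move=> c Pc; exists (\bigcup_(u <- c) u.2); first by case: Pc.
exact: pullback_carrier.
Qed.

Let pull_chain m : cpoints pullback m -> pb_chain m.
Proof.
move=> [m0 [h|[_ Lm Xm sm lm]]]; split=> //; rewrite ?h // => u um.
have [su _] := sm _ um; split=> //.
have uL : u.1 \in [fset u.1 | u in finsupp m] by rewrite in_imfset.
by have [] := p_simplex Lm uL.
Qed.

Let fst_cpoints m : cpoints pullback m -> cpoints L (pb_fst m).
Proof.
apply: (@cpoints_affine_ext R W (W * {fset T})%type L pullback).
move=> c [_ Lc _ _ _]; exists [fset u.1 | u in c] => // u uc; split.
- by rewrite finsupp_vertex fsub1set in_imfset.
- by move=> w; rewrite vertex_pointE.
- exact: mass_vertex.
Qed.

Let push_cpoints x : cpoints X x -> cpoints K (push x).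
Proof.
apply: (@cpoints_affine_ext R V T K X).
move=> s Xs; exists (g @` s); first exact: gXK.
move=> a sa; split.
- by rewrite finsupp_vertex fsub1set in_imfset.
- by move=> w; rewrite vertex_pointE.
- exact: mass_vertex.
Qed.

(** For surjectivity, [push x] is written with weights [l] in [L], and the north-west corner rule
    lifts [l] to a plan for [x]. For injectivity, pushing forward recovers [l] through [injL], and a
    monotone plan is determined by its two marginals. *)
Lemma pullback_subdivision : csubdivision X pullback pb_pos.
Proof.
have [_ surL injL] := subL.
split=> [|x Xx|m1 m2 P1 P2 e]; first exact: pull_car.
  have [l Ll lx] := surL _ (push_cpoints Xx).
  have pl w : w \in finsupp l -> [/\ forall v, 0 <= p w v, mass (p w) = 1 &
      finsupp (p w) != fset0].
    by case: Ll => _ [->//|Ll] /(p_simplex Ll).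
  have [||||m [cm fm am]] := @pb_exists l x _ _ _ _ lx.
  - by case: Ll.
  - by case: Xx.
  - by move=> w /pl[].
  - by move=> w /pl[].
  have [m0 sm lem] := cm.
  exists m => //; split => //.
  have [ms|mn] := eqVneq (finsupp m) fset0; [by left|right].
  have /fset0Pn[u um] := mn; split=> //.
  - have e : [fset u.1 | u in finsupp m] = finsupp l.
      rewrite -fm; apply/fsetP => w; apply/imfsetP/idP => [[u' /= um' ->]|].
        by apply/finsupp_pb_fst => //; exists u'.
      by move=> /finsupp_pb_fst -/(_ m0)[u' um' <-]; exists u'.
    rewrite e; case: Ll => _ [l0|//].
    have : u.1 \in finsupp l by rewrite -e in_imfset.
    by rewrite l0.
  - have e : \bigcup_(u <- finsupp m) u.2 = finsupp x.
      rewrite -am; apply/fsetP => a; apply/bigfcupP/idP => [[u' /andP[um' _]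
        au]|].
        by apply/finsupp_pb_image => //; exists u'.
      by move=> /(finsupp_pb_image _ cm)[u' um' au]; exists u'; rewrite ?um'.
    rewrite e; case: Xx => _ [x0|//].
    have [[_ gA] _] := sm _ um.
    have [_ _] : [/\ forall v, 0 <= p u.1 v, mass (p u.1) = 1 &
      finsupp (p u.1) != fset0].
      by apply: pl; rewrite -fm; apply/finsupp_pb_fst => //; exists u.
    rewrite -gA => /fset0Pn[v /imfsetP[a /= au _]].
    have : a \in finsupp x.
      by rewrite -am; apply/finsupp_pb_image => //; exists u.
    by rewrite x0.
  - move=> u' um'; have [su _] := sm _ um'; split=> //.
    have : u'.1 \in finsupp l.
      by rewrite -fm; apply/finsupp_pb_fst => //; exists u'.
    move=> /pl[_ _]; have [_ <-] := su => /fset0Pn[v /imfsetP[a /= au _]].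
    by apply/fset0Pn; exists a.
have c1 := pull_chain P1; have c2 := pull_chain P2.
apply: pb_unique => //; apply: (injL _ _ (fst_cpoints P1) (fst_cpoints P2)).
have [_ s1 _] := c1; have [_ s2 _] := c2.
have := congr1 push e; rewrite (@push_affine_ext m1) => [|u /s1[] //].
by rewrite (@push_affine_ext m2) => [|u /s2[] //].
Qed.

End Complex.

End PullBack.
(** * Restrictions and cones *)

Lemma closed_simplex_affine (R : realType) (V W : choiceType)
    (p : W -> point R V) (s : {fset W}) (r : {fset V}) y :
  (forall w, w \in s -> closed_simplex r (p w)) -> closed_simplex s y ->
  closed_simplex r (affine_ext p y).
Proof.
move=> ps [/fsubsetP ys y0 y1].
have pr w : w \in finsupp y -> closed_simplex r (p w) by move=> /ys /ps.
split.
- apply/fsubsetP => v /finsupp_affine_ext[w /pr[/fsubsetP h _ _]]; exact: h.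
- by apply: affine_ext_ge0 => // w /pr[].
- by rewrite -[LHS]/(mass _) mass_affine_ext // => w /pr[].
Qed.

Section Transitivity.
Variables (R : realType) (V W U : choiceType).
Variables (K : complex V) (L : complex W) (M : complex U).
Variables (p : W -> point R V) (q : U -> point R W).

Lemma csubdivision_trans : csubdivision K L p -> csubdivision L M q ->
  csubdivision K M (affine_ext p \o q).
Proof.
move=> [pK surK injK] [qL surL injL]; split.
- move=> t /qL[s /pK[r Kr sr] ts]; exists r => // w /ts /=.
  exact: closed_simplex_affine.
- move=> z /surK[y /surL[x Mx <-] <-]; exists x => //.
  by rewrite affine_ext_comp.
- move=> x y Mx My; rewrite -!affine_ext_comp => /injK e; apply: injL => //.
  by apply: e; exact: cpoints_affine_ext qL _ _.
Qed.

End Transitivity.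

Section Restriction.
Variables (W : choiceType) (L : complex W) (F : {fset W}).

Let rsimplex (s : {fset F}) : Prop := L [fset val w | w in s].

Let rsimplex_neq0 s : rsimplex s -> s != fset0.
Proof.
move=> /simplex_neq0 /fset0Pn[w /imfsetP[u /= us _]].
by apply/fset0Pn; exists u.
Qed.

Let rsimplex_face s t : rsimplex s -> t `<=` s -> t != fset0 -> rsimplex t.
Proof.
move=> Ls /fsubsetP ts /fset0Pn[u ut]; apply: (simplex_face Ls).
  by apply/fsubsetP => w /imfsetP[v /= /ts vs ->]; rewrite in_imfset.
by apply/fset0Pn; exists (val u); rewrite in_imfset.
Qed.

(** The pull-back has vertices in the possibly infinite type [W * {fset T}]. Restriction to a finite
    set of pairs makes them a [finType], as [polyhedron] demands. *)
Definition restriction : complex F := Complex rsimplex_neq0 rsimplex_face.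

Lemma affine_ext_val (R : realType) (x : point R F) u :
  affine_ext (fun u : F => vertex_point R (val u)) x (val u) = x u.
Proof.
rewrite affine_extE -(fsum_delta x u); apply: eq_fsum => v _.
by rewrite vertex_pointE (inj_eq val_inj) eq_sym.
Qed.

Lemma finsupp_affine_ext_val (R : realType) (x : point R F) :
  finsupp (affine_ext (fun u : F => vertex_point R (val u)) x) =
  [fset val w | w in finsupp x].
Proof.
apply/fsetP => w; apply/idP/imfsetP => [|[u /= ux ->]].
  by move=> /finsupp_affine_ext[u ux]; rewrite finsupp_vertex inE => /eqP ->;
    exists u.
by rewrite mem_finsupp affine_ext_val -mem_finsupp.
Qed.

Lemma restriction_subdivision (R : realType) :
  (forall s, L s -> s `<=` F) ->
  csubdivision L restriction (fun u : F => vertex_point R (val u)).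
Proof.
move=> LF; split.
- move=> t Lt; exists [fset val w | w in t] => // w wt; split.
  + by rewrite finsupp_vertex fsub1set in_imfset.
  + by move=> v; rewrite vertex_pointE.
  + exact: mass_vertex.
- move=> z [z0 Lz].
  pose x : point R F := [fsfun u in [fset u in enum {: F}] => z (val u) | 0].
  have xE u : x u = z (val u) by rewrite fsfun_fun inE mem_enum.
  have zx : affine_ext (fun u : F => vertex_point R (val u)) x = z.
    apply/fsfunP => w; have [wF|wF] := boolP (w \in F).
      by rewrite -[w]/(val [` wF]) affine_ext_val xE.
    have N0 (y : point R W) : finsupp y = fset0 \/ finsupp y `<=` F -> y w = 0
      :> R.
      move=> h; apply/eqP; rewrite -memNfinsupp; apply: contra wF.
      by case: h => [->//|/fsubsetP]; apply.
    rewrite !N0 //; first by case: Lz => [|/LF]; [left|right].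
    right; rewrite finsupp_affine_ext_val; apply/fsubsetP => v.
    by move=> /imfsetP[u _ ->]; exact: valP.
  exists x => //; split=> [u|]; first by rewrite xE.
  case: Lz => [z00|Lz]; [left|right].
    apply/eqP/fset0Pn => -[u]; rewrite mem_finsupp xE => zu.
    by move: zu; rewrite -mem_finsupp z00.
  by rewrite /restriction /= /rsimplex -finsupp_affine_ext_val zx.
- move=> x y _ _ /fsfunP e; apply/fsfunP => u.
  by have := e (val u); rewrite !affine_ext_val.
Qed.

End Restriction.

(** * Points supported on one summand of an option or sum type *)

Section Summand.
Variables (R : realType) (A B : choiceType) (f : A -> B) (g : B -> option A).
Hypotheses (fK : pcancel f g) (gK : ocancel g f).
Implicit Types (z : point R B) (x : point R A).

Definition preim_fset (s : {fset B}) : {fset A} := [fset a in pmap g s].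

Lemma mem_preim_fset s a : (a \in preim_fset s) = (f a \in s).
Proof.
rewrite inE /= mem_pmap; apply/mapP/idP => [[b bs ga]|fas].
  by have := gK b; rewrite -ga /= => ->.
by exists (f a); rewrite ?fK.
Qed.

Definition summand (z : point R B) : point R A :=
  [fsfun a in preim_fset (finsupp z) => z (f a) | 0].

Lemma summandE z a : summand z a = z (f a).
Proof.
rewrite /summand fsfun_fun mem_preim_fset; case: ifPn => //.
by rewrite memNfinsupp => /eqP ->.
Qed.

Lemma finsupp_summand z : finsupp (summand z) = preim_fset (finsupp z).
Proof. by apply/fsetP => a; rewrite mem_preim_fset !mem_finsupp summandE. Qed.

Definition summand_inj (x : point R A) : point R B :=
  affine_ext (fun a => vertex_point R (f a)) x.

Lemma summand_injE x a : summand_inj x (f a) = x a.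
Proof.
rewrite /summand_inj affine_extE -(fsum_delta x a); apply: eq_fsum => v _.
by rewrite vertex_pointE (inj_eq (pcan_inj fK)) eq_sym.
Qed.

Lemma summand_inj_out x b : (forall a, b != f a) -> summand_inj x b = 0.
Proof.
move=> bf; rewrite /summand_inj affine_extE /fsum big1 // => a _.
by rewrite vertex_pointE (negPf (bf a)) mulr0.
Qed.

Lemma fsum_summand_inj x F : fsum (summand_inj x) F = fsum x (F \o f).
Proof.
rewrite /summand_inj fsum_affine_ext; apply: eq_fsum => a _.
by rewrite fsum_vertex.
Qed.

Lemma mass_summand_inj x : mass (summand_inj x) = mass x.
Proof. by rewrite !massE fsum_summand_inj. Qed.

Lemma closed_simplex_summand_inj (s : {fset A}) (r : {fset B}) x :
  closed_simplex s x -> (forall a, a \in s -> f a \in r) ->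
  closed_simplex r (summand_inj x).
Proof.
move=> [/fsubsetP xs x0 x1] sr; split.
- apply/fsubsetP => b /finsupp_affine_ext[a /xs /sr ar].
  by rewrite finsupp_vertex inE => /eqP ->.
- by apply: affine_ext_ge0 => // a _ v; rewrite vertex_pointE.
- by rewrite -[LHS]/(mass _) mass_summand_inj.
Qed.

End Summand.

Section Cone.
Variables (R : realType) (T : choiceType).
Implicit Types (z : point R (option T)) (x : point R T).

Let SomeK : pcancel (@Some T) id. Proof. by []. Qed.
Let idK : ocancel id (@Some T). Proof. by case. Qed.

Definition base_fset (s : {fset option T}) : {fset T} := preim_fset id s.
Definition base z : point R T := summand (@Some T) id z.

Lemma mem_base_fset s a : (a \in base_fset s) = (Some a \in s).
Proof. exact: (mem_preim_fset SomeK idK). Qed.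

Lemma baseE z a : base z a = z (Some a).
Proof. exact: (summandE SomeK idK). Qed.

Lemma finsupp_base z : finsupp (base z) = base_fset (finsupp z).
Proof. exact: (finsupp_summand SomeK idK). Qed.

Definition cone_point (a : R) x : point R (option T) :=
  pcomb 1 (summand_inj (@Some T) x) a (vertex_point R None).

Lemma cone_point_None a x : cone_point a x None = a.
Proof.
rewrite pcombE vertex_pointE eqxx summand_inj_out //.
by rewrite mul1r add0r mulr1.
Qed.

Lemma cone_point_Some a x t : cone_point a x (Some t) = x t.
Proof.
rewrite pcombE vertex_pointE (summand_injE SomeK).
by rewrite mul1r mulr0 addr0.
Qed.

Lemma base_cone_point a x : base (cone_point a x) = x.
Proof. by apply/fsfunP => t; rewrite baseE cone_point_Some. Qed.

Lemma cone_pointK z : cone_point (z None) (base z) = z.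
Proof.
by apply/fsfunP => -[t|]; rewrite ?cone_point_None ?cone_point_Some ?baseE.
Qed.

Lemma fsum_option z F : fsum z F = z None * F None + fsum (base z) (F \o Some).
Proof.
rewrite -{1}(cone_pointK z) fsum_pcomb fsum_vertex fsum_summand_inj.
by rewrite mul1r addrC.
Qed.

Lemma mass_option z : mass z = z None + mass (base z).
Proof. by rewrite !massE fsum_option mulr1. Qed.

Variable X : complex T.

(** An empty base is allowed, so that the apex [None] alone is a simplex. *)
Let csimplex (s : {fset option T}) :=
  s != fset0 /\ (base_fset s = fset0 \/ X (base_fset s)).

Let csimplex_neq0 s : csimplex s -> s != fset0. Proof. by case. Qed.

Let csimplex_face s t : csimplex s -> t `<=` s -> t != fset0 -> csimplex t.
Proof.
move=> [_ Xs] /fsubsetP ts t0; split=> //.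
have sub : base_fset t `<=` base_fset s.
  by apply/fsubsetP => a; rewrite !mem_base_fset; exact: ts.
have [->|n0] := eqVneq (base_fset t) fset0; [by left|right].
case: Xs => [s0|Xs]; last exact: simplex_face Xs sub n0.
by move: sub n0; rewrite s0 fsubset0 => ->.
Qed.

Definition cone_complex := Complex csimplex_neq0 csimplex_face.

(** Without normalization the cone is a product: the apex coordinate and the base vary
    independently. Subdivisions of the base therefore extend to the cone without any rescaling. *)
Lemma cpoints_cone z :
  cpoints cone_complex z <-> (forall o, 0 <= z o) /\ cpoints X (base z).
Proof.
split=> [[z0 Xz]|[z0 [_ Xz]]].
  split=> //; split=> [a|]; first by rewrite baseE.
  rewrite finsupp_base; case: Xz => [h|[_ [h|h]]]; [left|by left|by right].
  by apply/eqP/fset0Pn => -[a]; rewrite mem_base_fset h.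
split=> //; rewrite finsupp_base in Xz.
by have [->|n0] := eqVneq (finsupp z) fset0; [left|right].
Qed.

Lemma cpoints_cone_point a x : 0 <= a -> cpoints X x ->
  cpoints cone_complex (cone_point a x).
Proof.
move=> a0 Xx; apply/cpoints_cone; rewrite base_cone_point; split=> //.
by case=> [t|]; rewrite ?cone_point_None // cone_point_Some; case: Xx.
Qed.

End Cone.

Section ConeSubdivision.
Variables (R : realType) (V W : choiceType) (K : complex V) (L : complex W).
Variable p : W -> point R V.

Definition cone_pos (o : option W) : point R (option V) :=
  if o is Some w then summand_inj (@Some V) (p w) else vertex_point R None.

Lemma affine_ext_cone z :
  affine_ext cone_pos z = cone_point (z None) (affine_ext p (base z)).
Proof.
have SomeK : pcancel (@Some V) id by [].
apply/fsfunP => -[v|]; rewrite affine_extE fsum_option /= vertex_pointE.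
  rewrite cone_point_Some mulr0 add0r affine_extE; apply: eq_fsum => w _ /=.
  by rewrite (summand_injE SomeK).
rewrite cone_point_None eqxx mulr1 /fsum big1 ?addr0 // => w _ /=.
by rewrite summand_inj_out // mulr0.
Qed.

Lemma cone_subdivision : csubdivision K L p ->
  csubdivision (cone_complex K) (cone_complex L) cone_pos.
Proof.
move=> [pK surK injK]; split.
- move=> t [t0 Lt].
  have vN (r : {fset option V}) : None \in r -> closed_simplex r (vertex_point
    R None).
    split; first by rewrite finsupp_vertex fsub1set.
      by move=> v; rewrite vertex_pointE.
    exact: mass_vertex.
  case: Lt => [t00|/pK[s Ks ts]].
    exists [fset None]; last first.
      move=> [w|_]; last by apply: vN; rewrite inE.
      by rewrite -mem_base_fset t00.
    split; first by apply/fset0Pn; exists None; rewrite inE.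
    by left; apply/eqP/fset0Pn => -[a]; rewrite mem_base_fset inE.
  exists (None |` (Some @` s)).
    split; first by apply/fset0Pn; exists None; rewrite !inE.
    right; suff -> : base_fset (None |` (Some @` s)) = s by [].
    apply/fsetP => a; rewrite mem_base_fset !inE /=.
    by apply/imfsetP/idP => [[b /= bs [->]]|?]; last exists a.
  move=> [w|_]; last by apply: vN; rewrite !inE.
  rewrite -mem_base_fset => /ts h; apply: closed_simplex_summand_inj h _.
  by move=> a sa; rewrite !inE /= in_imfset.
- move=> z /cpoints_cone[z0 /surK[x Lx xz]].
  exists (cone_point (z None) x); first exact: cpoints_cone_point.
  by rewrite affine_ext_cone cone_point_None base_cone_point xz cone_pointK.
- move=> x y /cpoints_cone[_ Lx] /cpoints_cone[_ Ly].
  rewrite !affine_ext_cone => e.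
  have eN : x None = y None.
    by have := congr1 (fun z : point R (option V) => z None) e;
      rewrite !cone_point_None.
  have eb : base x = base y.
    by apply: injK => //; have := congr1 (@base R V) e;
      rewrite !base_cone_point.
  by rewrite -(cone_pointK x) -(cone_pointK y) eN eb.
Qed.

End ConeSubdivision.
(** * The layers and the collar of a cone *)

Section Path.
Variables (R : realType) (M : nat).

Let esimplex (s : {fset bool}) : Prop := s != fset0.
Let esimplex_neq0 s : esimplex s -> s != fset0. Proof. by []. Qed.
Let esimplex_face s t : esimplex s -> t `<=` s -> t != fset0 -> esimplex t.
Proof. by []. Qed.

Definition edge_complex := Complex esimplex_neq0 esimplex_face.

Let psimplex (s : {fset nat}) : Prop :=
  s != fset0 /\ exists2 j, (j < M)%N & s `<=` [fset j; j.+1].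
Let psimplex_neq0 s : psimplex s -> s != fset0. Proof. by case. Qed.
Let psimplex_face s t : psimplex s -> t `<=` s -> t != fset0 -> psimplex t.
Proof.
move=> [_ [j jM sj]] ts t0; split=> //; exists j => //.
exact: fsubset_trans sj.
Qed.

Definition path_complex := Complex psimplex_neq0 psimplex_face.

(** The edge runs from [false] to [true]. The apex of the cone will go to [false], so that level 0
    is the apex and level [M] the base. *)
Definition path_pos (j : nat) : point R bool :=
  pcomb (j%:R / M%:R) (vertex_point R true)
        (1 - j%:R / M%:R) (vertex_point R false).

Lemma path_pos_true j : path_pos j true = j%:R / M%:R.
Proof. by rewrite pcombE !vertex_pointE /=; ring. Qed.

Lemma path_pos_false j : path_pos j false = 1 - j%:R / M%:R.
Proof. by rewrite pcombE !vertex_pointE /=; ring. Qed.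

Let fsum_pair (x : point R nat) F j : finsupp x `<=` [fset j; j.+1] ->
  fsum x F = x j * F j + x j.+1 * F j.+1.
Proof.
move=> /fsum_incl ->; rewrite big_fsetU1 ?big_seq_fset1 // inE.
by rewrite neq_ltn ltnSn.
Qed.

Let mass_bool (z : point R bool) : mass z = z true + z false.
Proof.
have -> : z = pcomb (z true) (vertex_point R true) (z false) (vertex_point R
  false).
  by apply/fsfunP => -[]; rewrite pcombE !vertex_pointE /=; ring.
by rewrite mass_pcomb !mass_vertex !pcombE !vertex_pointE /=; ring.
Qed.

Let ex_interval (n : nat) (c m : R) : 0 <= c -> c <= n.+1%:R * m ->
  exists2 j, (j <= n)%N & j%:R * m <= c <= j.+1%:R * m.
Proof.
elim: n c => [|n IHn] c c0 cm; first by exists 0%N; rewrite // mul0r c0 cm.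
have [/IHn|/ltW lt] := leP c (n.+1%:R * m).
  by move=> /(_ c0)[j jn h]; exists j => //; exact: leqW.
by exists n.+1 => //; rewrite lt cm.
Qed.

Let pcomb_pair (x : point R nat) j : finsupp x `<=` [fset j; j.+1] ->
  x = pcomb (x j) (vertex_point R j) (x j.+1) (vertex_point R j.+1).
Proof.
move=> /fsubsetP xj; apply/fsfunP => i; rewrite pcombE !vertex_pointE.
have [->|ij] := eqVneq i j; first by rewrite -(negbK (j == _)) neq_ltn ltnSn
  /=; ring.
have [->|ij'] := eqVneq i j.+1; first by rewrite /=; ring.
rewrite !mulr0 addr0; apply/eqP; rewrite -memNfinsupp; apply/negP => /xj.
by rewrite !inE (negPf ij) (negPf ij').
Qed.

(* If the two edges are different, then both sides vanish except at a common
   vertex. *)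
Let pair_unique (x y : point R nat) j k : (j <= k)%N ->
  (forall i, 0 <= x i) -> (forall i, 0 <= y i) ->
  finsupp x `<=` [fset j; j.+1] -> finsupp y `<=` [fset k; k.+1] ->
  mass x = mass y -> fsum x (fun i => i%:R) = fsum y (fun i => i%:R) -> x = y.
Proof.
move=> jk x0 y0 xj yk; rewrite !massE.
rewrite (fsum_pair _ xj) (fsum_pair _ yk) (fsum_pair _ xj) (fsum_pair _ yk).
rewrite !mulr1 -!natr1 => e1 e2.
have [ejk|njk] := eqVneq j k.
  subst k; rewrite (pcomb_pair xj) (pcomb_pair yk).
  have h : x j.+1 = y j.+1 by move: e2; nra.
  have -> : x j = y j by move: e1; rewrite h => /addIr.
  by rewrite h.
have ltjk : (j.+1 <= k)%N by rewrite ltn_neqAle njk.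
have kj : (j%:R + 1 : R) <= k%:R by rewrite natr1 ler_nat.
rewrite (pcomb_pair xj) (pcomb_pair yk).
have := x0 j; have := x0 j.+1; have := y0 k; have := y0 k.+1.
set a := x j in e1 e2 *; set b := x j.+1 in e1 e2 *.
set c := y k in e1 e2 *; set d := y k.+1 in e1 e2 *.
move=> d0 c0 b0 a0.
have h : a + (k%:R - j%:R - 1) * (c + d) + d = 0.
  have -> : a + (k%:R - j%:R - 1) * (c + d) + d =
     (c * k%:R + d * (k%:R + 1)) - (a * j%:R + b * (j%:R + 1))
     - (j%:R + 1) * ((c + d) - (a + b)) by ring.
  by rewrite e1 e2; ring.
have h2 : 0 <= (k%:R - j%:R - 1) * (c + d).
  by apply: mulr_ge0; [lra|exact: addr_ge0].
have ea : a = 0 by lra.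
have ed : d = 0 by lra.
have eb : b = c by lra.
have [ek|nk] := eqVneq k j.+1.
  by rewrite ek ea ed eb; apply/fsfunP => i; rewrite !pcombE; ring.
have : (j%:R + 1 : R) < k%:R.
  by rewrite natr1 ltr_nat ltn_neqAle eq_sym nk.
move=> lt; have : (k%:R - j%:R - 1) * (c + d) = 0 by lra.
move=> /eqP; rewrite mulf_eq0 => /orP[/eqP|/eqP] h'; first by exfalso; lra.
have ec : c = 0 by lra.
by rewrite ea ed eb ec; apply/fsfunP => i; rewrite !pcombE; ring.
Qed.

Lemma path_subdivision : (0 < M)%N ->
  csubdivision edge_complex path_complex path_pos.
Proof.
move=> M0; have M0R : (0 : R) < M%:R by rewrite ltr0n.
split.
- move=> t [_ [j jM tj]]; exists [fset true; false].
    by rewrite /= /esimplex; apply/fset0Pn; exists true; rewrite !inE.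
  move=> w /(fsubsetP tj) wj; have wM : (w <= M)%N.
    by move: wj; rewrite !inE => /orP[/eqP ->|/eqP -> //]; exact: ltnW.
  split; first by apply/fsubsetP => -[]; rewrite !inE.
    case; rewrite ?path_pos_true ?path_pos_false; first by rewrite divr_ge0.
    by rewrite subr_ge0 ler_pdivrMr // mul1r ler_nat.
  by rewrite -[LHS]/(mass _) mass_bool path_pos_true path_pos_false; ring.
- move=> z [z0 _].
  have [||j jM /andP[h1 h2]] := @ex_interval M.-1 (z true * M%:R) (mass z).
  - by rewrite mulr_ge0.
  - by rewrite prednK // mulrC ler_wpM2l // point_le_mass.
  (* The coefficients solve two linear equations: their sum is [mass z], and the first moment, with
     weights [j] and [j.+1], is [z true * M%:R]. *)
  exists (pcomb (j.+1%:R * mass z - z true * M%:R) (vertex_point R j)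
                (z true * M%:R - j%:R * mass z) (vertex_point R j.+1)).
    set x := pcomb _ _ _ _.
    split=> [i|].
      by rewrite pcombE addr_ge0 // mulr_ge0 ?subr_ge0 // vertex_pointE.
    have [->|n0] := eqVneq (finsupp x) fset0; [by left|right; split=> //].
    exists j; first by rewrite -(prednK M0) ltnS.
    by have := finsupp_pcomb (j.+1%:R * mass z - z true * M%:R) (vertex_point R
      j)
      (z true * M%:R - j%:R * mass z) (vertex_point R j.+1);
        rewrite !finsupp_vertex.
  rewrite affine_ext_pcomb !affine_ext_vertex mass_bool -natr1.
  apply/fsfunP => -[]; rewrite pcombE ?path_pos_true ?path_pos_false -natr1;
    by field; rewrite gt_eqF.
move=> x y [x0 Px] [y0 Py] e.
have PE z : affine_ext path_pos z true = fsum z (fun i => i%:R) / M%:R.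
  rewrite affine_extE /fsum mulr_suml; apply: eq_bigr => i _.
  by rewrite path_pos_true mulrA.
have em : mass x = mass y.
  have pm z : mass (affine_ext path_pos z) = mass z.
    rewrite mass_affine_ext // => i _.
    by rewrite mass_bool path_pos_true path_pos_false; ring.
  by rewrite -pm e pm.
(* The image determines the mass and the first moment; by [pair_unique] these two numbers determine
   a point carried by one edge of the path. *)
have es : fsum x (fun i => i%:R) = fsum y (fun i => i%:R).
  have := congr1 (fun z : point R bool => z true) e.
  by rewrite !PE => /mulIf; apply; rewrite invr_eq0 gt_eqF.
have zero (z : point R nat) : (forall i, 0 <= z i) -> mass z = 0 -> forall i, z
  i = 0 :> R.
  by move=> z0 mz i; apply: finsupp_eq0; exact: mass_eq0.
case: Px => [Px|[_ [j _ xj]]].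
  have mx : mass x = 0 by rewrite /mass Px big_seq_fset0.
  by apply/fsfunP => i; rewrite !zero // -em.
case: Py => [Py|[_ [k _ yk]]].
  have my : mass y = 0 by rewrite /mass Py big_seq_fset0.
  by apply/fsfunP => i; rewrite !zero // em.
case: (leqP j k) => [jk|/ltnW kj]; first exact: pair_unique jk _ _ _ _ _ _.
by apply/esym; apply: pair_unique kj _ _ _ _ _ _.
Qed.

End Path.

(** * Splitting a weight into an initial and a final part *)

Section Cut.
Variables (R : realType) (T : choiceType) (leT : rel T).
Hypotheses (leT_total : total leT) (leT_anti : antisymmetric leT).
Hypothesis leT_trans : transitive leT.
Implicit Types (z a b : point R T).

(* [a] is the initial part of mass [c] of [z]. *)
Lemma cut_exists z c : (forall t, 0 <= z t) -> 0 <= c -> c <= mass z ->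
  exists a, [/\ forall t, 0 <= a t, forall t, a t <= z t, mass a = c &
    forall s t, s \in finsupp a -> a t < z t -> leT s t].
Proof.
have [n] := ubnP #|` finsupp z|.
elim: n z c => // n IHn z c lezn z0 c0 cz.
have [cc|cn] := eqVneq c 0.
  exists [fsfun of _ => 0]; split=> [t|t||s t]; rewrite ?fsfun0E ?finsupp0 //.
  by rewrite /mass finsupp0 big_seq_fset0 cc.
have c1 : 0 < c by rewrite lt_def cn.
have zn : finsupp z != fset0.
  by apply: contra_ltN c1 => /eqP h; move: cz; rewrite /mass h big_seq_fset0.
have [] := @ex_fset_min _ (fun w w' => leT w w') (finsupp z) zn.
- by move=> w w' _ _; apply/orP; exact: leT_total.
- by move=> w w' w'' _ _ _; exact: leT_trans.
move=> x xz xmin; have zx : 0 < z x by rewrite -point_gt0.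
have [le|/ltW lt] := leP c (z x).
  exists (pcomb c (vertex_point R x) 0 z); split.
  - by move=> t; rewrite pcombE vertex_pointE mul0r addr0 mulr_ge0 // ltW.
  - move=> t; rewrite pcombE vertex_pointE mul0r addr0.
    by case: (eqVneq t x) => [->|_]; rewrite ?mulr1 // mulr0.
  - by rewrite mass_pcomb mass_vertex mul0r addr0 mulr1.
  - move=> s t; rewrite mem_finsupp !pcombE !vertex_pointE !mul0r !addr0.
    case: (eqVneq s x) => [-> _ h|_]; last by rewrite mulr0 eqxx.
    apply: xmin; rewrite point_gt0 //; apply: le_lt_trans h.
    by rewrite mulr_ge0 // ltW.
have z'0 t : 0 <= pcomb 1 z (- z x) (vertex_point R x) t.
  rewrite pcombE vertex_pointE; case: (eqVneq t x) => [->|_].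
    by rewrite mul1r mulr1 subrr.
  by rewrite mulr0 addr0 mul1r.
have sub : finsupp (pcomb 1 z (- z x) (vertex_point R x)) `<=` finsupp z.
  apply: fsubset_trans (finsupp_pcomb _ _ _ _) _.
  by rewrite finsupp_vertex fsubUset fsubset_refl fsub1set.
have [||||a [a0 az ac al]] := IHn (pcomb 1 z (- z x) (vertex_point R x)) (c - z
  x).
- rewrite ltnS in lezn; apply: leq_trans lezn.
  apply: fproper_ltn_card; rewrite fproperE sub; apply/fsubsetPn;
    exists x => //.
  by rewrite memNfinsupp pcombE vertex_pointE eqxx mul1r mulr1 subrr.
- exact: z'0.
- by rewrite subr_ge0.
- by rewrite mass_pcomb mass_vertex mul1r mulr1 lerD2r.
exists (pcomb 1 a (z x) (vertex_point R x)); split.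
- by move=> t; rewrite pcombE addr_ge0 // mulr_ge0 ?vertex_pointE // ltW.
- by move=> t; have := az t; rewrite !pcombE; lra.
- by rewrite mass_pcomb mass_vertex ac; ring.
- move=> s t; rewrite mem_finsupp => sa lt'.
  have tz : t \in finsupp z.
    rewrite point_gt0 //; apply: le_lt_trans lt'.
    by rewrite pcombE addr_ge0 // mulr_ge0 ?vertex_pointE // ltW.
  have [->|sx] := eqVneq s x; first exact: xmin.
  apply: al; last by move: lt'; rewrite !pcombE; lra.
  move: sa; rewrite mem_finsupp pcombE vertex_pointE (negPf sx).
  by rewrite mulr0 addr0 mul1r.
Qed.

(** If [a] and [a'] of equal mass differ, then [a s < a' s] and [a' t < a t] for some [s] and [t],
    whence [b' s < b s] and [b t < b' t]. The two order conditions then give [leT s t] and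
    [leT t s], so [s = t], which is absurd. *)
Lemma cut_unique a b a' b' c : 0 < c ->
  (forall t, 0 <= a t) -> (forall t, 0 <= b t) ->
  (forall t, 0 <= a' t) -> (forall t, 0 <= b' t) -> mass a = mass a' ->
  (forall t, a t + c * b t = a' t + c * b' t) ->
  (forall s t, s \in finsupp a -> t \in finsupp b -> leT s t) ->
  (forall s t, s \in finsupp a' -> t \in finsupp b' -> leT s t) -> a = a'.
Proof.
move=> c0 a0 b0 a'0 b'0 em es ab ab'.
have [[s [l1 l2]] | no_s] := pselect (exists s, a s < a' s /\ b' s < b s).
  have [[t [l3 l4]] | no_t] := pselect (exists t, a' t < a t /\ b t < b' t).
    have est : s = t.
      apply: leT_anti; rewrite ab' ?ab ?point_gt0 //.
      - exact: le_lt_trans l3.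
      - exact: le_lt_trans l2.
      - exact: le_lt_trans l1.
      - exact: le_lt_trans l4.
    by exfalso; subst t; lra.
  exfalso.
  have le t : a t <= a' t.
    rewrite leNgt; apply/negP => h; apply: no_t; exists t; split=> //.
    by have := es t; nra.
  have : 0 < mass (pcomb 1 a' (-1) a).
    apply: lt_le_trans (point_le_mass s _).
      by rewrite pcombE; lra.
    by move=> t; have := le t; rewrite pcombE; lra.
  by rewrite mass_pcomb em; lra.
have le t : a' t <= a t.
  rewrite leNgt; apply/negP => h; apply: no_s; exists t; split=> //.
  by have := es t; nra.
apply/fsfunP => t.
have : (pcomb 1 a (-1) a') t = 0.
  apply: finsupp_eq0; apply: mass_eq0.
    by move=> s; have := le s; rewrite pcombE; lra.
  by rewrite mass_pcomb em; lra.
by rewrite pcombE; lra.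
Qed.

End Cut.
Lemma closed_simplex_vertex (R : realType) (V : choiceType) (s : {fset V}) v :
  v \in s -> closed_simplex s (vertex_point R v).
Proof.
move=> vs; split; first by rewrite finsupp_vertex fsub1set.
  by move=> w; rewrite vertex_pointE.
exact: mass_vertex.
Qed.

Lemma closed_simplex_pcomb (R : realType) (V : choiceType) (s : {fset V}) a b
    (x y : point R V) : 0 <= a -> 0 <= b -> a + b = 1 ->
  closed_simplex s x -> closed_simplex s y -> closed_simplex s (pcomb a x b y).
Proof.
move=> a0 b0 ab [xs x0 x1] [ys y0 y1]; split.
- by apply: fsubset_trans (finsupp_pcomb _ _ _ _) _; rewrite fsubUset xs ys.
- by move=> v; rewrite pcombE addr_ge0 // mulr_ge0.
- by rewrite -[LHS]/(mass _) mass_pcomb /mass x1 y1 !mulr1.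
Qed.

Section Collar.
Variables (R : realType) (T U : choiceType) (leT : rel T).
Hypotheses (leT_total : total leT) (leT_anti : antisymmetric leT).
Hypothesis leT_trans : transitive leT.
Variables (X : complex T) (Q : complex U) (q : U -> point R (option T)).

Let getl (c : T + U) := if c is inl t then Some t else None.
Let getr (c : T + U) := if c is inr u then Some u else None.
Let inlK : pcancel (@inl T U) getl. Proof. by []. Qed.
Let inrK : pcancel (@inr T U) getr. Proof. by []. Qed.
Let getlK : ocancel getl (@inl T U). Proof. by case. Qed.
Let getrK : ocancel getr (@inr T U). Proof. by case. Qed.

Definition outer (c : {fset T + U}) : {fset T} := preim_fset getl c.
Definition inner (c : {fset T + U}) : {fset U} := preim_fset getr c.

Lemma mem_outer c t : (t \in outer c) = (inl t \in c).
Proof. exact: mem_preim_fset inlK getlK _ _. Qed.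

Lemma mem_inner c u : (u \in inner c) = (inr u \in c).
Proof. exact: mem_preim_fset inrK getrK _ _. Qed.

Definition base_carrier (s : {fset U}) : {fset T} :=
  \bigcup_(u <- s) base_fset (finsupp (q u)).

(* The region between the copies of [X] at heights 1/2 and 1 is cut like a
   prism: a top face comes before a bottom simplex in the order of [T]. *)
Let collar_simplex (c : {fset T + U}) : Prop :=
  [/\ c != fset0, inner c = fset0 \/ Q (inner c) &
    outer c != fset0 ->
    [/\ X (outer c `|` base_carrier (inner c)),
        forall u, u \in inner c -> q u None = 0 &
        forall s t, s \in outer c -> t \in base_carrier (inner c) -> leT s t]].

Let collar_neq0 c : collar_simplex c -> c != fset0. Proof. by case. Qed.

Let collar_face c e : collar_simplex c -> e `<=` c -> e != fset0 ->
  collar_simplex e.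
Proof.
move=> [_ Qc Xc] /fsubsetP ec e0.
have so : outer e `<=` outer c.
  by apply/fsubsetP => t; rewrite !mem_outer; exact: ec.
have si : inner e `<=` inner c.
  by apply/fsubsetP => t; rewrite !mem_inner; exact: ec.
have sb : base_carrier (inner e) `<=` base_carrier (inner c).
  apply/fsubsetP => t /bigfcupP[u /andP[ue _] tu]; apply/bigfcupP;
    exists u => //.
  by rewrite (fsubsetP si).
split=> //.
  have [->|n0] := eqVneq (inner e) fset0; [by left|right].
  case: Qc => [Q0|Qc]; last exact: simplex_face Qc si n0.
  by move: si n0; rewrite Q0 fsubset0 => ->.
move=> /fset0Pn[t te]; have [|Xo N0 le] := Xc.
  by apply/fset0Pn; exists t; exact: (fsubsetP so).
split.
- apply: simplex_face Xo _ _; first exact: fsetUSS.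
  by apply/fset0Pn; exists t; rewrite inE te.
- by move=> u /(fsubsetP si); exact: N0.
- by move=> s t' /(fsubsetP so) h /(fsubsetP sb); exact: le.
Qed.

Definition collar := Complex collar_neq0 collar_face.

(** Taking midpoints with the apex shrinks [Q] to the inner half of the cone, while the vertices of
    [X] stay where they are. *)
Definition collar_pos (c : T + U) : point R (option T) :=
  match c with
  | inl t => vertex_point R (Some t)
  | inr u => pcomb 2^-1 (q u) 2^-1 (vertex_point R None)
  end.

Hypothesis subQ : csubdivision (cone_complex X) Q q.

Let opoint (m : point R (T + U)%type) : point R T := summand (@inl T U) getl m.
Let ipoint (m : point R (T + U)%type) : point R U := summand (@inr T U) getr m.

Let sumpt (a : point R T) (b : point R U) : point R (T + U)%type :=
  pcomb 1 (summand_inj (@inl T U) a) 1 (summand_inj (@inr T U) b).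

Let sumptl a b t : sumpt a b (inl t) = a t.
Proof.
by rewrite /sumpt pcombE (summand_injE inlK) summand_inj_out // mulr0 addr0
  mul1r.
Qed.

Let sumptr a b u : sumpt a b (inr u) = b u.
Proof.
by rewrite /sumpt pcombE (summand_injE inrK) summand_inj_out // mulr0 add0r
  mul1r.
Qed.

Let opointE m t : opoint m t = m (inl t).
Proof. exact: (summandE inlK getlK). Qed.
Let ipointE m u : ipoint m u = m (inr u).
Proof. exact: (summandE inrK getrK). Qed.

Let sumptK m : sumpt (opoint m) (ipoint m) = m.
Proof. by apply/fsfunP => -[t|u]; rewrite (sumptl, sumptr) (opointE, ipointE).
  Qed.

Let affine_ext_collar a b o : affine_ext collar_pos (sumpt a b) o =
  if o is Some t then a t + 2^-1 * affine_ext q b (Some t)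
  else 2^-1 * (affine_ext q b None + mass b).
Proof.
rewrite affine_extE fsum_pcomb !fsum_summand_inj !mul1r.
have -> : fsum b ((fun w => collar_pos w o) \o inr) =
    2^-1 * (affine_ext q b o + mass b * vertex_point R None o).
  rewrite affine_extE massE /fsum mulr_suml -big_split /= mulr_sumr.
  by apply: eq_bigr => u _; rewrite /= pcombE; ring.
case: o => [t|] /=; last first.
  rewrite vertex_pointE eqxx mulr1 /fsum big1 ?add0r // => t _ /=.
  by rewrite vertex_pointE mulr0.
rewrite !vertex_pointE mulr0 addr0 -[X in _ = X + _](fsum_delta a t).
congr (_ + _); apply: eq_fsum => s _ /=.
by rewrite vertex_pointE (inj_eq Some_inj) eq_sym.
Qed.

Let qQ := let: And3 h _ _ := subQ in h.

Let finsupp_base_image b : cpoints Q b ->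
  finsupp (base (affine_ext q b)) = base_carrier (finsupp b).
Proof.
move=> Qb; apply/fsetP => t; rewrite finsupp_base mem_base_fset.
apply/idP/bigfcupP => [/finsupp_affine_ext[u ub tu]|[u /andP[ub _] tu]].
  by exists u; rewrite ?ub // mem_base_fset.
have q0 w : w \in finsupp b -> forall o, 0 <= q w o.
  exact: (carrier_ge0 qQ Qb).
apply: (fsubsetP (finsupp_affine_ext_sub (proj1 Qb) q0 ub)).
by rewrite -mem_base_fset.
Qed.

Let apex_eq0 b : cpoints Q b ->
  affine_ext q b None = 0 <-> forall u, u \in finsupp b -> q u None = 0.
Proof.
move=> Qb; split=> [b0 u ub|h]; last first.
  by rewrite affine_extE /fsum big_seq big1 // => u /h ->; rewrite mulr0.
have q0 w : w \in finsupp b -> forall o, 0 <= q w o.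
  exact: (carrier_ge0 qQ Qb).
have /fsubsetP /(_ None) := finsupp_affine_ext_sub (proj1 Qb) q0 ub.
rewrite !mem_finsupp b0 eqxx; case: eqP => // _ /(_ isT); by [].
Qed.

(** The combinatorial conditions on the support of [b] are traded for conditions on its image in the
    cone over [X], which is where the subdivision property is checked. *)
Let cpoints_collar a b :
  cpoints collar (sumpt a b) <-> [/\ forall t, 0 <= a t, cpoints Q b &
    finsupp a != fset0 ->
    [/\ cpoints X (pcomb 1 a 1 (base (affine_ext q b))), affine_ext q b None =
      0 &
    forall s t, s \in finsupp a -> t \in finsupp (base (affine_ext q b)) ->
      leT s t]].
Proof.
have oE : outer (finsupp (sumpt a b)) = finsupp a.
  by apply/fsetP => t; rewrite mem_outer !mem_finsupp sumptl.
have iE : inner (finsupp (sumpt a b)) = finsupp b.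
  by apply/fsetP => t; rewrite mem_inner !mem_finsupp sumptr.
have ge0 : (forall c, 0 <= sumpt a b c) <->
    (forall t, 0 <= a t) /\ (forall u, 0 <= b u).
  split=> [h|[h1 h2] [t|u]]; last 2 first.
  - by rewrite sumptl.
  - by rewrite sumptr.
  by split=> [t|u]; [rewrite -(sumptl a b)|rewrite -(sumptr a b)].
have uE : (forall t, 0 <= a t) -> cpoints Q b ->
    finsupp (pcomb 1 a 1 (base (affine_ext q b))) =
    finsupp a `|` base_carrier (finsupp b).
  move=> a0 Qb; rewrite -finsupp_base_image //.
  have [bb0 _] := cpoints_affine_ext qQ Qb.
  apply/fsetP => t; rewrite inE !point_gt0 //; last 2 first.
  - by move=> s; rewrite baseE.
  - by move=> s; rewrite pcombE baseE !mul1r addr_ge0.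
  rewrite pcombE baseE !mul1r; have := a0 t; have := bb0 (Some t).
  move=> h1 h2; apply/idP/orP => [h|[h|h]]; [|lra|lra].
  by have [h'|h'] := ltP 0 (a t); [left|right; lra].
split=> [[/ge0[a0 b0] C]|[a0 Qb C]].
  have C' : collar_simplex (finsupp (sumpt a b)) \/
      (finsupp a = fset0 /\ finsupp b = fset0).
    case: C => [C|]; [right|by left].
    by rewrite -oE -iE C; split; apply/fsetP => t;
      rewrite ?mem_outer ?mem_inner.
  rewrite /collar_simplex oE iE in C'.
  have Qb : cpoints Q b by split=> //; case: C' => [[]//|[_]]; by left.
  split=> // an; case: C' => [[_ _ /(_ an)[Xab q0 le]]|[h]];
    last by rewrite h in an.
  split.
  - have [bb0 _] := cpoints_affine_ext qQ Qb.
    split; last by right; rewrite uE.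
    by move=> t; rewrite pcombE baseE !mul1r addr_ge0.
  - exact/apex_eq0.
  - by rewrite finsupp_base_image.
split; first by apply/ge0; split=> //; case: Qb.
have [|n0] := eqVneq (finsupp (sumpt a b)) fset0; first by left.
right; rewrite /= /collar_simplex oE iE; split=> //; first by case: Qb.
move=> an; have [Xab b0 le] := C an; split.
- rewrite -uE //; case: Xab => _ [h|//]; exfalso.
  move: h; rewrite uE // => /eqP; rewrite fsetU_eq0 => /andP[/eqP h _].
  by rewrite h in an.
- exact/apex_eq0.
- by rewrite -finsupp_base_image.
Qed.

Let collar_carrier c : collar c -> exists2 s, cone_complex X s &
  forall w, w \in c -> closed_simplex s (collar_pos w).
Proof.
move=> [c0 Qc Xc]; have [out0|oc] := eqVneq (outer c) fset0.
  have Qi : Q (inner c).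
    case: Qc => // i0; case/fset0Pn: c0 => -[t|u];
      rewrite -?mem_outer -?mem_inner.
      by rewrite out0.
    by rewrite i0.
  have [s [s0 Xs] qs] := qQ Qi; exists (None |` s).
    split; first by apply/fset0Pn; exists None; rewrite !inE.
    suff -> : base_fset (None |` s) = base_fset s by [].
    by apply/fsetP => t; rewrite !mem_base_fset !inE.
  move=> [t|u]; first by rewrite -mem_outer out0.
  rewrite -mem_inner => /qs [qu u0 u1] /=.
  apply: closed_simplex_pcomb; rewrite ?invr_ge0 //; first lra.
    split=> //; apply: fsubset_trans qu _; exact: fsubsetUr.
  by apply: closed_simplex_vertex; rewrite !inE.
have [Xo q0 le] := Xc oc.
exists (None |` (Some @` (outer c `|` base_carrier (inner c)))).
  split; first by apply/fset0Pn; exists None; rewrite !inE.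
  right; move: (_ `|` base_carrier _) Xo => r Xr.
  suff -> : base_fset (None |` (Some @` r)) = r by [].
  apply/fsetP => t; rewrite mem_base_fset !inE /=.
  by apply/imfsetP/idP => [[s /= sr [->]]|h]; last exists t.
move=> [t|u] /=.
  rewrite -mem_outer => tc; apply: closed_simplex_vertex.
  by rewrite !inE /= in_imfset // inE tc.
rewrite -mem_inner => uc.
have Qi : Q (inner c) by case: Qc => // h; rewrite h in uc.
have [s _ /(_ _ uc)[_ u0 u1]] := qQ Qi.
apply: closed_simplex_pcomb; rewrite ?invr_ge0 //; first lra.
  split=> //; apply/fsubsetP => -[t tu|_]; last by rewrite !inE.
  rewrite !inE /= in_imfset // inE; apply/orP; right.
  by apply/bigfcupP; exists u; rewrite ?uc // mem_base_fset.
by apply: closed_simplex_vertex; rewrite !inE.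
Qed.

Let mass_image b : cpoints Q b ->
  mass b = affine_ext q b None + mass (base (affine_ext q b)).
Proof. by move=> Qb; rewrite -(mass_carrier qQ Qb) mass_option. Qed.

Lemma collar_subdivision : csubdivision (cone_complex X) collar collar_pos.
Proof.
have [_ surQ injQ] := subQ.
split; first exact: collar_carrier.
- move=> z /cpoints_cone[z0 Xz].
  have bz0 t : 0 <= base z t by rewrite baseE.
  have cX k (b : point R T) : 0 <= k -> (forall t, 0 <= b t) -> (forall t, b t
    <= base z t) ->
      cpoints (cone_complex X) (cone_point k (pcomb 2 b 0 b)).
    move=> k0 b0 bz; apply: cpoints_cone_point => //; split=> [t|].
      by rewrite pcombE mul0r addr0 mulr_ge0.
    have [|n0] := eqVneq (finsupp (pcomb 2 b 0 b)) fset0; [by left|right].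
    have sub : finsupp (pcomb 2 b 0 b) `<=` finsupp (base z).
      apply/fsubsetP => t; rewrite mem_finsupp pcombE mul0r addr0 => h.
      rewrite point_gt0 //; apply: lt_le_trans (bz t).
      by rewrite lt_def b0 andbT; apply: contra h => /eqP ->; rewrite mulr0.
    case: Xz => _ [zz|Xz]; last exact: simplex_face Xz sub n0.
    by move: sub n0; rewrite zz fsubset0 => ->.
  (* The inner half consists of the [z] with [mass (base z) <= z None]. There, inverting
     [z = (B + mass B * apex) / 2] gives the point [B] passed to [surQ]. *)
  have [ge|/ltW lt] := leP (mass (base z)) (z None).
    have [|b Qb be] := surQ (cone_point (z None - mass (base z))
      (pcomb 2 (base z) 0 (base z))).
      by apply: cX; rewrite ?subr_ge0.
    exists (sumpt [fsfun of _ => 0] b).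
      apply/cpoints_collar; split=> // [t|]; first by rewrite fsfun0E.
      by rewrite finsupp0.
    apply/fsfunP => -[t|]; rewrite affine_ext_collar /=.
      by rewrite be cone_point_Some fsfun0E pcombE baseE; field.
    by rewrite mass_image // be cone_point_None base_cone_point mass_pcomb;
      field.
  (* In the outer half the excess [mass (base z) - z None] is taken from the [leT]-first part of the
     base and stays on [X]. The remainder [r] has mass [z None]; doubled and then halved towards the
     apex, it restores both [r] and the apex coordinate. *)
  have [|||a [a0 az am ale]] := cut_exists leT_total leT_trans
      (z := base z) (c := mass (base z) - z None).
  - by [].
  - by rewrite subr_ge0.
  - by rewrite gerBl.
  pose r := pcomb 1 (base z) (-1) a.
  have rE t : r t = base z t - a t by rewrite pcombE mul1r mulN1r.
  have [|b Qb be] := surQ (cone_point 0 (pcomb 2 r 0 r)).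
    apply: cX => // t; rewrite rE ?subr_ge0 //.
    by rewrite gerBl.
  exists (sumpt a b).
    apply/cpoints_collar; split=> // an; rewrite be base_cone_point
      cone_point_None.
    split=> //.
      split=> [t|].
        rewrite !pcombE mul0r addr0 mul1r.
        by have := a0 t; have := az t; lra.
      right; case: Xz => _ [zz|].
        case/fset0Pn: an => t; rewrite point_gt0 // => at0.
        have : t \in finsupp (base z).
          by rewrite point_gt0 //; exact: lt_le_trans (az t).
        by rewrite zz.
      suff -> : finsupp (pcomb 1 a 1 (pcomb 2 r 0 r)) = finsupp (base z) by [].
      have h t : 0 <= pcomb 1 a 1 (pcomb 2 r 0 r) t.
        by rewrite !pcombE; have := a0 t; have := az t; lra.
      apply/fsetP => t; rewrite !point_gt0 // !pcombE.
      have := a0 t; have := az t; have := bz0 t.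
      by move=> *; apply/idP/idP => ?; lra.
    move=> s t sa tr; apply: ale => //; move: tr.
    rewrite mem_finsupp pcombE mul0r addr0 rE => h.
    rewrite lt_neqAle az andbT; apply: contra h => /eqP ->.
    by rewrite subrr mulr0.
  apply/fsfunP => -[t|]; rewrite affine_ext_collar /=.
    by rewrite be cone_point_Some pcombE rE baseE; field.
  by rewrite mass_image // be cone_point_None base_cone_point !mass_pcomb am;
    field.
move=> m1 m2; rewrite -(sumptK m1) -(sumptK m2).
move: (opoint m1) (ipoint m1) (opoint m2) (ipoint m2) => a b a' b' {m1 m2}.
move=> /cpoints_collar[a0 Qb C] /cpoints_collar[a'0 Qb' C'] e.
have eS t : a t + 2^-1 * base (affine_ext q b) t =
    a' t + 2^-1 * base (affine_ext q b') t.
  have := congr1 (fun z : point R _ => z (Some t)) e.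
  by rewrite !affine_ext_collar !baseE.
have eN := congr1 (fun z : point R _ => z None) e.
rewrite !affine_ext_collar !mass_image // in eN; move: e => _.
set B := affine_ext q b in C eS eN; set B' := affine_ext q b' in C' eS eN.
have [B0 _] := cpoints_affine_ext qQ Qb; rewrite -/B in B0.
have [B'0 _] := cpoints_affine_ext qQ Qb'; rewrite -/B' in B'0.
have eM : mass a + 2^-1 * mass (base B) = mass a' + 2^-1 * mass (base B').
  have := congr1 (@mass R T) (_ : pcomb 1 a 2^-1 (base B) = pcomb 1 a' 2^-1
    (base B')).
  rewrite !mass_pcomb !mul1r; apply.
  by apply/fsfunP => t; rewrite !pcombE !mul1r.
have zero (x : point R T) : (forall t, 0 <= x t) -> mass x = 0 ->
    x = [fsfun of _ => 0].
  move=> x0 mx; apply/fsfunP => t; rewrite fsfun0E.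
  by apply: finsupp_eq0; exact: mass_eq0.
have pos (x : point R T) : (forall t, 0 <= x t) -> mass x != 0 ->
    finsupp x != fset0 /\ 0 < mass x.
  move=> x0 mx; split; last by rewrite lt_def mx mass_ge0.
  by apply: contra mx => /eqP h; rewrite /mass h big_seq_fset0.
(* By [eM] and [eN], the difference [mass a - B None] depends only on the image. Both terms are
   nonnegative and, by the collar condition, one of them vanishes; so each is determined, and
   [cut_unique] applies. *)
have [ea eB] : a = a' /\ B None = B' None.
  have BN0 := B0 None; have BN'0 := B'0 None.
  have [ma|ma] := eqVneq (mass a) 0; have [ma'|ma'] := eqVneq (mass a') 0.
  - by rewrite (zero a) // (zero a') //; split=> //; lra.
  - have [an' am'] := pos _ a'0 ma'; have [_ h _] := C' an'.
    exfalso; lra.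
  - have [an am] := pos _ a0 ma; have [_ h _] := C an.
    exfalso; lra.
  - have [an' am'] := pos _ a'0 ma'; have [_ h' le'] := C' an'.
    have [an am] := pos _ a0 ma; have [_ h le] := C an.
    split; last by rewrite h h'.
    have half0 : (0 : R) < 2^-1 by rewrite invr_gt0.
    apply: (cut_unique leT_anti half0 _ _ _ _ _ eS le le') => //.
    + by move=> t; rewrite baseE.
    + by move=> t; rewrite baseE.
    + lra.
suff -> : b = b' by rewrite ea.
apply: injQ => //; rewrite -/B -/B' -(cone_pointK B) -(cone_pointK B') eB.
congr cone_point; apply/fsfunP => t; have := eS t; rewrite ea.
by move=> /addrI /mulfI; apply; rewrite invr_eq0 pnatr_eq0.
Qed.

End Collar.
(** * Topology of polyhedra and of their cones *)

Lemma fsum_fin (R : realType) (T : finType) (x : point R T) F :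
  fsum x F = \sum_(t : T) x t * F t.
Proof.
rewrite /fsum big_uniq ?fset_uniq //= big_mkcond; apply: eq_bigr => t _.
by case: ifPn => //; rewrite memNfinsupp => /eqP ->; rewrite mul0r.
Qed.

Lemma continuous_bigsum (R : realType) (Y : topologicalType) (I : Type)
    (r : seq I) (f : I -> Y -> R) :
  (forall i, continuous (f i)) -> continuous (fun y => \sum_(i <- r) f i y).
Proof.
move=> cf; elim: r => [|i r IHr].
  under eq_fun do rewrite big_nil; exact: cst_continuous.
by under eq_fun do rewrite big_cons; move=> y; apply: continuousD;
  [exact: cf|exact: IHr].
Qed.

Lemma initial_compact (S : choiceType) (T : topologicalType) (f : S -> T) :
  compact (range f) -> compact [set: initial_topology f].
Proof.
move=> cf F FF _.
have [|_ [[s _ <-]] cls] := cf (f @ F) _.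
  by apply: (@filterS _ F _ setT) => [s _|]; [exists s|exact: filterT].
exists s; split=> // A B FA [_ [[C oC <-] Cs] CB].
have [|_ [[a Aa <-] Ca]] := cls (f @` A)%classic C _ (open_nbhs_nbhs (conj oC
  Cs)).
  by apply: (@filterS _ F _ A) => // a Aa; exists a.
by exists a; split=> //; exact: CB.
Qed.

Lemma initial_hausdorff (S : choiceType) (T : topologicalType) (f : S -> T) :
  injective f -> hausdorff_space T -> hausdorff_space (initial_topology f).
Proof.
move=> fI hT p q clpq; apply: fI; apply: hT => A B fA fB.
have [s [sA sB]] := clpq (f @^-1` A) (f @^-1` B)
  (@initial_continuous _ _ f p A fA) (@initial_continuous _ _ f q B fB).
by exists (f s).
Qed.

Section Polyhedron.
Variables (R : realType) (T : finType) (X : complex T).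

Lemma polyhedron_inj (x y : polyhedron R X) :
  (val x : point R T) =1 val y -> x = y.
Proof. by move=> h; apply: val_inj; apply/fsfunP. Qed.

Lemma coordinate_continuous t :
  continuous (fun x : polyhedron R X => (val x : point R T) t).
Proof.
move=> x; apply: (@continuous_comp _ _ _ (@coordinates R T X) (fun y => y t)).
  exact: initial_continuous.
exact: (@proj_continuous _ (fun=> R) t).
Qed.

Lemma continuous_polyhedron (Y : topologicalType) (f : Y -> polyhedron R X) :
  (forall t, continuous (fun y => (val (f y) : point R T) t)) -> continuous f.
Proof.
move=> cf; apply: continuous_comp_initial => y.
apply/cvg_sup => t A [_ [[B oB <-] Bf] BA].
by apply: filterS BA _; apply: (cf t y); exact: open_nbhs_nbhs.
Qed.

Lemma polyhedron_hausdorff : hausdorff_space (polyhedron R X).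
Proof.
apply: initial_hausdorff.
  by move=> x y e; apply: polyhedron_inj => t; exact: (congr1 (fun h => h t) e).
by apply: hausdorff_product => _; exact: Rhausdorff.
Qed.

Lemma polyhedron_points (y : T -> R) (s : {fset T}) : X s ->
  (forall t, 0 <= y t) -> \sum_(t : T) y t = 1 -> (forall t, t \notin s -> y t
    = 0) ->
  exists x : polyhedron R X, (val x : point R T) =1 y.
Proof.
move=> Xs y0 y1 ys; pose x : point R T := [fsfun t in [fset t in T] => y t | 0].
have xE t : x t = y t by rewrite fsfun_fun inE.
have Xx : points R X x.
  exists s => //; split=> [|t|]; last 2 first.
  - by rewrite xE.
  - change (mass x = 1); rewrite massE fsum_fin -[RHS]y1.
    by apply: eq_bigr => t _; rewrite xE mulr1.
  apply/fsubsetP => t; rewrite mem_finsupp xE; apply: contraR => /ys ->.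
  by rewrite eqxx.
by exists (exist (fun y => y \in points R X) x (mem_set Xx)).
Qed.

(** In coordinates the polyhedron is the part of the cube on which the coordinates sum to 1 and
    which lies in a finite union of coordinate subspaces, one for each simplex; it is thus closed in
    a compact set. *)
Lemma polyhedron_compact : compact [set: polyhedron R X].
Proof.
apply: initial_compact.
pose I01 := [set f : {ptws T -> R} | forall t, `[0, 1]%classic (f t)].
pose S1 := [set f : {ptws T -> R} | \sum_(t : T) f t = 1].
pose F (s : {fset T}) := [set f : {ptws T -> R} | forall t, t \notin s -> f t =
  0].
have -> : range (@coordinates R T X) =
    (I01 `&` S1 `&` \bigcup_(s in [set s | X s]) F s)%classic.
  apply/seteqP; split => [_ [x _ <-]|y [[y01 y1] [s Xs ys]]].
    have /set_mem/pointsP[[x0 Xx] x1] := valP x; split; first split.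
    - move=> t; rewrite /= in_itv /= /coordinates x0 /=.
      by rewrite -x1; exact: point_le_mass.
    - by rewrite /S1 /= -x1 massE fsum_fin; apply: eq_bigr => t _;
      rewrite /= mulr1.
    - have /set_mem[s Xs [xs _ _]] := valP x; exists s => // t ts.
      by apply/eqP; rewrite -memNfinsupp; apply: contra ts => /(fsubsetP xs).
  have [|x xy] := polyhedron_points Xs _ y1 ys.
    by move=> t; have := y01 t; rewrite /= in_itv /= => /andP[].
  by exists x => //; apply/funext => t; exact: xy.
have proj_cont t : continuous (fun f : {ptws T -> R} => f t).
  exact: (@proj_continuous _ (fun=> R) t).
rewrite -setIA; apply: compact_closedI.
  apply: (@tychonoff T (fun=> R) (fun=> `[0, 1]%classic)) => _.
  exact: segment_compact.
apply: closedI.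
  apply: (@preimage_closed {ptws T -> R} R (fun f => \sum_(t : T) f t) [set x |
    x = 1]).
    by move=> f _; exact: continuous_bigsum.
  exact: closed_eq.
apply: closed_bigcup => [|s _]; first exact: finite_finset.
have -> : F s = (\bigcap_(t in [set t | t \notin s])
    [set f : {ptws T -> R} | f t = 0])%classic.
  by apply/seteqP; split.
apply: closed_bigI => t _.
apply: (@preimage_closed {ptws T -> R} R (fun f => f t) [set x | x = 0]).
  by move=> f _; exact: proj_cont.
exact: closed_eq.
Qed.

End Polyhedron.

Lemma compact_bijection (Y Z : topologicalType) (f : Y -> Z) :
  compact [set: Y] -> hausdorff_space Z -> continuous f -> injective f ->
  (forall z, exists y, f y = z) ->
  exists k : Z -> Y, [/\ continuous k, cancel f k & cancel k f].
Proof.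
move=> cY hZ cf fI /choice[k kK]; exists k.
have fK : cancel f k by move=> y; apply: fI.
split=> //; apply/continuous_closedP => C cC.
have -> : k @^-1` C = (f @` C)%classic.
  apply/seteqP; split => [z Cz|_ [y Cy <-]]; last by rewrite /= fK.
  by exists (k z).
apply: compact_closed => //; apply: continuous_compact.
  exact: continuous_subspaceT.
by apply: (subclosed_compact cC cY).
Qed.

Section SubdivisionHomeo.
Variables (R : realType) (T U : finType) (X : complex T) (P : complex U).
Variable p : U -> point R T.
Hypothesis subP : csubdivision X P p.

Let bijP := let: Build_subdivision _ h := (subdivision_csub X P p).2 subP in h.

Definition subdivision_map (x : polyhedron R P) : polyhedron R X :=
  exist (fun y => y \in points R X) _
    (mem_set (let: And3 f _ _ := bijP in f _ (set_mem (valP x)))).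

Lemma subdivision_map_continuous : continuous subdivision_map.
Proof.
apply: continuous_polyhedron => t /=.
under eq_fun do rewrite affine_extE fsum_fin.
apply: continuous_bigsum => u y; apply: continuousM.
  exact: coordinate_continuous.
exact: cst_continuous.
Qed.

Lemma subdivision_map_homeo : exists k : polyhedron R X -> polyhedron R P,
  [/\ continuous k, cancel subdivision_map k & cancel k subdivision_map].
Proof.
have [_ injp surp] := bijP.
apply: compact_bijection.
- exact: polyhedron_compact.
- exact: polyhedron_hausdorff.
- exact: subdivision_map_continuous.
- move=> x y /(congr1 val) /= e; apply: val_inj.
  by apply: injp e; exact: valP.
- move=> z; have [x Px xz] := surp _ (set_mem (valP z)).
  exists (exist (fun y => y \in points R P) x (mem_set Px)).
  exact: val_inj.
Qed.

End SubdivisionHomeo.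

(** * The topological cone as the polyhedron of the cone complex *)

Section ConeHomeomorphism.
Variables (R : realType) (T : finType) (X : complex T).

Local Notation I := (unit_interval R).

Lemma unit_interval_itv (t : I) : 0 <= val t <= 1.
Proof. by have := set_mem (valP t); rewrite /= in_itv. Qed.

Let cone_pre_subproof (a : polyhedron R X * I) :
  cone_point (1 - val a.2) (pcomb (val a.2) (val a.1 : point R T) 0 (val a.1))
    \in points R (cone_complex X).
Proof.
have /andP[t0 t1] := unit_interval_itv a.2.
apply/mem_set/pointsP.
have /set_mem/pointsP[Xx x1] := valP a.1; split.
  by apply: cpoints_cone_point; [rewrite subr_ge0|exact: cpoints_scale].
by rewrite mass_option cone_point_None base_cone_point mass_pcomb x1; ring.
Qed.

Definition cone_pre (a : polyhedron R X * I) : polyhedron R (cone_complex X) :=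
  exist (fun y => y \in points R (cone_complex X)) _ (cone_pre_subproof a).

Let snd_continuous : continuous (fun a : polyhedron R X * I => val a.2 : R).
Proof.
move=> a; apply: (@continuous_comp _ _ _ snd (fun t : I => val t : R)).
  exact: cvg_snd.
exact: (@initial_continuous _ _ (@set_val R `[(0 : R), 1]%classic)).
Qed.

Let fst_continuous t :
  continuous (fun a : polyhedron R X * I => (val a.1 : point R T) t).
Proof.
move=> a; apply: (@continuous_comp _ _ _ fst
  (fun x : polyhedron R X => (val x : point R T) t)).
  exact: cvg_fst.
exact: coordinate_continuous.
Qed.

Lemma cone_pre_continuous : continuous cone_pre.
Proof.
apply: continuous_polyhedron => -[t|] /=.
  under eq_fun do rewrite cone_point_Some pcombE mul0r addr0.
  move=> a; exact: (@continuousM R _ (fun a : polyhedron R X * I => val a.2)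
    (fun a => (val a.1 : point R T) t) a (@snd_continuous a) (@fst_continuous t
      a)).
under eq_fun do rewrite cone_point_None.
move=> a; exact: (@continuousB _ _ _ (fun=> 1 : R^o)
  (fun a : polyhedron R X * I => val a.2) a (@cst_continuous _ _ _ _)
    (@snd_continuous a)).
Qed.

Lemma cone_pre_eq a b : (cone_pre a = cone_pre b) <-> cone_rel R (polyhedron R
  X) a b.
Proof.
rewrite /cone_rel /=; split=> [e|/predU1P[-> //|/andP[/eqP a0 /eqP b0]]].
  have /fsfunP e' := congr1 val e.
  have et : val a.2 = val b.2 :> R.
    by have := e' None; rewrite !cone_point_None => /addrI /oppr_inj.
  have [b0|bn] := eqVneq (val b.2) 0; first by rewrite et b0 eqxx orbT.
  apply/orP; left; apply/eqP; case: a b e e' et bn => [x s] [y t] /= _ e' st t0.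
  congr pair; last exact: val_inj.
  apply: polyhedron_inj => u; have := e' (Some u).
  rewrite !cone_point_Some !pcombE !mul0r !addr0 st => /mulfI; exact.
apply: val_inj; apply/fsfunP => -[t|] /=; rewrite ?cone_point_Some
  ?cone_point_None.
  by rewrite !pcombE a0 b0 !mul0r.
by rewrite a0 b0.
Qed.

(** The point [x0] is needed over the apex: for empty [X] the quotient would be empty, whereas
    [cone_complex X] still has its apex. *)
Lemma cone_pre_surj (x0 : polyhedron R X) z : exists a, cone_pre a = z.
Proof.
set y : point R (option T) := val z.
have /set_mem/pointsP[/cpoints_cone[y0 Xy] y1] := valP z.
have my : mass (base y) = 1 - y None by rewrite -y1 mass_option addrC addKr.
have It : 1 - y None \in `[(0 : R), 1]%classic.
  apply/mem_set; rewrite /= in_itv /= subr_ge0 gerBl y0 andbT.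
  by rewrite -y1 point_le_mass.
pose t : I := exist (fun s => s \in `[(0 : R), 1]%classic) _ It.
have [m0|mn] := eqVneq (1 - y None) 0.
  exists (x0, t); apply: val_inj; apply/fsfunP => -[u|] /=.
    rewrite cone_point_Some pcombE m0 !mul0r addr0 -/y -baseE.
    by rewrite finsupp_eq0 //; apply: mass_eq0; [case: Xy|rewrite my].
  by rewrite cone_point_None -/y; ring.
have m1 : 0 <= 1 - y None by rewrite -my mass_ge0 //; case: Xy.
have Xx : points R X (pcomb (1 - y None)^-1 (base y) 0 (base y)).
  apply/pointsP; split; first by apply: cpoints_scale; rewrite ?invr_ge0.
  by rewrite mass_pcomb my mulVf // mul0r addr0.
exists (exist (fun y => y \in points R X) _ (mem_set Xx), t).
apply: val_inj; apply/fsfunP => -[u|] /=.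
  rewrite cone_point_Some !pcombE !mul0r !addr0 mulrA divff // mul1r.
  by rewrite baseE.
by rewrite cone_point_None -/y; ring.
Qed.

Definition cone_map (c : Defs.cone R (polyhedron R X)) :
    polyhedron R (cone_complex X) :=
  cone_pre (repr c).

Let conePi (a : polyhedron R X * I) : Defs.cone R (polyhedron R X) :=
  (\pi_(Defs.cone R (polyhedron R X)) a)%qT.

Lemma cone_map_pi a : cone_map (conePi a) = cone_pre a.
Proof.
apply/cone_pre_eq.
apply/(@eqmodP _ (cone_rel R (polyhedron R X))).
exact: reprK.
Qed.

Lemma cone_map_inj : injective cone_map.
Proof.
move=> c c' /cone_pre_eq.
move=> /(@eqmodP _ (cone_rel R (polyhedron R X))) e.
by rewrite -[c]reprK -[c']reprK.
Qed.

Lemma cone_map_continuous : continuous cone_map.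
Proof.
apply: (@repr_comp_continuous _ {eq_quot (cone_rel R (polyhedron R X))}%qT).
  exact: cone_pre_continuous.
move=> a b /eqP /(@eqmodP _ (cone_rel R (polyhedron R X))) h.
by apply/eqP/cone_pre_eq.
Qed.

Lemma unit_interval_compact : compact [set: I].
Proof.
apply: initial_compact.
suff -> : range (@set_val R `[(0 : R), 1]%classic) = `[(0 : R), 1]%classic.
  exact: segment_compact.
apply/seteqP; split => [_ [t _ <-]|t t01]; first exact: set_mem (valP t).
by exists (exist (fun s => s \in `[(0 : R), 1]%classic) t (mem_set t01)).
Qed.

Lemma cone_compact : compact [set: Defs.cone R (polyhedron R X)].
Proof.
have -> : [set: Defs.cone R (polyhedron R X)] = range conePi.
  apply/seteqP; split=> // c _; exists (repr c) => //; exact: reprK.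
apply: continuous_compact.
  apply: continuous_subspaceT.
  exact: (@pi_continuous _ {eq_quot (cone_rel R (polyhedron R X))}%qT).
rewrite -setXTT; apply: compact_setX.
  exact: polyhedron_compact.
exact: unit_interval_compact.
Qed.

(** A formula for the inverse divides by the cone parameter, which vanishes at the apex; continuity
    there comes from compactness of the cone instead. *)
Lemma cone_map_homeo (x0 : polyhedron R X) :
  exists k : polyhedron R (cone_complex X) -> Defs.cone R (polyhedron R X),
  [/\ continuous k, cancel cone_map k & cancel k cone_map].
Proof.
apply: compact_bijection.
- exact: cone_compact.
- exact: polyhedron_hausdorff.
- exact: cone_map_continuous.
- exact: cone_map_inj.
- move=> z; have [a az] := cone_pre_surj x0 z; exists (conePi a).
  by rewrite cone_map_pi.
Qed.

Lemma cone_map_base x t :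
  (val (cone_map (cone_base R x)) : point R (option T)) t =
  summand_inj (@Some T) (val x) t.
Proof.
rewrite [cone_map _]cone_map_pi /= pcombE subrr mul0r addr0 mul1r.
suff -> : pcomb 1 (val x : point R T) 0 (val x) = val x by [].
by apply/fsfunP => u; rewrite pcombE mul0r addr0 mul1r.
Qed.

End ConeHomeomorphism.

Lemma cone_triangulation (R : realType) (T U : finType) (X : complex T)
    (P : complex U) (p : U -> point R (option T)) (i : T -> U)
    (iXP : simplicial X P i) (x0 : polyhedron R X) :
  csubdivision (cone_complex X) P p ->
  (forall t, p (i t) = vertex_point R (Some t)) ->
  exists h : polyhedron R P -> Defs.cone R (polyhedron R X), homeomorphism h /\
    forall x : polyhedron R X, h (realization_map iXP x) = cone_base R x.
Proof.
move=> subP pS; have [k [kC kK Kk]] := cone_map_homeo x0.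
have [l [lC lK Kl]] := subdivision_map_homeo subP.
exists (k \o subdivision_map subP); split.
  split.
    by move=> y; apply: continuous_comp; [exact:
      subdivision_map_continuous|exact: kC].
  exists (l \o @cone_map R T X); split.
  - by move=> y; apply: continuous_comp; [exact: cone_map_continuous|exact: lC].
  - by move=> y /=; rewrite Kk lK.
  - by move=> c /=; rewrite Kl kK.
move=> x; rewrite -[RHS]kK; congr k; apply: polyhedron_inj => t.
rewrite cone_map_base /= affine_ext_comp /summand_inj !affine_extE.
by apply: eq_fsum => u _ /=; rewrite affine_ext_vertex pS.
Qed.

(** * From topological connectedness to edge paths *)

Section Connectedness.
Variables (R : realType) (T F : finType) (X : complex T) (Y : complex F).
Variable p : F -> point R T.
Hypothesis subY : csubdivision X Y p.
Hypothesis X_connected : connected [set: polyhedron R X].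

(** The affine extension [phi] of the indicator of [A] takes only the values 0 and 1, since [A]
    contains all or none of the vertices of a simplex. Hence [phi >= 1/2] and [phi > 1/2] define the
    same set, which is both closed and open. *)
Lemma connected_vertices (A : pred F) :
  (exists2 u, Y [fset u] & A u) ->
  (forall u v, Y [fset u; v] -> A u -> A v) -> forall v, Y [fset v] -> A v.
Proof.
move=> [u Yu Au] adjA v Yv.
have [k [kC kK Kk]] := subdivision_map_homeo subY.
pose phi (y : polyhedron R Y) := \sum_(w : F) (val y : point R F) w * (A w)%:R.
have phiC : continuous (phi \o k).
  move=> x; apply: continuous_comp; first exact: kC.
  apply: continuous_bigsum => w y.
  exact: (@continuousM R _ (fun y : polyhedron R Y => (val y : point R F) w)
    (fun=> (A w)%:R) y (@coordinate_continuous _ _ _ w y) (@cst_continuous _ _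
      _ y)).
have phi01 y : phi y = 0 \/ phi y = 1.
  have /set_mem/pointsP[[y0 Yy] y1] := valP y.
  rewrite /phi -(fsum_fin (val y : point R F) (fun w => (A w)%:R)).
  have [[w wy Aw]|noA] := pselect (exists2 w, w \in finsupp (val y : point R F)
    & A w).
    right; rewrite -[RHS]y1 massE; apply: eq_fsum => w' wy'.
    have Yy' : Y (finsupp (val y : point R F)) by case: Yy => // h;
      rewrite h in wy.
    suff -> : A w' by [].
    apply: (adjA w) => //; apply: simplex_face Yy' _ _.
      by rewrite fsubUset !fsub1set wy wy'.
    by apply/fset0Pn; exists w; rewrite !inE eqxx.
  left; rewrite /fsum big_seq big1 // => w wy.
  by case: (boolP (A w)) => [Aw|]; [case: noA; exists w|rewrite mulr0].
have vx w : Y [fset w] -> exists y : polyhedron R Y, phi y = (A w)%:R.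
  move=> Yw; have Pw : points R Y (vertex_point R w).
    by exists [fset w] => //; apply: closed_simplex_vertex; rewrite inE.
  exists (exist (fun y => y \in points R Y) _ (mem_set Pw)).
  by rewrite /phi -(fsum_fin (vertex_point R w) (fun w => (A w)%:R))
    fsum_vertex.
pose B := [set x | 2^-1 <= phi (k x)].
have BE : B = [set x | 2^-1 < phi (k x)].
  by apply/seteqP; split => x; rewrite /B /=; have [->|->] := phi01 (k x); lra.
have [yu yuE] := vx u Yu; have [yv yvE] := vx v Yv.
have /seteqP[_ /(_ (subdivision_map subY yv) I)] : B = [set: polyhedron R X].
  apply: X_connected.
  - exists (subdivision_map subY yu); rewrite /B /= kK yuE Au /=; lra.
  - exists B; last by rewrite setTI.
    rewrite BE; apply: (@open_comp _ _ (phi \o k) [set x | 2^-1 < x]).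
      by move=> x _; exact: phiC.
    exact: open_gt.
  - exists B; last by rewrite setTI.
    apply: (@preimage_closed _ R (phi \o k) [set x | 2^-1 <= x]).
      by move=> x _; exact: phiC.
    exact: closed_ge.
rewrite /B /= kK yvE; case: (A v) => //=; lra.
Qed.

(* A shortest edge path visits each vertex at most once. *)
Lemma vertex_distance_bound (D : F -> F -> R) (delta : R) : 0 <= delta ->
  (forall u v w, D u w <= D u v + D v w) -> (forall u, D u u = 0) ->
  (forall u v, Y [fset u; v] -> D u v <= delta) ->
  forall u v, Y [fset u] -> Y [fset v] -> D u v <= delta * #|F|%:R.
Proof.
move=> d0 Dtri D0 Dadj u v Yu Yv.
pose e : rel F := [rel a b | `[< Y [fset a; b] >]].
have : connect e u v.
  apply: (connected_vertices (A := connect e u)) => //; first by exists u.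
  move=> a b Yab ua; apply: connect_trans ua (connect1 _).
  by rewrite /e /=; apply/asboolP.
move=> /connectP[q0 eq0 ->]; case/shortenP: eq0 => q eq uq _.
have D_path a s : path e a s -> D a (last a s) <= delta * (size s)%:R.
  elim: s a => [|b s IHs] a /=; first by rewrite D0 mulr0.
  move=> /andP[/asboolP/Dadj ab /IHs bs].
  by apply: le_trans (Dtri a b _) _; rewrite -natr1 mulrDr mulr1 addrC lerD.
apply: le_trans (D_path _ _ eq) _; rewrite ler_wpM2l // ler_nat.
apply: (@leq_trans (size (u :: q))) => //.
by rewrite -(card_uniqP uq) max_card.
Qed.

End Connectedness.
(** * Geodesics, and labels of points by vertices *)

Section Plane.
Variable R : realType.
Implicit Types a b : 'rV[R]_2.

Lemma plane_distE a b : plane_dist a b =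
  Num.sqrt ((a 0 0 - b 0 0) ^+ 2 + (a 0 1 - b 0 1) ^+ 2).
Proof.
rewrite /plane_dist big_ord_recl big_ord_recl big_ord0 addr0.
by have -> : lift ord0 ord0 = 1 :> 'I_2 by exact: val_inj.
Qed.

Lemma plane_dist_sym a b : plane_dist a b = plane_dist b a.
Proof.
rewrite !plane_distE -[in LHS](opprB (b 0 0)) -[in LHS](opprB (b 0 1)).
by rewrite !sqrrN.
Qed.

Lemma plane_dist_scale (t : R) a b : 0 <= t ->
  plane_dist (t *: a) (t *: b) = t * plane_dist a b.
Proof.
move=> t0; rewrite !plane_distE !mxE.
have -> : (t * a 0 0 - t * b 0 0) ^+ 2 + (t * a 0 1 - t * b 0 1) ^+ 2 =
  t ^+ 2 * ((a 0 0 - b 0 0) ^+ 2 + (a 0 1 - b 0 1) ^+ 2) by ring.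
by rewrite sqrtrM ?sqr_ge0 // sqrtr_sqr ger0_norm.
Qed.

Lemma plane_dist0_eq0 a : plane_dist 0 a = 0 -> a = 0.
Proof.
rewrite plane_distE !mxE !add0r !sqrrN => /eqP; rewrite sqrtr_eq0 => h.
have h0 : a 0 0 = 0 by nra.
have h1 : a 0 1 = 0 by nra.
apply/rowP => i; rewrite mxE; case: i => [[|[|//]] i2].
  by rewrite -[RHS]h0; congr (a _ _); exact: val_inj.
by rewrite -[RHS]h1; congr (a _ _); exact: val_inj.
Qed.

Lemma comparison_triangle (l1 l2 l : R) : 0 <= l1 -> 0 <= l2 -> 0 <= l ->
  l1 <= l2 + l -> l2 <= l1 + l -> l <= l1 + l2 ->
  exists a b, [/\ plane_dist 0 a = l1, plane_dist a b = l & plane_dist 0 b =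
    l2].
Proof.
move=> l10 l20 l0 t1 t2 t3.
pose pt (x y : R) : 'rV[R]_2 := \row_i if i == 0 then x else y.
have pt0 x y : pt x y 0 0 = x by rewrite mxE.
have pt1 x y : pt x y 0 1 = y by rewrite mxE.
have [l1z|l1n] := eqVneq l1 0.
  have ll : l = l2 by lra.
  exists 0, (pt l2 0); rewrite !plane_distE !pt0 !pt1 !mxE l1z ll; split.
  - by rewrite subrr expr0n addr0 sqrtr0.
  - by rewrite subrr expr0n addr0 sub0r sqrrN sqrtr_sqr ger0_norm.
  - by rewrite subrr expr0n addr0 sub0r sqrrN sqrtr_sqr ger0_norm.
have l1p : 0 < l1 by rewrite lt_def l1n.
(* With [a] on the first axis, the law of cosines gives the abscissa of [b]. *)
pose x := (l1 ^+ 2 + l2 ^+ 2 - l ^+ 2) / (2 * l1).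
have xE : x * (2 * l1) = l1 ^+ 2 + l2 ^+ 2 - l ^+ 2.
  by rewrite /x divfK // mulf_neq0.
(* As in Heron's formula, [2 * l1] times [l2 - x], or times [l2 + x], is a product of two factors
   that are nonnegative by the triangle inequalities. *)
have y0 : 0 <= l2 ^+ 2 - x ^+ 2.
  have h1 : 0 <= 2 * l1 * (l2 - x).
    have -> : 2 * l1 * (l2 - x) = (l - l1 + l2) * (l + l1 - l2).
      by rewrite mulrBr [2 * l1 * x]mulrC xE; ring.
    by rewrite mulr_ge0; lra.
  have h2 : 0 <= 2 * l1 * (l2 + x).
    have -> : 2 * l1 * (l2 + x) = (l1 + l2 - l) * (l1 + l2 + l).
      by rewrite mulrDr [2 * l1 * x]mulrC xE; ring.
    by rewrite mulr_ge0; lra.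
  have l12 : 0 < 2 * l1 by lra.
  rewrite subr_sqr; apply: mulr_ge0.
    by rewrite -(pmulr_rge0 _ l12).
  by rewrite -(pmulr_rge0 _ l12).
exists (pt l1 0), (pt x (Num.sqrt (l2 ^+ 2 - x ^+ 2))).
rewrite !plane_distE !pt0 !pt1 !mxE !sub0r !sqrrN !expr0n /= !addr0; split.
- by rewrite sqrtr_sqr ger0_norm.
- rewrite sqr_sqrtr // (_ : _ + _ = l ^+ 2) ?sqrtr_sqr ?ger0_norm //.
  transitivity (l1 ^+ 2 + l2 ^+ 2 - x * (2 * l1)); first by ring.
  by rewrite xE; ring.
- by rewrite sqr_sqrtr // addrC subrK sqrtr_sqr ger0_norm.
Qed.

End Plane.

Lemma geodesic_reverse (R : realType) (M : metricType R) (x y : M) c :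
  geodesic x y c -> geodesic y x (fun s => c (mdist x y - s)).
Proof.
move=> [c0 c1 cd]; split; rewrite ?(metric_sym y x) ?subr0 ?subrr // => s t hs
  ht.
rewrite cd; [|lra|lra].
have -> : mdist x y - s - (mdist x y - t) = - (s - t) by ring.
by rewrite normrN.
Qed.

(** In the comparison triangle with [x] at the origin, the two points are the images of the other
    two vertices under the homothety of ratio [t]. *)
Lemma CAT0_geodesics (R : realType) (M : metricType R) (x y z : M) c1 c2 (t :
  R) :
  CAT0 M -> geodesic x y c1 -> geodesic x z c2 -> 0 <= t <= 1 ->
  mdist (c1 (t * mdist x y)) (c2 (t * mdist x z)) <= t * mdist y z.
Proof.
move=> [geo cmp] g1 g2 /andP[t0 t1].
have [c12 g12] := geo y z.
pose i0 : 'I_3 := Ordinal (isT : (0 < 3)%N).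
pose i2 : 'I_3 := Ordinal (isT : (2 < 3)%N).
have [a [b [a1 ab b2]]] := comparison_triangle (mdist_ge0 x y) (mdist_ge0 x z)
  (mdist_ge0 y z)
  (ltac:(by rewrite (metric_sym y z); exact: metric_triangle))
  (metric_triangle x y z)
  (ltac:(by rewrite (metric_sym x y); exact: metric_triangle)).
(* The sides of the triangle are oriented cyclically, so the third one runs from [z] back to [x]:
   [c2] is reversed and its parameter becomes [(1 - t) * mdist x z]. *)
have := cmp (fun i => nth x [:: x; y; z] i)
  (fun i => nth c1 [:: c1; c12; fun s => c2 (mdist x z - s)] i)
  (fun i => nth 0 [:: 0; a; b] i) _ _ i0 i2 (t * mdist x y) ((1 - t) * mdist x
    z).
rewrite /= => h; apply: le_trans (le_trans (h _ _ _ _) _).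
- suff -> : mdist x z - (1 - t) * mdist x z = t * mdist x z by [].
  by ring.
- case=> [[|[|[|//]]] ?] //=; exact: geodesic_reverse.
- case=> [[|[|[|//]]] ?] //=.
  by rewrite plane_dist_sym b2 metric_sym.
- by rewrite mulr_ge0 ?mdist_ge0 // ler_piMl ?mdist_ge0.
- rewrite (metric_sym z x) mulr_ge0 ?mdist_ge0 ?subr_ge0 //.
  by rewrite ler_piMl ?mdist_ge0 // gerBl.
have segE (w : 'rV[R]_2) (l : R) s : plane_dist 0 w = l -> s * l / l *: w = s
  *: w.
  move=> wl; have [l0|ln] := eqVneq l 0; last by rewrite mulfK.
  by rewrite (plane_dist0_eq0 (etrans wl l0)) !scaler0.
rewrite /segment_point /= (plane_dist_sym b) a1 b2 add0r sub0r subr0 scalerN.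
rewrite !segE //.
have -> : b - (1 - t) *: b = t *: b by rewrite scalerBl scale1r opprB addrC
  subrK.
by rewrite plane_dist_scale // ab.
Qed.

(** * Covering by barycentric stars *)

Section BarycentricCover.
Variables (R : realType) (V : choiceType).
Implicit Types (s : {fset V}) (y : point R V).

Lemma barycenterE s v : barycenter R s v = if v \in s then (#|` s|%:R)^-1 else
  0.
Proof. by rewrite /barycenter fsfun_fun. Qed.

Lemma mass_barycenter s : s != fset0 -> mass (barycenter R s) = 1.
Proof.
move=> s0; rewrite massE (@fsum_incl _ _ s); last exact: finsupp_fun_sub.
rewrite big_seq; under eq_bigr => v vs do rewrite barycenterE vs mulr1.
rewrite -big_seq big_const_seq count_predT iter_addr addr0 -[LHS]mulr_natr
  mulVf //.
by rewrite pnatr_eq0 cardfs_eq0.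
Qed.

(* Subtract from [y] its smallest value on its support. *)
Lemma barycentric_decomposition y : (forall v, 0 <= y v) -> finsupp y != fset0
  ->
  exists (l : point R {fset V}) v, [/\ forall t, 0 <= l t,
    affine_ext (@barycenter R V) l = y,
    forall t, t \in finsupp l -> v \in t /\ t `<=` finsupp y &
    forall s t, s \in finsupp l -> t \in finsupp l -> s `<=` t \/ t `<=` s].
Proof.
have [n] := ubnP #|` finsupp y|.
elim: n y => // n IHn y lty y0 yn; set S := finsupp y in lty yn *.
have [] := @ex_fset_min _ (fun u v => y u <= y v) S yn.
- by move=> u v _ _; apply/orP; exact: le_total.
- by move=> u v w _ _ _; exact: le_trans.
move=> a aS amin; have ya : 0 < y a by rewrite -point_gt0.
have S0 : (#|` S|%:R : R) != 0 by rewrite pnatr_eq0 cardfs_eq0.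
(* This multiple of the barycenter of [S] equals [y a] at every vertex of [S]. *)
pose c : R := y a * #|` S|%:R; have c0 : 0 <= c by rewrite mulr_ge0.
pose y' := pcomb 1 y (- c) (barycenter R S).
have y'E v : y' v = if v \in S then y v - y a else 0.
  rewrite pcombE barycenterE mul1r; case: ifPn => [_|].
    by rewrite mulNr /c mulfK.
  by rewrite memNfinsupp => /eqP ->; rewrite mulr0 addr0.
have y'0 v : 0 <= y' v by rewrite y'E; case: ifP => // /amin; rewrite subr_ge0.
have sub : finsupp y' `<=` S.
  by apply/fsubsetP => v; rewrite mem_finsupp y'E; case: ifP; rewrite ?eqxx.
have yy : y = pcomb 1 y' c (barycenter R S).
  by apply/fsfunP => v; rewrite /y' !pcombE; ring.
have [y'z|y'n] := eqVneq (finsupp y') fset0.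
  exists (pcomb c (vertex_point R S) 0 (vertex_point R S)), a; split.
  - by move=> t; rewrite pcombE vertex_pointE mul0r addr0 mulr_ge0.
  - rewrite affine_ext_pcomb affine_ext_vertex [RHS]yy; apply/fsfunP => v.
    by rewrite pcombE [RHS]pcombE (finsupp_eq0 v y'z); ring.
  - move=> t /(fsubsetP (finsupp_pcomb _ _ _ _)).
    by rewrite finsupp_vertex !inE orbb => /eqP ->.
  - move=> s t /(fsubsetP (finsupp_pcomb _ _ _ _)) + /(fsubsetP (finsupp_pcomb
    _ _ _ _)).
    by rewrite finsupp_vertex !inE !orbb => /eqP -> /eqP ->; left.
have lt' : (#|` finsupp y'| < n)%N.
  rewrite ltnS in lty; apply: leq_trans lty; apply: fproper_ltn_card.
  rewrite fproperE sub; apply/fsubsetPn; exists a => //.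
  by rewrite memNfinsupp y'E aS subrr.
have [l [v [l0 ly lv lc]]] := IHn _ lt' y'0 y'n.
have lS t : t \in finsupp l -> t `<=` S.
  by move=> /lv[_ h]; exact: fsubset_trans sub.
have memE t : t \in finsupp (pcomb 1 l c (vertex_point R S)) -> t \in finsupp l
  \/ t = S.
  move=> /(fsubsetP (finsupp_pcomb _ _ _ _)); rewrite finsupp_vertex !inE.
  by move=> /orP[|/eqP]; [left|right].
exists (pcomb 1 l c (vertex_point R S)), v; split.
- by move=> t; rewrite pcombE vertex_pointE addr_ge0 // mulr_ge0.
- by rewrite affine_ext_pcomb affine_ext_vertex ly -yy.
- move=> t /memE[tl|->]; first by split; [case: (lv _ tl)|exact: lS].
  split=> //; have /fset0Pn[u ul] : finsupp l != fset0.
    apply: contra y'n => /eqP h; rewrite -ly; apply/fset0Pn => -[w].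
    by move=> /finsupp_affine_ext[w']; rewrite h.
  by have [vu uS] := lv _ ul; apply: (fsubsetP (lS _ ul)).
- move=> s t /memE[sl|->] /memE[tl|->].
  + exact: lc.
  + by left; exact: lS.
  + by right; exact: lS.
  + by left.
Qed.

End BarycentricCover.

Section Labels.
Variables (R : realType) (V : choiceType) (K : complex V).
Variable m : metric R (realization R K).

Lemma support_simplex (x : metrized m) :
  K (finsupp (val (x : realization R K) : point R V)).
Proof.
have /set_mem/pointsP[[_ [h|//]] x1] := valP (x : realization R K).
by move: x1; rewrite /mass h big_seq_fset0 => /esym/eqP; rewrite oner_eq0.
Qed.

Lemma support_closed_simplex (x : metrized m) :
  in_realization (closed_simplex (finsupp (val (x : realization R K) : point R
    V))) x.
Proof. by have /set_mem/pointsP[[x0 _] x1] := valP (x : realization R K). Qed.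

Lemma star_cover (x : metrized m) : exists2 v, K [fset v] & barycentric_star v
  x.
Proof.
have Kx := support_simplex x.
have /set_mem/pointsP[[x0 _] x1] := valP (x : realization R K).
set y : point R V := val (x : realization R K) in x0 x1 Kx.
have [l [v [l0 ly lv lc]]] := barycentric_decomposition x0 (simplex_neq0 Kx).
have [t tl] : exists t, t \in finsupp l.
  apply/fset0Pn; apply: contra (simplex_neq0 Kx) => /eqP h; rewrite -ly.
  apply/fset0Pn => -[u] /finsupp_affine_ext[t]; by rewrite h.
have [vt tS] := lv _ tl.
have Kv : K [fset v].
  apply: simplex_face Kx _ _.
    by rewrite fsub1set (fsubsetP tS).
  by apply/fset0Pn; exists v; rewrite inE.
have tn s : s \in finsupp l -> s != fset0.
  by move=> /lv[vs _]; apply/fset0Pn; exists v.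
exists v => //; apply: subset_closure.
(* All sets in the chain contain [v], so adding [[fset v]] gives again a chain, that is, a simplex
   of the barycentric subdivision at the vertex [v]. *)
exists ([fset v] |` finsupp l).
  split; last by rewrite !inE eqxx.
  split; first by apply/fset0Pn; exists [fset v]; rewrite !inE eqxx.
    move=> s; rewrite !inE => /predU1P[->//|sl].
    by apply: simplex_face Kx _ (tn _ sl); case: (lv _ sl).
  move=> s s'; rewrite !inE => /predU1P[->|sl] /predU1P[->|sl'].
  - by left.
  - by left; rewrite fsub1set; case: (lv _ sl').
  - by right; rewrite fsub1set; case: (lv _ sl).
  - exact: lc.
exists l; last exact: ly.
split=> //; first exact: fsubsetUr.
change (mass l = 1); rewrite -x1 -[in RHS]ly mass_affine_ext // => s sl.
by rewrite mass_barycenter // tn.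
Qed.

Variable e : R.
Hypothesis e0 : 0 < e.
Hypothesis thick : forall (v : V) (s : {fset V}),
    K [fset v] -> K s ->
    (closed_neighbourhood e (@barycentric_star R V K m v) `&`
      in_realization (closed_simplex s) !=set0)%classic -> v \in s.

(** Thickness is applied to the smallest simplex containing [y]. That simplex depends on [y] alone,
    so it serves the labels of all points near [y] at once. *)
Lemma star_near_support v (x y : metrized m) : K [fset v] ->
  barycentric_star v x -> mdist x y <= e ->
  v \in finsupp (val (y : realization R K) : point R V).
Proof.
move=> Kv vx xy; apply: (thick Kv (support_simplex y)).
exists y; split; last exact: support_closed_simplex.
apply: (@le_trans _ _ (mdist y x)%:E); last by rewrite lee_fin metric_sym.
by apply: ereal_inf_lbound; exists x.
Qed.

Lemma star_support v (x : metrized m) : K [fset v] -> barycentric_star v x ->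
  v \in finsupp (val (x : realization R K) : point R V).
Proof. by move=> Kv vx; apply: star_near_support vx _;
  rewrite // mdistxx ltW. Qed.

Lemma star_near_edge v w (x y : metrized m) : K [fset v] -> K [fset w] ->
  barycentric_star v x -> barycentric_star w y -> mdist x y <= e ->
  K [fset v; w].
Proof.
move=> Kv Kw vx wy xy; apply: simplex_face (support_simplex y) _ _.
  rewrite fsubUset !fsub1set (star_near_support Kv vx xy).
  exact: star_support.
by apply/fset0Pn; exists v; rewrite !inE eqxx.
Qed.

End Labels.
(** * Counting *)

(** The staircase triangulations need total orders, and the vertices of [L] come from an arbitrary
    type. Minima of sets of two and of three elements in a well-ordering give totality, antisymmetry
    and transitivity. *)
Lemma ex_total_order (T : eqType) : exists r : rel T,
  [/\ total r, antisymmetric r & transitive r].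
Proof.
have [r wo] := well_ordering_principle T.
have min2 x y : exists z, minimum_of r (pred2 x y) z.
  by have [|z [h _]] := wo (pred2 x y); [exists x; rewrite inE eqxx|exists z].
have rt : total r.
  move=> x y; have [z [zxy zmin]] := min2 x y.
  move: zxy; rewrite inE => /orP[/eqP e|/eqP e]; subst z.
    by rewrite zmin // inE eqxx orbT.
  by rewrite orbC zmin // inE eqxx.
have ra : antisymmetric r.
  move=> x y /andP[xy yx].
  have [|z [_ zu]] := wo (pred2 x y); first by exists x; rewrite inE eqxx.
  have rr w : r w w by have := rt w w; rewrite orbb.
  transitivity z; [apply/esym|]; apply: zu; split; rewrite ?inE ?eqxx ?orbT //;
    by move=> w; rewrite inE => /orP[/eqP ->|/eqP ->].
exists r; split=> // y x z xy yz.
have [|w [[wA wmin] _]] := wo (mem [:: x; y; z]).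
  by exists x; rewrite inE eqxx.
have rw u : u \in [:: x; y; z] -> r w u by exact: wmin.
move: wA; rewrite !inE => /or3P[] /eqP e; subst w.
- by apply: rw; rewrite !inE eqxx !orbT.
- have -> // : x = y by apply: ra; rewrite xy rw // inE eqxx.
- have e : y = z by apply: ra; rewrite yz rw // !inE eqxx orbT.
  by rewrite -e.
Qed.

Lemma card_bigfcup_le (I T : choiceType) (r : {fset I}) (F : I -> {fset T}) m :
  (forall i, i \in r -> (#|` F i| <= m)%N) ->
  (#|` \bigcup_(i <- r) F i| <= #|` r| * m)%N.
Proof.
move=> Fm; have {}Fm i : i \in (r : seq I) -> (#|` F i| <= m)%N by apply: Fm.
rewrite -[#|` r|]/(size r); elim: (enum_fset r) Fm => [|i s IHs] Fm.
  by rewrite big_nil cardfs0.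
rewrite big_cons mulSn; apply: leq_trans (leq_card_fsetU _ _) _.
rewrite leq_add ?Fm ?mem_head // IHs // => j js.
by apply: Fm; rewrite inE js orbT.
Qed.

Lemma card_fsetM (T U : choiceType) (A : {fset T}) (B : {fset U}) :
  (#|` A `*` B| <= #|` A| * #|` B|)%N.
Proof.
have -> : A `*` B = \bigcup_(a <- A) [fset (a, b) | b in B].
  apply/fsetP => -[a b]; rewrite in_fsetM /=; apply/andP/bigfcupP => [[aA bB]|].
    by exists a; rewrite ?aA // in_imfset.
  by move=> [c /andP[cA _] /imfsetP[d /= dB [-> ->]]].
apply: card_bigfcup_le => a _; exact: leq_imfset_card.
Qed.

Lemma card_le_fset (T : choiceType) (A : set T) (N : nat) : (A #<= `I_N)%card ->
  exists S : {fset T}, (forall t, t \in S <-> A t) /\ (#|` S| <= N)%N.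
Proof.
move=> AN; have fA := card_le_finite AN (finite_II N).
exists (fset_set A); split=> [t|].
  by rewrite in_fset_set //; split => [/set_mem|/mem_set].
exact: geq_card_fset_set.
Qed.

Lemma card_preim_val (T : choiceType) (F S : {fset T}) :
  (#|` [fset u : F | val u \in S]| <= #|` S|)%N.
Proof.
set A := (X in #|` X|); have <- : #|` val @` A| = #|` A|.
  by rewrite card_imfset //; exact: val_inj.
apply: fsubset_leq_card.
by apply/fsubsetP => t /imfsetP[u /=]; rewrite !inE => us ->.
Qed.

Lemma quadratic_monomial (c : nat) : (0 < c)%N -> quadratic (fun n => c * n ^
  2)%N.
Proof.
move=> c0; have cR : (c%:R : rat) != 0 by rewrite pnatr_eq0 -lt0n.
exists (c%:R *: 'X^2); first by rewrite size_scale // size_polyXn.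
by move=> n; rewrite hornerZ hornerXn natrM natrX.
Qed.
(** * Construction of the triangulation *)

(** [box s] collects the pairs that can occur over the [d]-simplex [s]. The equality of
    [finsupp (p (w u))] with the [g]-image of the carrier of [u] is recorded for the collar, where
    labels have to be compared with values of [g]. *)
Lemma fine_subdivision (R : realType) (d N : nat) (V W : choiceType) (T :
  finType)
    (K : complex V) (L : complex W) (p : W -> point R V) (X : complex T)
    (g : T -> V) :
  csubdivision K L p -> simplicial X K g -> dimensional d X ->
  (forall s, K s ->
    ([set t | L t /\ (cell p t `<=` closed_simplex s)%classic] #<= `I_N)%card)
      ->
  exists (F : finType) (Y : complex F) (pos : F -> point R T) (w : F -> W)
    (box : {fset T} -> {fset F}),
  [/\ csubdivision X Y pos,
      forall c, Y c -> L (w @` c),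
      forall u, Y [fset u] -> finsupp (p (w u)) = g @` finsupp (pos u),
      forall c, Y c -> exists s, [/\ X s, #|` s| = d.+1 & c `<=` box s] &
      (forall s, X s -> #|` s| = d.+1 -> (#|` box s| <= N * 2 ^ d.+1)%N) /\
      (#|F| <= nb_simplices d X * (N * 2 ^ d.+1))%N].
Proof.
move=> subL gXK [_ dimX] cardL.
have [leW [leWt leWa leWr]] := ex_total_order W.
have [leT [leTt leTa leTr]] := ex_total_order T.
have gK s : X s -> K (g @` s) by exact: gXK.
have /choice[LS LSP] s : exists S : {fset {fset W}}, X s ->
    (forall t, t \in S <-> L t /\ (cell p t `<=` closed_simplex (g @`
      s)%fset)%classic) /\
    (#|` S| <= N)%N.
  have [Xs|nX] := pselect (X s); last by exists fset0.
  by have [S h] := card_le_fset (cardL _ (gK _ Xs)); exists S.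
pose VS s := \bigcup_(t <- LS s) t.
have VSN s : X s -> (#|` VS s| <= N)%N.
  move=> Xs; have [LSE LSN] := LSP s Xs; apply: leq_trans LSN.
  (* A vertex of a cell is itself a cell, so the bound [N] on cells also bounds their vertices. *)
  have -> : #|` VS s| = #|` [fset [fset v] | v in VS s]|.
    by rewrite card_imfset // => a b /fset1_inj.
  apply: fsubset_leq_card; apply/fsubsetP => t /imfsetP[v /= vVS ->].
  move: vVS => /bigfcupP[t' /andP[/LSE[Lt' cellt'] _] vt']; apply/LSE; split.
    apply: simplex_face Lt' _ _; first by rewrite fsub1set.
    by apply/fset0Pn; exists v; rewrite inE.
  move=> x [y [yv y0 y1] <-]; apply: cellt'; exists y => //; split=> //.
  by apply: fsubset_trans yv _; rewrite fsub1set.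
pose Y0 := pullback p g leW leT L X.
have subY0 : csubdivision X Y0 (pb_pos p g).
  exact: (pullback_subdivision leWt leWa leWr leTt leTa leTr subL gXK).
pose B s := VS s `*` fpowerset s.
have Y0B c : Y0 c -> exists s, [/\ X s, #|` s| = d.+1 & c `<=` B s].
  move=> Y0c; have [_ Lc Xc sc _] := Y0c.
  have [s [Xs ds cs]] := dimX _ Xc; exists s; split=> //.
  have us u : u \in c -> u.2 `<=` s.
    by move=> uc; apply: fsubset_trans cs; exact: bigfcup_sup.
  have LSc : [fset u.1 | u in c] \in LS s.
    apply/(proj1 (LSP s Xs)); split=> // x [y yc <-].
    apply: closed_simplex_affine yc => v /imfsetP[u /= uc ->].
    have [t _ /(_ u.1)] := (let: And3 h _ _ := subL in h) _ Lc.
    rewrite in_imfset // => /(_ isT)[_ p0 p1]; split=> //.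
    have [[_ <-] _] := sc _ uc; apply/fsubsetP => a /imfsetP[b /= bu ->].
    by rewrite in_imfset //=; exact: (fsubsetP (us _ uc)).
  apply/fsubsetP => u uc; rewrite in_fsetM fpowersetE us // andbT.
  by apply/bigfcupP; exists [fset u.1 | u in c]; rewrite ?LSc // in_imfset.
have fX : finite_set [set s : {fset T} | X s /\ #|` s| = d.+1].
  exact: finite_finset.
pose SX := fset_set [set s : {fset T} | X s /\ #|` s| = d.+1].
have SXE s : s \in SX <-> X s /\ #|` s| = d.+1.
  by rewrite in_fset_set //; split => [/set_mem|/mem_set].
have BN s : X s -> #|` s| = d.+1 -> (#|` B s| <= N * 2 ^ d.+1)%N.
  move=> Xs ds; apply: leq_trans (card_fsetM _ _) _.
  by rewrite card_fpowerset ds leq_mul // VSN.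
pose F := \bigcup_(s <- SX) B s.
have Y0F c : Y0 c -> c `<=` F.
  move=> /Y0B[s [Xs ds cB]]; apply: fsubset_trans cB _.
  by apply: bigfcup_sup => //; apply/SXE.
have subY := csubdivision_trans subY0 (restriction_subdivision R Y0F).
exists F, (restriction Y0 F), (affine_ext (pb_pos p g) \o
  (fun u : F => vertex_point R (val u))), (fun u => (val u).1),
  (fun s => [fset u : F | val u \in B s]).
split=> //.
- move=> c [_ Lc _ _ _]; suff <- : [fset u.1 | u in val @` c] = [fset (val u).1
  | u in c] by [].
  apply/fsetP => v; apply/imfsetP/imfsetP => -[u /=].
    by move=> /imfsetP[u' /= uc ->] ->; exists u'.
  by move=> uc ->; exists (val u) => //; rewrite in_imfset.
- move=> u [_ _ _ sc _]; have [su _] : pb_section p g (val u) /\ (val u).2 !=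
  fset0.
    by apply: sc; rewrite in_imfset // inE.
  by rewrite /= affine_ext_vertex finsupp_pb_pos //; case: su.
- move=> c /Y0B[s [Xs ds cB]]; exists s; split=> //.
  apply/fsubsetP => u uc; rewrite inE /=; apply: (fsubsetP cB).
  by rewrite in_imfset.
split=> [s Xs ds|]; first exact: leq_trans (card_preim_val _ _) (BN _ Xs ds).
rewrite -cardfE; apply: card_bigfcup_le => s /SXE[]; exact: BN.
Qed.

(** The path with [M] edges is pulled back along the map that sends the apex to [false] and [Y] to
    [true]. A vertex [(j, A)] is the point at fraction [j / M] of the segment from the apex to one
    vertex [u] of [Y]: [lev] is [j], and [top] is [u], or [None] at the apex itself. *)
Lemma layered_cone (R : realType) (F : finType) (Y : complex F) (M : nat) :
  (0 < M)%N ->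
  exists (G : finType) (Q : complex G) (pos : G -> point R (option F))
    (lev : G -> nat) (top : G -> option F)
    (box : {fset nat} -> {fset option F} -> {fset G}),
  [/\ csubdivision (cone_complex Y) Q pos,
      forall c, Q c -> exists2 j, (j < M)%N &
        forall y, y \in c -> lev y \in [fset j; j.+1],
      forall c, Q c -> forall y, y \in c ->
        [/\ (lev y <= M)%N, top y = None -> lev y = 0%N,
            forall u, top y = Some u -> Some u \in finsupp (pos y) &
            pos y None = 0 -> lev y = M /\ top y <> None],
      forall c, Q c -> forall y y' u u', y \in c -> y' \in c ->
        top y = Some u -> top y' = Some u' -> Y [fset u; u'] &
      (forall J O, (#|` box J O| <= #|` J| * 2 ^ #|` O|)%N) /\
      forall c, Q c -> exists2 s, cone_complex Y s & forall J O, s `<=` O ->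
        (forall y, y \in c -> lev y \in J) -> c `<=` box J O].
Proof.
move=> M0; have [leF [leFt leFa leFr]] := ex_total_order (option F).
pose g (o : option F) : bool := o.
have leqa : antisymmetric leq by move=> m n; rewrite -eqn_leq => /eqP.
have leqt : transitive leq by move=> b a c; exact: leq_trans.
have gE : simplicial (cone_complex Y) edge_complex g.
  move=> s Ys; have /fset0Pn[b bs] := simplex_neq0 Ys.
  by apply/fset0Pn; exists (g b); rewrite in_imfset.
pose p := path_pos R M.
pose Q0 := pullback p g leq leF (path_complex M) (cone_complex Y).
have subQ0 : csubdivision (cone_complex Y) Q0 (pb_pos p g).
  exact: (pullback_subdivision leq_total leqa leqt leFt leFa leFr
    (path_subdivision R M0) gE).
pose allF : {fset option F} := [fset o in enum {: option F}].
have inF o : o \in allF by rewrite inE /= mem_enum.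
pose G := [fset val i | i in 'I_M.+1] `*` fpowerset allF.
have inJ j : (j <= M)%N -> j \in [fset val i | i in 'I_M.+1].
  by rewrite -ltnS => jM; rewrite -[j]/(val (Ordinal jM)) in_imfset.
have pT j : (0 < j)%N -> true \in finsupp (p j).
  move=> j0; rewrite mem_finsupp path_pos_true mulf_neq0 ?invr_eq0 //.
    by rewrite pnatr_eq0 -lt0n.
  by rewrite pnatr_eq0 -lt0n.
have pF j : (j <= M)%N -> (false \in finsupp (p j)) = (j != M).
  move=> jM; rewrite mem_finsupp path_pos_false.
  have M0R : (M%:R : R) != 0 by rewrite pnatr_eq0 -lt0n.
  congr (~~ _); apply/eqP/eqP => [|->]; last by rewrite divff // subrr.
  move=> /eqP; rewrite subr_eq0 => /eqP e; apply/eqP.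
  by rewrite -(eqr_nat R) -[j%:R](divfK M0R) -e mul1r.
have Q0j c : Q0 c -> exists2 j, (j < M)%N & forall u, u \in c -> u.1 \in [fset
  j; j.+1].
  move=> [_ [_ [j jM sj]] _ _ _]; exists j => // u uc; apply: (fsubsetP sj).
  by rewrite in_imfset.
have Q0M c u : Q0 c -> u \in c -> (u.1 <= M)%N.
  move=> /Q0j[j jM h] /h; rewrite !inE => /orP[/eqP ->|/eqP -> //]; exact: ltnW.
have Q0G c : Q0 c -> c `<=` G.
  move=> Qc; apply/fsubsetP => u uc; rewrite in_fsetM fpowersetE inJ ?(Q0M _ _
    Qc) //=.
  apply/fsubsetP => o _; exact: inF.
have subQ := csubdivision_trans subQ0 (restriction_subdivision R Q0G).
(* On a section the choice is forced: [g] is injective on it and sends every [Some u] to [true]. *)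
pose top (y : G) : option F :=
  if [pick u | Some u \in (val y).2] is Some u then Some u else None.
have topP y u : top y = Some u -> Some u \in (val y).2.
  by rewrite /top; case: pickP => // v vy [<-].
have topN y : top y = None -> forall u, Some u \notin (val y).2.
  by rewrite /top; case: pickP => // h _ u; rewrite h.
have inval (c : {fset G}) y : y \in c -> val y \in [fset val z | z in c].
  by move=> yc; rewrite in_imfset.
exists G, (restriction Q0 G), (affine_ext (pb_pos p g) \o
  (fun u : G => vertex_point R (val u))), (fun y => (val y).1), top,
  (fun J O => [fset y : G | val y \in J `*` fpowerset O]).
split=> //.
- move=> c /Q0j[j jM h]; exists j => // y yc; exact/h/inval.
- move=> c Qc y yc; have [_ _ _ sc _] := Qc.
  have [sy _] := sc _ (inval _ _ yc); have [gi gA] := sy.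
  have yM := Q0M _ _ Qc (inval _ _ yc).
  have topT : (0 < (val y).1)%N -> top y <> None.
    move=> /pT; rewrite -gA => /imfsetP[[u|] //= uy _] /topN /(_ u).
    by rewrite uy.
  split=> //.
  + by move=> tN; apply/eqP; rewrite -leqn0 leqNgt; apply/negP => /topT.
  + by move=> u tu; rewrite /= affine_ext_vertex finsupp_pb_pos //; exact: topP.
  + rewrite /= affine_ext_vertex pb_posE => h.
    have lM : (val y).1 = M.
      apply/eqP/negPn; rewrite -pF //; apply/negP => Fp.
      move: (Fp); rewrite -gA => /imfsetP[[u|] //= uy _].
      by move: h; rewrite uy => /eqP; move: Fp;
        rewrite mem_finsupp => /negPf ->.
    by split=> //; apply: topT; rewrite lM.
- move=> c [_ _ [_ Yc] sc _] y y' u u' yc y'c /topP uy /topP uy'.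
  have bu : u \in base_fset (\bigcup_(z <- [fset val z | z in c]) z.2).
    by rewrite mem_base_fset; apply/bigfcupP; exists (val y); rewrite ?inval.
  have bu' : u' \in base_fset (\bigcup_(z <- [fset val z | z in c]) z.2).
    by rewrite mem_base_fset; apply/bigfcupP; exists (val y'); rewrite ?inval.
  case: Yc => [h|Yc]; first by rewrite h in bu.
  apply: simplex_face Yc _ _; first by rewrite fsubUset !fsub1set bu bu'.
  by apply/fset0Pn; exists u; rewrite !inE eqxx.
split.
  move=> J O; apply: leq_trans (card_preim_val _ _) _.
  by apply: leq_trans (card_fsetM _ _) _; rewrite card_fpowerset.
move=> c [_ _ Yc sc _]; exists (\bigcup_(z <- [fset val z | z in c]) z.2) => //.
move=> J O sO lJ; apply/fsubsetP => y yc; rewrite inE /= inE in_fsetM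
  fpowersetE lJ //=.
apply: fsubset_trans sO; apply: (@bigfcup_sup _ _ _ _ xpredT (fun z => z.2)) =>
  //.
exact: inval.
Qed.

(* Each point moves at constant speed along the geodesic to the base point, so
   that the points of a layer stay at least as close as their end points. *)
Lemma geodesic_layers (R : realType) (Mt : metricType R) (F : finType)
    (adj : F -> F -> Prop) (q : F -> Mt) (x0 : Mt) (delta : R) (M : nat) :
  CAT0 Mt -> (0 < M)%N -> 0 <= delta ->
  (forall u v, adj u v -> mdist (q u) (q v) <= delta /\
    mdist x0 (q v) <= delta * M%:R) ->
  exists pt : F -> nat -> Mt,
  [/\ forall u, pt u 0%N = x0, forall u, pt u M = q u &
      forall u v j k, adj u v -> (j <= M)%N -> (k <= M)%N ->
        (j <= k.+1)%N -> (k <= j.+1)%N -> mdist (pt u j) (pt v k) <= 2 * delta].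
Proof.
move=> cat M0 d0 hq; have [geo _] := cat.
have /choice[c cP] u : exists c, geodesic x0 (q u) c by exact: geo.
have M0R : (0 : R) < M%:R by rewrite ltr0n.
exists (fun u j => c u (j%:R / M%:R * mdist x0 (q u))); split.
- by move=> u; rewrite mul0r mul0r; case: (cP u).
- by move=> u; rewrite divff ?gt_eqF // mul1r; case: (cP u).
move=> u v j k uv jM kM jk kj; have [quv qv] := hq _ _ uv.
have frac i : (i <= M)%N -> 0 <= (i%:R / M%:R : R) <= 1.
  by move=> iM; rewrite divr_ge0 // ler_pdivrMr // mul1r ler_nat.
(* One [delta] compares two geodesics at the same fraction, by the CAT(0) inequality; the other is
   one step along a geodesic of length at most [delta * M%:R]. *)
apply: le_trans (metric_triangle _ (c v (j%:R / M%:R * mdist x0 (q v))) _) _.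
have -> : 2 * delta = delta + delta by ring.
apply: lerD.
  apply: le_trans (CAT0_geodesics cat (cP u) (cP v) (frac j jM)) _.
  have /andP[f0 f1] := frac j jM.
  apply: le_trans quv; rewrite ler_piMl //; exact: mdist_ge0.
have [_ _ cd] := cP v.
have inr i : (i <= M)%N -> 0 <= i%:R / M%:R * mdist x0 (q v) <= mdist x0 (q v).
  move=> /frac/andP[f0 f1]; rewrite mulr_ge0 ?mdist_ge0 //.
  by rewrite ler_piMl // mdist_ge0.
rewrite cd ?inr // -mulrBl -mulrBl normrM (ger0_norm (mdist_ge0 _ _)).
rewrite normrM (ger0_norm (_ : 0 <= M%:R^-1)) ?invr_ge0 //.
have jk1 : `|j%:R - k%:R| <= 1 :> R.
  have h1 : j%:R <= (k%:R + 1 : R) by rewrite natr1 ler_nat.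
  have h2 : k%:R <= (j%:R + 1 : R) by rewrite natr1 ler_nat.
  by rewrite ler_norml; apply/andP; split; lra.
apply: (@le_trans _ _ (1 * M%:R^-1 * mdist x0 (q v))).
  by rewrite ler_wpM2r ?mdist_ge0 // ler_wpM2r // invr_ge0.
by rewrite mul1r mulrC ler_pdivrMr.
Qed.
Lemma point_vertex (R : realType) (V : choiceType) (K : complex V) (x : point R
  V) :
  points R K x -> exists2 v, K [fset v] & v \in finsupp x.
Proof.
move=> /pointsP[[x0 Kx] x1].
have xn : finsupp x != fset0.
  apply/eqP => h; move: x1; rewrite /mass h big_seq_fset0 => /esym/eqP.
  by rewrite oner_eq0.
case: Kx => [h|Kx]; first by rewrite h in xn.
have /fset0Pn[v vx] := xn; exists v => //; apply: simplex_face Kx _ _.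
  by rewrite fsub1set.
by apply/fset0Pn; exists v; rewrite inE.
Qed.

Lemma simplicial_skeleton (d : nat) (V : choiceType) (T : finType) (K : complex
  V)
    (X : complex T) (g : T -> V) :
  dimensional d X -> simplicial X K g -> simplicial X (skeleton d K) g.
Proof.
move=> [_ dimX] gXK s Xs; split; first exact: gXK.
have [t [_ dt st]] := dimX _ Xs.
apply: leq_trans (leq_imfset_card _ _ _) _.
by rewrite -dt; exact: (fsubset_leq_card st).
Qed.

(** * Filling the cone over a given simplicial map *)

Section ConeFilling.
Variables (R : realType) (d N : nat) (V W : choiceType) (K : complex V).
Variables (dK : metric R (realization R K)) (L : complex W) (p : W -> point R
  V).
Variable delta : R.
Hypotheses (flagK : flag K) (catK : CAT0 (metrized dK)).
Hypothesis delta0 : 0 < delta.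
Hypothesis thick : forall (v : V) (s : {fset V}), K [fset v] -> K s ->
  (closed_neighbourhood (2 * delta) (@barycentric_star R V K dK v) `&`
    in_realization (closed_simplex s) !=set0)%classic -> v \in s.
Hypothesis subL : subdivision (skeleton d K) L p.
Hypothesis diamL : forall t, L t -> forall x y : metrized dK,
  in_realization (cell p t) x -> in_realization (cell p t) y -> mdist x y <=
    delta.
Hypothesis cardL : forall s, skeleton d K s ->
  ([set t | L t /\ (cell p t `<=` closed_simplex s)%classic] #<= `I_N)%card.

Variables (T : finType) (X : complex T) (g : T -> V).
Hypotheses (dimX : dimensional d X) (connX : connected [set: polyhedron R X]).
Hypothesis gXK : simplicial X K g.

Let nX := nb_simplices d X.
Let A := (N * 2 ^ d.+1)%N.
(** A bound on the number of subsets of a box: two levels, times the subsets of a set of at most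
    [A.+1] vertices, namely those of [Y] over one [d]-simplex together with the apex. *)
Let B := (2 ^ (2 * 2 ^ A.+1))%N.

Let x0_exists : exists x : polyhedron R X, True.
Proof.
have [[s Xs] _] := dimX; have /fset0Pn[t ts] := simplex_neq0 Xs.
have Xt : points R X (vertex_point R t).
  by exists s => //; exact: closed_simplex_vertex.
by exists (exist (fun y => y \in points R X) _ (mem_set Xt)).
Qed.

Lemma ex_cone_filling : exists (U : finType) (P : complex U)
    (h : polyhedron R P -> Defs.cone R (polyhedron R X))
    (i : T -> U) (iXP : simplicial X P i) (g' : U -> V),
  [/\ homeomorphism h,
      forall x : polyhedron R X, h (realization_map iXP x) = cone_base R x,
      simplicial P K g',
      forall t, X [fset t] -> g' (i t) = g t &
      (nb_simplices d.+1 P <= B * (A + 2 ^ d.+1) * nX ^ 2)%N].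
Proof.
have [x0 _] := x0_exists.
have csubL := (subdivision_csub (skeleton d K) L p).1 subL.
have gXS := simplicial_skeleton dimX gXK.
have [F [Y [pos [w [box [subY YL Yw Ybox [boxA FA]]]]]]] :=
  fine_subdivision csubL gXS dimX cardL.
rewrite -/nX -/A in FA.
have [ky [_ _ _]] := subdivision_map_homeo subY.
have [u0 Yu0 _] := point_vertex (set_mem (valP (ky x0))).
(* At most [A] vertices of [Y] for each [d]-simplex. As [Y] has the vertex [u0], this is positive,
   as the division of geodesics into [M] parts requires. *)
pose M := (nX * A)%N.
have FM : (#|F| <= M)%N by exact: FA.
have M0 : (0 < M)%N.
  by apply: leq_trans FM; apply/card_gt0P; exists u0.
have wP u : Y [fset u] -> points R K (p (w u)).
  move=> /YL Lw; have [s [Ks _] h] := (let: And3 h _ _ := csubL in h) _ Lw.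
  by exists s => //; apply: h; rewrite in_imfset // inE.
(* Elements of [F] that are not vertices of [Y] receive the image of [x0] as a default value. *)
have /choice[q qE] u : exists x : metrized dK, Y [fset u] ->
    val (x : realization R K) = p (w u).
  have [Yu|nYu] := pselect (Y [fset u]); last first.
    by exists (realization_map gXK (x0 : realization R X)).
  by exists (exist (fun y => y \in points R K) _ (mem_set (wP _ Yu))).
have Yface c u : Y c -> u \in c -> Y [fset u].
  move=> Yc uc; apply: simplex_face Yc _ _; first by rewrite fsub1set.
  by apply/fset0Pn; exists u; rewrite inE.
have qcell c u : Y c -> u \in c -> in_realization (cell p (w @` c)) (q u).
  move=> Yc uc; have Yu := Yface _ _ Yc uc.
  rewrite /in_realization /= qE //; exists (vertex_point R (w u)).
    by apply: closed_simplex_vertex; rewrite in_imfset.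
  exact: affine_ext_vertex.
have qadj u v : Y [fset u; v] -> mdist (q u) (q v) <= delta.
  move=> Yuv; apply: (diamL (YL _ Yuv)); apply: qcell => //.
    by rewrite !inE eqxx.
  by rewrite !inE eqxx orbT.
have qfar v : Y [fset v] -> mdist (q u0) (q v) <= delta * M%:R.
  move=> Yv; apply: (@le_trans _ _ (delta * #|F|%:R)).
    apply: (vertex_distance_bound subY connX (D := fun a b => mdist (q a) (q
      b))) => //.
    - exact: ltW.
    - by move=> a b c; exact: metric_triangle.
    - by move=> a; exact: mdistxx.
  by rewrite ler_wpM2l ?ler_nat // ltW.
have [|pt [pt0 ptM ptadj]] := geodesic_layers (adj := fun u v => Y [fset u; v])
  (q := q) (x0 := q u0) (delta := delta) catK M0 (ltW delta0).
  move=> u v Yuv; split; first exact: qadj.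
  by apply: qfar; apply: Yface Yuv _; rewrite !inE eqxx orbT.
have [G [Q [posQ [lev [top [lbox [subQ0 Qlev Qtop Qadj [lboxM Qbox]]]]]]]] :=
  layered_cone R Y M0.
pose posG := affine_ext (cone_pos pos) \o posQ.
have subQ : csubdivision (cone_complex X) Q posG.
  exact: csubdivision_trans (cone_subdivision subY) subQ0.
have posGN y : posG y None = posQ y None.
  by rewrite /posG /= affine_ext_cone cone_point_None.
have [leT [leTt leTa leTr]] := ex_total_order T.
pose P := collar leT X Q posG.
have subP : csubdivision (cone_complex X) P (collar_pos posG).
  exact: collar_subdivision.
have e0 : 0 < 2 * delta by rewrite mulr_gt0.
have /choice[lab labP] x : exists v, K [fset v] /\ @barycentric_star R V K dK v
  x.
  by have [v ? ?] := star_cover x; exists v.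
pose ptG y : metrized dK := if top y is Some u then pt u (lev y) else q u0.
pose g' (c : T + G) : V := match c with inl t => g t | inr y => lab (ptG y) end.
have ptG_near c y y' : Q c -> y \in c -> y' \in c -> mdist (ptG y) (ptG y') <=
  2 * delta.
  move=> Qc yc y'c.
  have [yM y0 ysupp _] := Qtop _ Qc _ yc; have [y'M y'0 y'supp _] := Qtop _ Qc
    _ y'c.
  have [j jM lj] := Qlev _ Qc.
  have [l1 l2] : (lev y <= (lev y').+1)%N /\ (lev y' <= (lev y).+1)%N.
    have := lj _ yc; have := lj _ y'c; rewrite !inE.
    by move=> h h'; split; lia.
  rewrite /ptG; case ty: (top y) => [u|]; case ty': (top y') => [u'|].
  - by apply: ptadj => //; exact: (Qadj _ Qc _ _ _ _ yc y'c ty ty').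
  - rewrite -(pt0 u) ptadj //; first exact: (Qadj _ Qc _ _ _ _ yc yc ty ty).
    by move: l1; rewrite (y'0 ty').
  - rewrite -(pt0 u') ptadj //; first exact: (Qadj _ Qc _ _ _ _ y'c y'c ty'
    ty').
    by move: l2; rewrite (y0 ty).
  - by rewrite mdistxx ltW.
(* The point [y] lies on the segment from the apex to [u] and is not the apex, so its carrier in [X]
   contains that of [u]. *)
have base_supp c y u : Q c -> y \in c -> top y = Some u ->
    finsupp (pos u) `<=` base_fset (finsupp (posG y)).
  move=> Qc yc ty; have [_ _ /(_ _ ty) uy _] := Qtop _ Qc _ yc.
  have [r [_ Yr] /(_ _ yc)[yr y0 _]] := (let: And3 h _ _ := subQ0 in h) _ Qc.
  have -> : base_fset (finsupp (posG y)) = finsupp (affine_ext pos (base (posQ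
    y))).
    by rewrite -finsupp_base /posG /= affine_ext_cone base_cone_point.
  apply: finsupp_affine_ext_sub.
  - by move=> v; rewrite baseE.
  - move=> v; rewrite finsupp_base mem_base_fset => vy.
    have vr : v \in base_fset r by rewrite mem_base_fset; exact: (fsubsetP yr).
    case: Yr => [h|/(let: And3 h _ _ := subY in h)[s _ /(_ _ vr)[]] //].
    by rewrite h in vr.
  - by rewrite finsupp_base mem_base_fset.
have labK x : K [fset lab x] by case: (labP x).
have labstar x : barycentric_star (lab x) x by case: (labP x).
have g'P : simplicial P K g'.
  move=> c [c0 Qc Xc]; have [out0|outn] := eqVneq (outer c) fset0.
    have cinr b : b \in c -> exists2 y, b = inr y & y \in inner c.
      case: b => [t|y] bc; last by exists y; rewrite ?mem_inner.
      by have : t \in outer c; [rewrite mem_outer|rewrite out0].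
    have /fset0Pn[b bc] := c0; have [y _ yc] := cinr b bc.
    have {}Qc : Q (inner c) by case: Qc => // h; rewrite h in yc.
    apply: flagK; first by apply/fset0Pn; exists (g' b); rewrite in_imfset.
    move=> v v' /imfsetP[b1 /= /cinr[y1 -> y1c] ->] /imfsetP[b2 /= /cinr[y2 ->
      y2c] ->].
    apply: (star_near_edge e0 thick (labK _) (labK _) (labstar _) (labstar _)).
    exact: ptG_near Qc y1c y2c.
  (* In a mixed simplex every inner vertex lies on the base of [Q], where [ptG y] is some [q u]. Its
     label is in the support of [p (w u)], hence of the form [g t] with [t] in the carrier of [u];
     so the whole image lies in the [g]-image of one simplex of [X]. *)
  have [Xo q0 _] := Xc outn.
  apply: simplex_face (gXK Xo) _ _; last first.
    by have /fset0Pn[b bc] := c0; apply/fset0Pn; exists (g' b);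
      rewrite in_imfset.
  apply/fsubsetP => v /imfsetP[[t|y] /= bc ->].
    by rewrite in_imfset //= inE mem_outer bc.
  have yi : y \in inner c by rewrite mem_inner.
  have {}Qc : Q (inner c) by case: Qc => // h; rewrite h in yi.
  have [_ _ _ ytop] := Qtop _ Qc _ yi.
  have [|ly ty] := ytop; first by rewrite -posGN q0.
  case tyE: (top y) ty => [u|] // _.
  have Yu : Y [fset u] by have := Qadj _ Qc _ _ _ _ yi yi tyE tyE;
    rewrite fsetUid.
  have := star_support e0 thick (labK (ptG y)) (labstar (ptG y)).
  have -> : ptG y = q u by rewrite /ptG tyE ly ptM.
  rewrite qE // Yw // => /imfsetP[t /= tu ->].
  rewrite in_imfset //= inE; apply/orP; right; apply/bigfcupP; exists y.
    by rewrite yi.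
  exact: (fsubsetP (base_supp _ _ _ Qc yi tyE)).
have iXP : simplicial X P inl.
  move=> s Xs; have /fset0Pn[t ts] := simplex_neq0 Xs.
  have oE : outer (@inl T G @` s) = s.
    apply/fsetP => a; rewrite mem_outer; apply/imfsetP/idP => [[b /= bs [->]]
      //|as_].
    by exists a.
  have iE : inner (@inl T G @` s) = fset0.
    apply/fsetP => y; rewrite mem_inner inE; apply/negP.
    by move=> /imfsetP[b /= bs].
  split; first by apply/fset0Pn; exists (inl t); rewrite in_imfset.
    by left.
  rewrite oE iE /base_carrier big_seq_fset0 fsetU0 => _; split=> //.
have [h [hh hb]] := cone_triangulation iXP x0 subP (fun=> erefl).
exists (T + G)%type, P, h, inl, iXP, g'; split=> //.
have fX : finite_set [set s : {fset T} | X s /\ #|` s| = d.+1].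
  exact: finite_finset.
pose SX := fset_set [set s : {fset T} | X s /\ #|` s| = d.+1].
have SXE s : s \in SX <-> X s /\ #|` s| = d.+1.
  by rewrite in_fset_set //; split => [/set_mem|/mem_set].
have SXn : #|` SX| = nX by [].
pose Ob s := None |` (@Some F @` box s).
have ObA s : s \in SX -> (#|` Ob s| <= A.+1)%N.
  move=> /SXE[Xs ds]; apply: leq_trans (leq_card_fsetU _ _) _.
  rewrite cardfs1 add1n ltnS; apply: leq_trans (leq_imfset_card _ _ _) _.
  exact: boxA.
have Qin c : Q c -> exists2 s, s \in SX & forall J,
    (forall y, y \in c -> lev y \in J) -> c `<=` lbox J (Ob s).
  move=> /Qbox[r [r0 Yr] rbox].
  have [s sX rs] : exists2 s, s \in SX & base_fset r `<=` box s.
    case: Yr => [->|/Ybox[s [Xs ds rs]]]; last by exists s => //; apply/SXE.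
    have [[s Xs] /(_ _ Xs)[t [Xt dt _]]] := dimX.
    by exists t; [apply/SXE|exact: fsub0set].
  exists s => // J; apply: rbox; apply/fsubsetP => -[u|_]; last by rewrite !inE.
  rewrite -mem_base_fset => /(fsubsetP rs) us.
  by rewrite !inE in_imfset.
pose comb (r : {fset T}) (s : {fset G}) : {fset T + G} :=
  (inl @` r) `|` (inr @` s).
have combE (c : {fset T + G}) : c = comb (outer c) (inner c).
  apply/fsetP => b; rewrite inE; apply/idP/orP => [bc|[]].
  - by case: b bc => [t|y] bc; [left|right]; rewrite in_imfset //= ?mem_outer
    ?mem_inner.
  - by move=> /imfsetP[t /=]; rewrite mem_outer => tc ->.
  - by move=> /imfsetP[y /=]; rewrite mem_inner => yc ->.
(* [SP] contains all candidates for simplices of [P]. An inner one is fixed by a [d]-simplex, two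
   consecutive levels and a subset of the box. A mixed one is fixed by a face of a [d]-simplex and a
   subset of a box at level [M]; the two [d]-simplices are chosen independently, which costs one
   more factor [nX]. *)
pose SQ := \bigcup_(s <- SX) \bigcup_(j <- [fset val k | k in 'I_M])
  fpowerset (lbox [fset j; j.+1] (Ob s)).
pose SB := \bigcup_(s <- SX) fpowerset (lbox [fset M] (Ob s)).
pose SR := \bigcup_(s <- SX) fpowerset s.
pose SP := [fset comb fset0 s | s in SQ] `|` [fset comb rs.1 rs.2 | rs in SR
  `*` SB].
have PSP c : P c -> c \in SP.
  move=> [c0 Qc Xc]; rewrite (combE c) inE.
  have [out0|outn] := eqVneq (outer c) fset0; apply/orP; [left|right].
    rewrite out0; apply: in_imfset => /=.
    have {}Qc : Q (inner c).
      case: Qc => // inn0; move: c0; rewrite (combE c) out0 inn0.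
      by case/fset0Pn => b; rewrite inE => /orP[] /imfsetP[].
    have [s sX sJ] := Qin _ Qc; have [j jM lj] := Qlev _ Qc.
    apply/bigfcupP; exists s; rewrite ?sX //; apply/bigfcupP; exists j.
      by rewrite -[j]/(val (Ordinal jM)) in_imfset.
    by rewrite fpowersetE sJ.
  have [Xo q0 _] := Xc outn.
  have [s [Xs ds os]] := (proj2 dimX) _ Xo.
  have sX : s \in SX by apply/SXE.
  apply/imfsetP; exists (outer c, inner c) => //=; rewrite in_fsetM /=;
    apply/andP; split.
    apply/bigfcupP; exists s; rewrite ?sX // fpowersetE.
    by apply: fsubset_trans os; exact: fsubsetUl.
  case: Qc => [->|Qc].
    by apply/bigfcupP; exists s; rewrite ?sX // fpowersetE fsub0set.
  have [s' s'X sJ] := Qin _ Qc; apply/bigfcupP; exists s'; rewrite ?s'X //.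
  rewrite fpowersetE; apply: sJ => y yc; rewrite inE.
  have [_ _ _ [|-> //]] := Qtop _ Qc _ yc; first by rewrite -posGN q0.
have lboxB (J : {fset nat}) s : s \in SX -> (#|` J| <= 2)%N ->
    (#|` fpowerset (lbox J (Ob s))| <= B)%N.
  move=> sX J2; rewrite card_fpowerset leq_exp2l //.
  apply: leq_trans (lboxM _ _) _; rewrite leq_mul // leq_exp2l //.
  exact: ObA.
have cSQ : (#|` SQ| <= nX * (M * B))%N.
  rewrite -SXn; apply: card_bigfcup_le => s sX.
  apply: leq_trans (card_bigfcup_le (m := B) _) _; last first.
    rewrite leq_mul2r; apply/orP; right; apply: leq_trans (leq_imfset_card _ _
      _) _.
    by rewrite /= -cardE card_ord.
  move=> j _; apply: lboxB => //.
  by rewrite cardfs2; case: eqP.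
have cSB : (#|` SB| <= nX * B)%N.
  rewrite -SXn; apply: card_bigfcup_le => s sX; apply: lboxB => //.
  by rewrite cardfs1.
have cSR : (#|` SR| <= nX * 2 ^ d.+1)%N.
  rewrite -SXn; apply: card_bigfcup_le => s /SXE[_ ds].
  by rewrite card_fpowerset ds.
have cSP : (#|` SP| <= nX * (M * B) + nX * 2 ^ d.+1 * (nX * B))%N.
  apply: leq_trans (leq_card_fsetU _ _) _; apply: leq_add.
    by apply: leq_trans (leq_imfset_card _ _ _) _; exact: cSQ.
  apply: leq_trans (leq_imfset_card _ _ _) _.
  by apply: leq_trans (card_fsetM SR SB) _; exact: leq_mul.
(* With [M = nX * A] layers, the inner simplices also contribute a multiple of [nX ^ 2]. *)
have -> : (B * (A + 2 ^ d.+1) * nX ^ 2 = nX * (M * B) + nX * 2 ^ d.+1 * (nX *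
  B))%N.
  by rewrite /M; nia.
(* The bound holds for the simplices of all dimensions together, in particular for those of
   dimension [d.+1]. *)
apply: leq_trans cSP; apply: fsubset_leq_card; apply/fsubsetP => c.
by rewrite in_fset_set => [/set_mem[Pc _]|]; [exact: PSP|exact: finite_finset].
Qed.

End ConeFilling.

Theorem theorem2p13 (R : realType) (d : nat) (V : choiceType) (K : complex V)
    (dK : metric R (realization R K)) :
  (0 < d)%N -> flag K -> CAT0 (metrized dK) ->
  bounded_shapes dK d -> thick_shapes dK ->
  exists2 f : nat -> nat, quadratic f &
    forall (T : finType) (X : complex T) (g : T -> V),
      dimensional d X -> connected [set: polyhedron R X] -> simplicial X K g ->
      exists (U : finType) (P : complex U)
        (h : polyhedron R P -> cone R (polyhedron R X))
        (i : T -> U) (iXP : simplicial X P i) (g' : U -> V),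
        [/\ homeomorphism h,
            forall x : polyhedron R X,
              h (realization_map iXP x) = cone_base R x,
            simplicial P K g',
            forall t, X [fset t] -> g' (i t) = g t
          & (nb_simplices d.+1 P <= f (nb_simplices d X))%N].
Proof.
move=> _ flagK catK boundedK [e e0 thickK].
have delta0 : 0 < e / 2 by rewrite divr_gt0.
have [N [W [L [p [subL diamL cardL]]]]] := boundedK _ delta0.
pose A := (N * 2 ^ d.+1)%N.
exists (fun n => (2 ^ (2 * 2 ^ A.+1) * (A + 2 ^ d.+1)) * n ^ 2)%N.
  (* The summand [2 ^ d.+1] keeps the leading coefficient positive even when [N] is 0, as degree
     exactly 2 requires. *)
  by apply: quadratic_monomial; rewrite muln_gt0 addn_gt0 !expn_gt0 /= orbT.
have e2 : 2 * (e / 2) = e by rewrite mulrC divfK.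
move=> T X g dimX connX gXK.
apply: (ex_cone_filling flagK catK delta0 _ subL diamL cardL dimX connX gXK).
by rewrite e2.
Qed.
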